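(* Let $Z$ be a nonzero holomorphic vector field on the complex $n$-manifold $M$ that is associated to a gradient Kähler Ricci soliton $g$. Then $Z$ is linearizable at each of its singular points. Moreover, the linear part of $Z$ at a singular point is diagonalizable and has all its eigenvalues real.
   Context: A gradient Kähler Ricci soliton on $M$ is a Kähler metric $g$ for which there exists a real-valued function $f$ (a Ricci potential) with $\mathrm{Ric}(g)=\nabla^2 f$; its associated holomorphic vector field is $Z=\frac12(\nabla f-iJ(\nabla f))$. A singular point of $Z$ is a point $p$ with $Z(p)=0$. The linear part of $Z$ at a singular point $p$ is the linear map $Z'_p:T_pM\to T_pM$ with $Z'_p(v)=[V,Z](p)$ for any holomorphic vector field $V$ near $p$ with $V(p)=v$; in $p$-centered holomorphic coordinates in which $Z=Z^j(z)\,\partial/\partial z^j$ its matrix is $\left(\frac{\partial Z^j}{\partial z^l}(0)\right)$. $Z$ is linearizable near a singular point $p$ if there are $p$-centered holomorphic coordinates $w=(w^i)$ on an open neighborhood of $p$ and constants $a^i_j$ such that $Z=a^i_j\,w^j\,\frac{\partial}{\partial w^i}$ there. *)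

(* Defs.v *)
From HB Require Import structures.
From mathcomp Require Import all_boot all_order all_algebra.
From mathcomp Require Import complex.
From mathcomp Require Import all_classical all_reals all_analysis.

Set Implicit Arguments.
Unset Strict Implicit.
Unset Printing Implicit Defensive.

Import Order.TTheory GRing.Theory Num.Theory.
Import numFieldNormedType.Exports.

Local Open Scope classical_set_scope.
Local Open Scope ring_scope.

(* The metric topology of the norm of R[i]. *)
HB.instance Definition _ (R : realType) := PseudoPointedMetric.copy R[i] R[i]^o.

(* Conventions.  Points and tangent vectors are row vectors, so a linear map   *)
(* acts by v |-> v *m A, 'J f x has (l, j) entry d_l f^j, and matrices of      *)
(* linear maps are the transposes of the ones for column vectors.  Tensor      *)
(* fields on a manifold are families of components, one for every chart of    *)
(* the (maximal) atlas, subject to the usual transformation laws; the         *)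
(* components in the chart c are only meaningful at points of dom c.          *)

Section RealCoordinates.
Context {R : realType}.

Section Smooth.
Context {m : nat}.
Implicit Types (U : set 'rV[R]_m) (f : 'rV[R]_m -> R).

Definition partial (i : 'I_m) f : 'rV[R]_m -> R :=
  fun x => 'D_(delta_mx 0 i : 'rV[R]_m) f x.

(* Class C^k on U; used for open U only. *)
Fixpoint class_C (k : nat) U f : Prop :=
  (forall x, U x -> {for x, continuous f}) /\
  match k with
  | 0 => True
  | k'.+1 => forall i : 'I_m,
      (forall x, U x -> derivable f x (delta_mx 0 i : 'rV[R]_m)) /\
      class_C k' U (partial i f)
  end.

Definition smooth_on U f : Prop := forall k, class_C k U f.

End Smooth.

(* Riemannian geometry of a metric G with components G x j k. *)
Section LocalRiemannian.
Context {m : nat}.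
Variable G : 'rV[R]_m -> 'M[R]_m.
Implicit Types (i j k l : 'I_m) (x : 'rV[R]_m) (f : 'rV[R]_m -> R).

(* christoffel k i j = Gamma^k_ij *)
Definition christoffel k i j x : R :=
  2^-1 * \sum_l invmx (G x) k l *
    (partial i (fun y => G y j l) x + partial j (fun y => G y i l) x
     - partial l (fun y => G y i j) x).

(* curvature l i j k is the l-th component of R(d_i, d_j) d_k, where          *)
(* R(X, Y) = [nabla_X, nabla_Y] - nabla_[X, Y].                               *)
Definition curvature l i j k x : R :=
  partial i (christoffel l j k) x - partial j (christoffel l i k) x
  + \sum_(s < m) (christoffel l i s x * christoffel s j k x
                  - christoffel l j s x * christoffel s i k x).

(* Ric(Y, W) = tr (X |-> R(X, Y) W) *)
Definition ricci x : 'M[R]_m := \matrix_(j, k) \sum_i curvature i i j k x.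

(* Second covariant derivative of f for the Levi-Civita connection. *)
Definition hessian f x : 'M[R]_m :=
  \matrix_(i, j) (partial i (partial j f) x
                  - \sum_k christoffel k i j x * partial k f x).

Definition gradient f x : 'rV[R]_m :=
  (\row_i partial i f x) *m invmx (G x).

End LocalRiemannian.

End RealCoordinates.

Section ComplexCoordinates.
Context {R : realType} {n : nat}.

(* R^(n + n) -> C^n, (x, y) |-> x + i y, and its inverse. *)
Definition to_complex (x : 'rV[R]_(n + n)) : 'rV[R[i]]_n :=
  \row_j Complex (x 0 (lshift n j)) (x 0 (rshift n j)).

Definition to_real (z : 'rV[R[i]]_n) : 'rV[R]_(n + n) :=
  row_mx (map_mx (@complex.Re R) z) (map_mx (@complex.Im R) z).

(* J d/dx^j = d/dy^j and J d/dy^j = - d/dx^j, acting on the right of rows. *)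
Definition Jmx : 'M[R]_(n + n) := block_mx 0 1%:M (- 1%:M) 0.

(* Z^j d/dz^j, with d/dz^j = (d/dx^j - i d/dy^j) / 2, in the real frame       *)
(* (d/dx, d/dy) of the complexified tangent space.                            *)
Definition hol_vector (Z : 'rV[R[i]]_n) : 'rV[R[i]]_(n + n) :=
  row_mx (2^-1 *: Z) (- (2^-1 * 'i%C) *: Z).

(* The complexified tangent vector (u - i J u) / 2. *)
Definition type10_part (u : 'rV[R]_(n + n)) : 'rV[R[i]]_(n + n) :=
  2^-1 *: (map_mx (@real_complex R) u
           - 'i%C *: map_mx (@real_complex R) (u *m Jmx)).

(* [V, W]^j = V^l d_l W^j - W^l d_l V^j for holomorphic fields. *)
Definition lie_bracket (V W : 'rV[R[i]]_n -> 'rV[R[i]]_n) (z : 'rV[R[i]]_n) :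
    'rV[R[i]]_n :=
  V z *m 'J W z - W z *m 'J V z.

End ComplexCoordinates.

(* A chart is a total map together with a total inverse; only the values of   *)
(* fwd on dom and of bwd on fwd @` dom matter.                                *)
Record chart (R : realType) (n : nat) (M : Type) := Chart {
  dom : set M;
  fwd : M -> 'rV[R[i]]_n;
  bwd : 'rV[R[i]]_n -> M }.

Section Charts.
Context {R : realType} {n : nat} {M : topologicalType}.
Implicit Types c d : chart R n M.

Definition is_chart c : Prop :=
  [/\ open (dom c),
      open (fwd c @` dom c),
      forall q, dom c q -> bwd c (fwd c q) = q,
      {within dom c, continuous (fwd c)} &
      {within fwd c @` dom c, continuous (bwd c)}].

Definition transition c d : 'rV[R[i]]_n -> 'rV[R[i]]_n := fwd d \o bwd c.

(* Holomorphy is complex (Frechet) differentiability at every point of an     *)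
(* open set: here differentiable is over the field R[i].                      *)
Definition compatible c d : Prop := forall q, dom c q -> dom d q ->
  differentiable (transition c d) (fwd c q) /\
  differentiable (transition d c) (fwd d q).

End Charts.

Record complexManifold (R : realType) (n : nat) := ComplexManifold {
  carrier :> topologicalType;
  manifold_hausdorff : hausdorff_space carrier;
  manifold_second_countable : @second_countable carrier;
  atlas : set (chart R n carrier);
  atlas_chart : forall c, atlas c -> is_chart c;
  atlas_cover : forall q : carrier, exists2 c, atlas c & dom c q;
  atlas_compatible : forall c d, atlas c -> atlas d -> compatible c d;
  atlas_maximal : forall c, is_chart c ->
    (forall d, atlas d -> compatible c d) -> atlas c }.

Section KahlerGeometry.
Context {R : realType} {n : nat} {M : complexManifold R n}.
Implicit Types (c d : chart R n M) (p q : M).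

Definition real_transition c d : 'rV[R]_(n + n) -> 'rV[R]_(n + n) :=
  to_real \o transition c d \o to_complex.

Definition real_image c : set 'rV[R]_(n + n) :=
  [set x | (fwd c @` dom c) (to_complex x)].

(* Coordinate expressions of a function on M, in real and complex coordinates. *)
Definition in_real c {T : Type} (F : M -> T) : 'rV[R]_(n + n) -> T :=
  fun x => F (bwd c (to_complex x)).

Definition in_complex c {T : Type} (F : M -> T) : 'rV[R[i]]_n -> T :=
  fun z => F (bwd c z).

Definition smooth_function (f : M -> R) : Prop :=
  forall c, atlas c -> smooth_on (real_image c) (in_real c f).

(* Z c q is the row of components Z^j, Z = Z^j d/dz^j, at q in the chart c. *)
Definition vector_field := chart R n M -> M -> 'rV[R[i]]_n.

Definition holomorphic_vector_field (Z : vector_field) : Prop :=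
  (forall c d q, atlas c -> atlas d -> dom c q -> dom d q ->
     Z d q = Z c q *m 'J (transition c d) (fwd c q)) /\
  (forall c q, atlas c -> dom c q ->
     differentiable (in_complex c (Z c)) (fwd c q)).

Definition vanishes_at (Z : vector_field) p : Prop :=
  forall c, atlas c -> dom c p -> Z c p = 0.

(* g c q is the Gram matrix of the metric at q in the real coordinate frame   *)
(* (d/dx, d/dy) of the chart c.                                               *)
Definition metric_tensor := chart R n M -> M -> 'M[R]_(n + n).

Definition riemannian_metric (g : metric_tensor) : Prop :=
  [/\ forall c d q, atlas c -> atlas d -> dom c q -> dom d q ->
        let A := 'J (real_transition c d) (to_real (fwd c q)) in
        g c q = A *m g d q *m A^T,
      forall c i j, atlas c ->
        smooth_on (real_image c) (in_real c (fun q => g c q i j)),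
      forall c q, atlas c -> dom c q -> (g c q)^T = g c q &
      forall c q (v : 'rV[R]_(n + n)), atlas c -> dom c q -> v != 0 ->
        0 < (v *m g c q *m v^T) 0 0].

(* Gram matrix of the Kahler form omega(u, v) = g(J u, v). *)
Definition kahler_form (g : metric_tensor) c q : 'M[R]_(n + n) :=
  Jmx *m g c q.

Definition kahler_metric (g : metric_tensor) : Prop :=
  [/\ riemannian_metric g,
      forall c q, atlas c -> dom c q -> Jmx *m g c q *m Jmx^T = g c q &
      forall c x i j k, atlas c -> real_image c x ->
        let omega a b := in_real c (fun q => kahler_form g c q a b) in
        partial i (omega j k) x + partial j (omega k i) x
        + partial k (omega i j) x = 0].

Definition ricci_potential (g : metric_tensor) (f : M -> R) : Prop :=
  smooth_function f /\
  forall c x, atlas c -> real_image c x ->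
    ricci (in_real c (g c)) x = hessian (in_real c (g c)) (in_real c f) x.

Definition gradient_kahler_ricci_soliton (g : metric_tensor) : Prop :=
  kahler_metric g /\ exists f, ricci_potential g f.

(* Z = (grad f - i J (grad f)) / 2 *)
Definition half_gradient_field (g : metric_tensor) (f : M -> R)
    (Z : vector_field) : Prop :=
  forall c x, atlas c -> real_image c x ->
    hol_vector (in_real c (Z c) x) =
    type10_part (gradient (in_real c (g c)) (in_real c f) x).

Definition associated_to_soliton (Z : vector_field) (g : metric_tensor) :
    Prop :=
  exists2 f, ricci_potential g f & half_gradient_field g f Z.

(* Since the atlas is maximal, its charts are exactly the holomorphic         *)
(* coordinate systems on open subsets of M.                                   *)
Definition linearizable_at (Z : vector_field) p : Prop :=
  exists w, [/\ atlas w, dom w p, fwd w p = 0 &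
    exists A : 'M[R[i]]_n, forall q, dom w q -> Z w q = fwd w q *m A].

(* L is the matrix, in the frame d/dz^j of the chart c at p, of the map       *)
(* V(p) |-> [V, Z](p), V any holomorphic vector field near p.  Taking V with  *)
(* constant components shows that L is unique.                                *)
Definition is_linear_part (Z : vector_field) p c (L : 'M[R[i]]_n) : Prop :=
  forall V : 'rV[R[i]]_n -> 'rV[R[i]]_n,
    (\forall z \near fwd c p, differentiable V z) ->
    lie_bracket V (in_complex c (Z c)) (fwd c p) = V (fwd c p) *m L.

End KahlerGeometry.

Arguments vector_field {R n} M.
Arguments metric_tensor {R n} M.

(* Main.v *)
Require Import Defs.
From HB Require Import structures.
From mathcomp Require Import all_boot all_order all_algebra.
From mathcomp Require Import complex.
From mathcomp Require Import all_classical all_reals all_analysis.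
From mathcomp Require Import ring lra.

(** Let X = grad f, seen in the real coordinates of a chart.  By hypothesis X is the
real form of the holomorphic field Z, so its Jacobian commutes with J.  Put
K = J X.  The contraction of K with the Kahler form is - df, and the form is
closed, so by Cartan's formula K preserves it; being holomorphic, K preserves the
metric as well (gradient_killing).  Thus a zero of Z is a zero of a holomorphic
Killing field.

A flow of isometries with a fixed point is linearized by Bochner's averaging.
The flow itself is not constructed: the Euler maps x + h K x are isometries up to
o(h) (euler_almost_isometry), so their iterates up to any prescribed total time T
have Jacobians bounded independently of h and T (euler_iterates).  With M the
derivative of the Euler map E at the zero, the mean u of E^k M^-k over k < N
satisfies u (E x) - u x M = O (1 / N) by telescoping, which says that u carries K
to its linear part up to an error O (1 / T) (almost_linearization).  The maps u
are holomorphic, so the Cauchy estimate (cauchy_estimate) turns the bound on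
their Jacobians into a Lipschitz bound for the Jacobians (jac_lipschitz).  Hence
the u have a limit that is differentiable, has derivative 1 at the zero, and
carries K exactly to its linear part (exact_linearization).  By the inverse
function theorem the limit is a holomorphic coordinate system
(inverse_function, chart_change), in which K is linear, and so is Z, which is K
multiplied by - i.

For the linear part, differentiate X G = df, where G is the Gram matrix of the
metric.  At a zero of X this exhibits DX G as the matrix of second derivatives of
f, which is symmetric (zero_self_adjoint).  So the linear part of Z is
self-adjoint for a Hermitian inner product, and the spectral theorem makes it
diagonalizable with real eigenvalues (self_adjoint_diagonalizable). *)

Set Implicit Arguments.
Unset Strict Implicit.
Unset Printing Implicit Defensive.

Import Order.TTheory GRing.Theory Num.Theory.
Import numFieldNormedType.Exports.

Local Open Scope classical_set_scope.
Local Open Scope ring_scope.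


(** * The maximum norm of matrices *)

Section MatrixNorm.
Context {K : numDomainType}.

Lemma mx_norm_leP m n (A : 'M[K]_(m, n)) c : 0 <= c ->
  (`|A| <= c <-> forall i j, `|A i j| <= c).
Proof.
move=> c0; rewrite {1}/Num.norm /= mx_normE -[c]/((NngNum c0)%:num) num_le.
split=> [/bigmax_leP[_ H] i j|H].
  by have := H (i, j) erefl; rewrite -num_le.
by apply/bigmax_leP; split=> [|[i j] _]; rewrite -num_le//=; exact: H.
Qed.

Lemma entry_norm_le m n (A : 'M[K]_(m, n)) i j : `|A i j| <= `|A|.
Proof. by move: i j; apply/(mx_norm_leP _ (normr_ge0 A)). Qed.

Lemma mulmx_norm_le m n p (A : 'M[K]_(m, n)) (B : 'M[K]_(n, p)) :
  `|A *m B| <= n%:R * `|A| * `|B|.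
Proof.
apply/mx_norm_leP; first by rewrite !mulr_ge0.
move=> i j; rewrite mxE (le_trans (ler_norm_sum _ _ _))//.
rewrite -mulrA mulr_natl -[n in _ *+ n]card_ord -sumr_const ler_sum// => k _.
by rewrite normrM ler_pM// entry_norm_le.
Qed.

End MatrixNorm.

(** * Jacobians of maps between row spaces *)

Section HasJac.
Context {K : numFieldType}.

(** The Jacobian of a map is a matrix even where the map is not differentiable;
this predicate asserts differentiability and the value of the Jacobian at once,
so that the rules of calculus deliver both. *)
Definition hasjac m n (f : 'rV[K]_m -> 'rV[K]_n) (x : 'rV[K]_m)
  (A : 'M[K]_(m, n)) : Prop := is_diff x f (mulmxr A).

Lemma mulmxr_continuous m n p (A : 'M[K]_(m, n)) :
  continuous (mulmxr A : 'M[K]_(p, m) -> 'M[K]_(p, n)).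
Proof.
apply/(@linear_bounded_continuous _ _ _ (mulmxr A : {linear 'M[K]_(p, m) -> 'M[K]_(p, n)})).
apply/linear_boundedP; exists (m%:R * `|A|); split=> [|c Ac x /=]; first by rewrite ger0_real ?mulr_ge0.
apply: (le_trans (mulmx_norm_le _ _)).
by rewrite mulrAC ler_wpM2r// ltW.
Qed.

Lemma hasjacP m n (f : 'rV[K]_m -> 'rV[K]_n) x (A : 'M[K]_(m, n)) :
  hasjac f x A <-> forall e, 0 < e ->
    \forall h \near (0 : 'rV[K]_m), `|f (x + h) - f x - h *m A| <= e * `|h|.
Proof.
split=> [[df dE] e e0|H].
  have /diff_locallyP[_] := df; rewrite dE => /eqaddoP/(_ _ e0).
  by apply: filterS => h /=; rewrite !fctE /= opprD addrA (addrC h x).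
have E : f \o shift x = cst (f x) + mulmxr A +o_ (0 : 'rV[K]_m) id.
  apply/eqaddoP => e e0; near=> h; rewrite !fctE /= opprD addrA (addrC h x).
  by near: h; exact: H.
have dE := diff_unique (@mulmxr_continuous m n 1 A) E.
apply: DiffDef => //; apply/diff_locallyP; split; last by rewrite dE.
by rewrite dE; exact: mulmxr_continuous.
Unshelve. all: by end_near. Qed.

Lemma hasjac_differentiable m n (f : 'rV[K]_m -> 'rV[K]_n) x A :
  hasjac f x A <-> differentiable f x /\ 'J f x = A.
Proof.
split=> [[df dE]|[df <-]].
  by split=> //; rewrite /jacobian dE; apply/row_matrixP => i; rewrite rowE mul_rV_lin1 /= -rowE.
by apply: DiffDef => //; apply/funext => h /=; rewrite /jacobian mul_rV_lin1.
Qed.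

Lemma hasjac_comp m n p (f : 'rV[K]_m -> 'rV[K]_n) (g : 'rV[K]_n -> 'rV[K]_p)
  x A B : hasjac f x A -> hasjac g (f x) B -> hasjac (g \o f) x (A *m B).
Proof.
move=> fA gB; have := is_diff_comp fA gB; rewrite /hasjac.
by move/is_diff_eq; apply; apply/funext => h /=; rewrite mulmxA.
Qed.

Lemma hasjacD m n (f g : 'rV[K]_m -> 'rV[K]_n) x A B :
  hasjac f x A -> hasjac g x B -> hasjac (f \+ g) x (A + B).
Proof.
move=> fA gB; have := is_diffD fA gB; rewrite /hasjac.
by move/is_diff_eq; apply; apply/funext => h /=; rewrite mulmxDr.
Qed.

Lemma hasjacN m n (f : 'rV[K]_m -> 'rV[K]_n) x A :
  hasjac f x A -> hasjac (fun y => - f y) x (- A).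
Proof.
move=> fA; have := is_diffN fA; rewrite /hasjac.
by move/is_diff_eq; apply; apply/funext => h /=; rewrite mulmxN.
Qed.

Lemma hasjacZ m n (f : 'rV[K]_m -> 'rV[K]_n) x A (c : K) :
  hasjac f x A -> hasjac (fun y => c *: f y) x (c *: A).
Proof.
move=> fA; have := is_diffZ c fA; rewrite /hasjac.
by move/is_diff_eq; apply; apply/funext => h /=; rewrite -scalemxAr.
Qed.

Lemma hasjac_id m (x : 'rV[K]_m) : hasjac id x 1%:M.
Proof.
have := is_diff_id x; rewrite /hasjac.
by move/is_diff_eq; apply; apply/funext => h /=; rewrite mulmx1.
Qed.

Lemma hasjac_cst m n (c : 'rV[K]_n) (x : 'rV[K]_m) : hasjac (cst c) x 0.
Proof.
have := is_diff_cst c x; rewrite /hasjac.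
by move/is_diff_eq; apply; apply/funext => h /=; rewrite mulmx0.
Qed.

Lemma hasjac_mulmx m n (A : 'M[K]_(m, n)) x : hasjac (fun y => y *m A) x A.
Proof.
apply/hasjacP => e e0; near=> h.
by rewrite mulmxDl addrAC addrK subrr normr0 mulr_ge0// ltW.
Unshelve. all: by end_near. Qed.

Lemma hasjac_sum m n N (f : 'I_N -> 'rV[K]_m -> 'rV[K]_n) x A :
  (forall k, hasjac (f k) x (A k)) ->
  hasjac (fun y => \sum_(k < N) f k y) x (\sum_(k < N) A k).
Proof.
elim: N f A => [|N IH] f A H.
  have -> : (fun y => \sum_(k < 0) f k y) = cst 0.
    by apply/funext => y; rewrite big_ord0.
  by rewrite big_ord0; exact: hasjac_cst.
have -> : (fun y => \sum_(k < N.+1) f k y) =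
    (fun y => \sum_(k < N) f (widen_ord (leqnSn N) k) y) \+ f ord_max.
  by apply/funext => y; rewrite big_ord_recr.
by rewrite big_ord_recr /=; apply: hasjacD; [apply: IH|].
Qed.

Lemma hasjac_near m n (f g : 'rV[K]_m -> 'rV[K]_n) x A :
  (\forall y \near x, f y = g y) -> hasjac f x A -> hasjac g x A.
Proof.
move=> fg /hasjacP H; apply/hasjacP => e e0.
have fgx : f x = g x by exact: nbhs_singleton fg.
have fg0 : \forall h \near (0 : 'rV[K]_m), f (x + h) = g (x + h).
  move: fg; rewrite (near_shift 0 x) subr0 => fg.
  by near=> h; rewrite addrC; near: h; exact: fg.
near=> h; rewrite -fgx -(near fg0 h)//; near: h; exact: H.
Unshelve. all: by end_near. Qed.

Lemma hasjac_continuous m n (f : 'rV[K]_m -> 'rV[K]_n) x A :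
  hasjac f x A -> {for x, continuous f}.
Proof. by case=> /differentiable_continuous. Qed.

Lemma hasjac_derive m n (f : 'rV[K]_m -> 'rV[K]_n) x A v :
  hasjac f x A -> is_derive x v f (v *m A).
Proof.
move=> /hasjac_differentiable[df <-]; split; first exact: diff_derivable.
exact: deriveEjacobian.
Qed.

Lemma is_derive_line (V W : normedModType K) (f : V -> W) (x v : V) (s : K) df :
  is_derive (x + s *: v) v f df -> is_derive s 1 (fun t => f (x + t *: v)) df.
Proof.
have E : (fun h : K => h^-1 *: ((f (x + (h *: 1 + s) *: v)) - f (x + s *: v))) =
         (fun h : K => h^-1 *: (f (h *: v + (x + s *: v)) - f (x + s *: v))).
  apply/funext => h; congr (_ *: (f _ - _)).
  by rewrite -[h *: 1]/(h * 1) mulr1 scalerDl addrCA.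
move=> [D E']; split; first by rewrite /derivable /= E.
by rewrite -E' /derive /= E.
Qed.

End HasJac.

(** * Limits of matrices *)

Section MatrixLimits.
Context {K : numFieldType} {T : Type} {F : set_system T} {FF : Filter F}.

Lemma cvg_mxP p q (M : T -> 'M[K]_(p, q)) (A : 'M[K]_(p, q)) :
  M @ F --> A <-> forall i j, (fun x => M x i j) @ F --> A i j.
Proof.
split=> [H i j|H].
  exact: (cvg_comp M (fun N : 'M[K]_(p, q) => N i j) H (@coord_continuous K p q i j A)).
apply/cvgrPdist_le => e e0.
have : \forall x \near F, forall i j, `|A i j - M x i j| <= e.
  apply: filter_forall => i; apply: filter_forall => j.
  by have /cvgrPdist_le := H i j; exact.
apply: filterS => x Hx; apply/mx_norm_leP; first exact: ltW.
by move=> i j; rewrite !mxE.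
Qed.

Lemma cvg_mulmx p q r (M : T -> 'M[K]_(p, q)) (N : T -> 'M[K]_(q, r))
  (A : 'M[K]_(p, q)) (B : 'M[K]_(q, r)) :
  M @ F --> A -> N @ F --> B -> (fun x => M x *m N x) @ F --> A *m B.
Proof.
move=> /cvg_mxP HM /cvg_mxP HN; apply/cvg_mxP => i j; rewrite mxE.
under eq_fun do rewrite mxE.
apply: cvg_big => [|k _]; first exact: add_continuous.
exact: cvgM.
Qed.

Lemma cvg_trmx p q (M : T -> 'M[K]_(p, q)) (A : 'M[K]_(p, q)) :
  M @ F --> A -> (fun x => (M x)^T) @ F --> A^T.
Proof.
move=> /cvg_mxP HM; apply/cvg_mxP => i j; rewrite mxE.
under eq_fun do rewrite mxE; exact: HM.
Qed.

End MatrixLimits.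

(** * Mean value inequalities *)

Section MeanValue.
Context {R : realType}.

Lemma hasjac_coord_derive m n (f : 'rV[R]_m -> 'rV[R]_n) x A v j :
  hasjac f x A -> is_derive x v (fun y => f y 0 j) ((v *m A) 0 j).
Proof.
move=> /(hasjac_derive v)[df E]; split; first exact: (proj1 (derivable_mxP _ _ _) df 0 j).
by rewrite -E derive_mx// mxE.
Qed.

Lemma mean_value_ineq (f f' : R -> R) (c : R) :
  (forall t : R, 0 <= t <= 1 -> is_derive t 1 f (f' t)) ->
  (forall t : R, 0 <= t <= 1 -> `|f' t| <= c) -> `|f 1 - f 0| <= c.
Proof.
move=> fd fc.
have [t] : exists2 t, t \in `[0, 1]%R & f 1 - f 0 = f' t * (1 - 0).
  apply: MVT_segment => //.
    by move=> t; rewrite in_itv /= => /andP[a b]; apply: fd; rewrite !ltW.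
  apply: derivable_within_continuous => t; rewrite in_itv /= => tab.
  by have [] := fd _ tab.
by rewrite in_itv /= subr0 mulr1 => tab ->; exact: fc.
Qed.

(** For the maximum norm it suffices to bound each coordinate, a real function
on the segment. *)
Lemma mean_value_hasjac m n (f : 'rV[R]_m -> 'rV[R]_n) (Df : 'rV[R]_m -> 'M[R]_(m, n))
  x y c : 0 <= c ->
  (forall t : R, 0 <= t <= 1 -> hasjac f (x + t *: (y - x)) (Df (x + t *: (y - x)))) ->
  (forall t : R, 0 <= t <= 1 -> `|(y - x) *m Df (x + t *: (y - x))| <= c) ->
  `|f y - f x| <= c.
Proof.
move=> c0 fd fc; apply/mx_norm_leP => // i j; rewrite ord1 !mxE.
have := @mean_value_ineq (fun t => f (x + t *: (y - x)) 0 j)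
  (fun t => ((y - x) *m Df (x + t *: (y - x))) 0 j) c.
rewrite scale1r subrKC scale0r addr0; apply => t t01.
  apply: (is_derive_line (f := fun z => f z 0 j)).
  by apply: hasjac_coord_derive; exact: fd.
exact: le_trans (entry_norm_le _ _ _) (fc _ t01).
Qed.

End MeanValue.

(** * Curves of matrices *)

Section Curves.
Context {R : realType}.

(** Entrywise, so that the product rule for matrices of different sizes reduces
to the one for numbers. *)
Definition mderiv p q (M : R -> 'M[R]_(p, q)) (t : R) (M' : 'M[R]_(p, q)) :=
  forall i j, is_derive t 1 (fun s => M s i j) (M' i j).

Lemma mderivP p q (M : R -> 'M[R]_(p, q)) t M' :
  mderiv M t M' <-> is_derive t 1 M M'.
Proof.
split=> [H|[D E] i j].
  have D : derivable M t 1 by apply/derivable_mxP => i j; have [] := H i j.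
  split=> //; rewrite derive_mx//; apply/matrixP => i j; rewrite mxE.
  by have [_ ->] := H i j.
split; first exact: (proj1 (derivable_mxP _ _ _) D i j).
by rewrite -E derive_mx// mxE.
Qed.

Lemma mderiv_cst p q (A : 'M[R]_(p, q)) t : mderiv (fun=> A) t 0.
Proof. by move=> i j; rewrite mxE; exact: is_derive_cst. Qed.

Lemma mderivD p q (M N : R -> 'M[R]_(p, q)) t M' N' :
  mderiv M t M' -> mderiv N t N' -> mderiv (fun s => M s + N s) t (M' + N').
Proof.
move=> HM HN i j; rewrite mxE.
have -> : (fun s => (M s + N s) i j) = (fun s => M s i j) + (fun s => N s i j).
  by apply/funext => s; rewrite mxE.
exact: is_deriveD.
Qed.

Lemma mderivM p q r (M : R -> 'M[R]_(p, q)) (N : R -> 'M[R]_(q, r)) t M' N' :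
  mderiv M t M' -> mderiv N t N' ->
  mderiv (fun s => M s *m N s) t (M' *m N t + M t *m N').
Proof.
move=> HM HN i j; rewrite !mxE -big_split /=.
have -> : (fun s => (M s *m N s) i j) =
    \sum_(k < q) ((fun s => M s i k) * (fun s => N s k j)).
  by apply/funext => s; rewrite mxE fct_sumE.
apply: is_derive_sum => k; have := is_deriveM (HM i k) (HN k j).
by rewrite addrC [_ *: M' i k]mulrC.
Qed.

Lemma mderiv_scale p q (c : R -> R) (A : 'M[R]_(p, q)) (t c' : R) :
  is_derive t 1 c c' -> mderiv (fun s => c s *: A) t (c' *: A).
Proof.
move=> Hc i j; rewrite mxE.
have -> : (fun s => (c s *: A) i j) = (A i j) \*: c.
  by apply/funext => s; rewrite mxE /= mulrC.
have := is_deriveZ (A i j) Hc.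
by rewrite [_ *: c']mulrC.
Qed.

Lemma mderivZ p q (c : R -> R) (M : R -> 'M[R]_(p, q)) (t c' : R) M' :
  is_derive t 1 c c' -> mderiv M t M' ->
  mderiv (fun s => c s *: M s) t (c' *: M t + c t *: M').
Proof.
move=> Hc HM i j; rewrite !mxE.
have -> : (fun s => (c s *: M s) i j) = c * (fun s => M s i j).
  by apply/funext => s; rewrite mxE.
have := is_deriveM Hc (HM i j).
by rewrite addrC [_ *: c']mulrC.
Qed.

Lemma mderiv_id p q (A : 'M[R]_(p, q)) t : mderiv (fun s => s *: A) t A.
Proof. by rewrite -[A in mderiv _ _ A]scale1r; exact: (@mderiv_scale _ _ id). Qed.

Lemma mderiv_comp m n (c : R -> 'rV[R]_m) (F : 'rV[R]_m -> 'rV[R]_n) t c' A :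
  mderiv c t c' -> hasjac F (c t) A -> mderiv (F \o c) t (c' *m A).
Proof.
move=> /mderivP Hc HF; apply/mderivP; have [D E] := Hc.
have dc : differentiable c t by apply/derivable1_diffP.
have dd := differentiableP dc.
have HFc := is_diff_comp dd HF; have [dFc dE] := HFc.
split; first exact/derivable1_diffP.
rewrite deriveE// dE /= -E deriveE//.
Qed.

Lemma is_derive_affine (f : R -> R) (a b t df : R) :
  is_derive (a + t * b) 1 f df -> is_derive t 1 (fun s => f (a + s * b)) (b * df).
Proof.
move=> Hf; have Hl : is_derive t 1 (fun s : R => a + s * b) b.
  have -> : (fun s : R => a + s * b) = cst a + (b \*: id).
    by apply/funext => s; rewrite !fctE /= mulrC.
  have := is_deriveD (is_derive_cst a t 1) (is_deriveZ b (is_derive_id t 1)).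
  by rewrite add0r [_ *: 1]mulr1.
have H := @is_derive1_comp R f (fun s => a + s * b) t _ _ Hf Hl.
by move: H; rewrite /comp mulrC; apply.
Qed.

Lemma mderiv_affine p q (M : R -> 'M[R]_(p, q)) a b t M' :
  mderiv M (a + t * b) M' -> mderiv (fun s => M (a + s * b)) t (b *: M').
Proof. by move=> HM i j; rewrite mxE; exact: is_derive_affine (HM i j). Qed.

Lemma mean_value_mderiv p q (M : R -> 'M[R]_(p, q)) (M' : R -> 'M[R]_(p, q)) a b c :
  a <= b -> 0 <= c ->
  (forall t, a <= t <= b -> mderiv M t (M' t)) ->
  (forall t, a <= t <= b -> `|M' t| <= c) -> `|M b - M a| <= c * (b - a).
Proof.
move=> ab c0 HM Hc.
have ba0 : 0 <= b - a by rewrite subr_ge0.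
have mem t : 0 <= t <= 1 -> a <= a + t * (b - a) <= b.
  case/andP=> t0 t1; rewrite lerDl mulr_ge0//= -[leRHS](subrKC a) lerD2l.
  by rewrite ler_piMl.
apply/mx_norm_leP; first by rewrite mulr_ge0.
move=> i j; rewrite !mxE.
have := @mean_value_ineq R (fun t => M (a + t * (b - a)) i j)
  (fun t => ((b - a) *: M' (a + t * (b - a))) i j) (c * (b - a)).
rewrite mul1r subrKC mul0r addr0; apply => t t01.
  exact: (mderiv_affine (HM _ (mem _ t01))).
rewrite mxE normrM mulrC (ger0_norm ba0) ler_wpM2r//.
exact: le_trans (entry_norm_le _ _ _) (Hc _ (mem _ t01)).
Qed.

End Curves.

(** * The Cauchy estimate *)

Section CauchyEstimate.
Context {R : realType} {m : nat}.
Variable J : 'M[R]_m.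
Hypothesis JJ : J *m J = - 1%:M.
Hypothesis Jle : forall w : 'rV[R]_m, `|w *m J| <= `|w|.

(* The rotation exp (tJ). *)
Let rot (t : R) : 'M[R]_m := cos t *: 1%:M + sin t *: J.

Lemma rot_norm (w : 'rV[R]_m) t : `|w *m rot t| <= 2 * `|w|.
Proof.
rewrite mulmxDr -!scalemxAr mulmx1 (le_trans (ler_normD _ _))// mulr_natl mulr2n.
rewrite !normrZ lerD//.
  by rewrite ler_piMl// ler_norml cos_geN1 cos_le1.
by rewrite (le_trans _ (Jle w))// ler_piMl// ler_norml sin_geN1 sin_le1.
Qed.

Lemma rotNK t : rot t *m rot (- t) = 1%:M.
Proof.
rewrite /rot cosN sinN mulmxDl !mulmxDr -!scalemxAl -!scalemxAr !mul1mx !mulmx1 JJ.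
apply/matrixP => i j; rewrite !mxE; set d := _%:R.
transitivity ((cos t ^+ 2 + sin t ^+ 2) * d); first by ring.
by rewrite cos2Dsin2 mul1r.
Qed.

Lemma mderiv_rot t : mderiv rot t (rot t *m J).
Proof.
rewrite /rot mulmxDl -!scalemxAl mul1mx JJ addrC scalerN -scaleNr.
by apply: mderivD; apply: mderiv_scale.
Qed.

Lemma mderiv_rotN t : mderiv (fun t => rot (- t)) t (- (rot (- t) *m J)).
Proof.
have := @mderiv_affine R _ _ rot 0 (-1) t (rot (- t) *m J).
rewrite mulrN1 add0r scaleN1r => /(_ (mderiv_rot _)).
by under eq_fun do rewrite mulrN1 add0r.
Qed.

Lemma rot0 : rot 0 = 1%:M.
Proof. by rewrite /rot cos0 sin0 scale1r scale0r addr0. Qed.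

Lemma rot2pi : rot (pi *+ 2) = 1%:M.
Proof. by rewrite /rot cos2pi sin2pi scale1r scale0r addr0. Qed.

Lemma rot_continuous : continuous rot.
Proof.
move=> t; apply: cvgD; apply: cvgZr_tmp; [exact: continuous_cos|exact: continuous_sin].
Qed.

Section Circle.
Variables (F : 'rV[R]_m -> 'rV[R]_m) (DF : 'rV[R]_m -> 'M[R]_m).
Variables (x v : 'rV[R]_m) (rho B : R).
Hypothesis Fd : forall y : 'rV[R]_m, `|y - x| < rho -> hasjac F y (DF y).
Hypothesis DFc : forall y : 'rV[R]_m, `|y - x| < rho -> {for y, continuous DF}.
Hypothesis DFJ : forall y : 'rV[R]_m, `|y - x| < rho -> DF y *m J = J *m DF y.
Hypothesis Fb : forall y : 'rV[R]_m, `|y - x| < rho -> `|F y| <= B.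
Hypothesis vr : 2 * `|v| < rho.

(* In complex notation H r t / r is (F (x + r e^(it) v) - F x) / (r e^(it)),
whose mean over t is the Cauchy integral of the derivative of F along v.  Up
to the factors J and r^-2, P is the derivative of H in t and of H / r in r. *)
Let y r t := x + r *: (v *m rot t).
Let H r t := (F (y r t) - F x) *m rot (- t).
Let P r t := ((r *: (v *m rot t)) *m DF (y r t) - (F (y r t) - F x)) *m rot (- t).

Let yball r t : `|r| <= 1 -> `|y r t - x| < rho.
Proof.
move=> r1; rewrite /y addrC addKr normrZ (le_lt_trans _ vr)//.
by rewrite (le_trans _ (rot_norm v t))// ler_piMl.
Qed.

Let rotJ t : rot t *m J = J *m rot t.
Proof. by rewrite mulmxDl mulmxDr -!scalemxAl -!scalemxAr mul1mx mulmx1. Qed.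

Let dH r t : `|r| <= 1 -> mderiv (H r) t (P r t *m J).
Proof.
move=> r1.
have dy : mderiv (y r) t (r *: (v *m rot t *m J)).
  rewrite -[X in mderiv _ _ X]add0r; apply: mderivD; first exact: mderiv_cst.
  have -> : (fun s => r *: (v *m rot s)) = (fun s => (r *: v) *m rot s).
    by apply/funext => s; rewrite scalemxAl.
  have := mderivM (mderiv_cst (r *: v) t) (mderiv_rot t).
  by rewrite mul0mx add0r -!scalemxAl mulmxA.
have dF := mderiv_comp dy (Fd (yball t r1)).
have := mderivM (mderivD dF (mderiv_cst (- F x) t)) (mderiv_rotN t).
rewrite addr0 /P mulmxN; congr (mderiv _ _ _).
move: (F (y r t) - F x) => D; rewrite !mulmxBl -[D *m _ *m J]mulmxA; congr (_ - _).
rewrite -!scalemxAl; congr (_ *: _).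
by rewrite -!mulmxA; congr (_ *m (_ *m _)); rewrite rotJ mulmxA -DFJ ?mulmxA// yball.
Qed.

Let dHr r t : 0 < r <= 1 -> mderiv (fun r => r^-1 *: H r t) r (r^-2 *: P r t).
Proof.
case/andP=> r0 r1.
have ar1 : `|r| <= 1 by rewrite ger0_norm// ltW.
have dy : mderiv (y^~ t) r (v *m rot t).
  rewrite -[X in mderiv _ _ X]add0r; apply: mderivD; first exact: mderiv_cst.
  exact: mderiv_id.
have dF := mderiv_comp dy (Fd (yball t ar1)).
have dHr := mderivM (mderivD dF (mderiv_cst (- F x) r)) (mderiv_cst (rot (- t)) r).
have rn0 : r != 0 by rewrite gt_eqF.
have dinv : is_derive r 1 (fun s : R => s^-1) (- r^-2).
  have := @is_deriveV R id r 1 1 rn0 (is_derive_id r 1).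
  by rewrite [_ *: 1]mulr1.
have := mderivZ dinv dHr.
rewrite addr0 mulmx0 addr0; congr (mderiv _ _ _).
rewrite /P /H /=; move: (F (y r t) - F x) => D.
rewrite mulmxBl scalerBr addrC scaleNr; congr (_ - _).
rewrite -!scalemxAl scalerA; congr (_ *: _).
by rewrite expr2 invfM -mulrA mulVf// mulr1.
Qed.

Let cP r t : `|r| <= 1 -> {for (r, t), continuous (fun p : R * R => P p.1 p.2)}.
Proof.
move=> r1.
have cr : (fun p : R * R => rot p.2) @ (r, t) --> rot t.
  apply: (cvg_comp (fun p : R * R => p.2) rot); last exact: rot_continuous.
  exact: cvg_snd.
have cvr : (fun p : R * R => p.1 *: (v *m rot p.2)) @ (r, t) --> r *: (v *m rot t).
  apply: cvgZ; first exact: cvg_fst.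
  by apply: cvg_mulmx => //; exact: cvg_cst.
have cy : (fun p : R * R => y p.1 p.2) @ (r, t) --> y r t.
  by apply: cvgD => //; exact: cvg_cst.
have cF := cvg_comp (fun p : R * R => y p.1 p.2) F cy (hasjac_continuous (Fd (yball t r1))).
have cDF := cvg_comp (fun p : R * R => y p.1 p.2) DF cy (DFc (yball t r1)).
apply: cvg_mulmx; last first.
  apply: (cvg_comp (fun p : R * R => - p.2) rot); last exact: rot_continuous.
  by apply: cvgN; exact: cvg_snd.
apply: cvgB; first exact: cvg_mulmx.
by apply: cvgB => //; exact: cvg_cst.
Qed.

(* Uniform continuity of P in t: near (r, t) the increment is small by
continuity, and finitely many such neighborhoods cover the rectangle. *)
Let uP e : 0 < e -> exists2 d, 0 < d & forall r t h, 0 <= r <= 1 ->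
  0 <= t <= pi *+ 2 -> `|h| < d -> `|P r (t + h) - P r t| <= e.
Proof.
move=> e0.
pose K := (`[0, 1]%classic : set R) `*` (`[0, pi *+ 2]%classic : set R).
have cK : compact K by apply: compact_setX; exact: segment_compact.
have /compact_near_coveringP/(_ R (nbhs (0 : R))
  (fun h p => `|P p.1 (p.2 + h) - P p.1 p.2| <= e)) := cK.
case=> [[r t] [] /=|d /= d0 dP].
  rewrite !in_itv /= => /andP[r0 r1] _.
  have ar1 : `|r| <= 1 by rewrite ger0_norm.
  have c0 : (fun p : R * R => P p.1 p.2) @ nbhs ((r, t) : R * R) --> P r t.
    exact: (@cP r t ar1).
  have c1 : (fun q : R * R * R => P q.1.1 (q.1.2 + q.2))
      @ filter_prod (nbhs (r, t)) (nbhs (0 : R)) --> P r t.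
    apply: (cvg_comp (fun q : R * R * R => (q.1.1, q.1.2 + q.2))
      (fun p : R * R => P p.1 p.2)); last exact: c0.
    have f1 : (fun q : R * R * R => q.1) @ filter_prod (nbhs (r, t)) (nbhs (0 : R))
        --> ((r, t) : R * R) by exact: cvg_fst.
    have p1 : (fun q : R * R * R => q.1.1) @ filter_prod (nbhs (r, t)) (nbhs (0 : R)) --> r.
      by apply: (cvg_comp (fun q : R * R * R => q.1) fst f1); exact: cvg_fst.
    have p2 : (fun q : R * R * R => q.1.2 + q.2)
        @ filter_prod (nbhs (r, t)) (nbhs (0 : R)) --> t.
      rewrite -[X in _ --> X]addr0; apply: cvgD; last exact: cvg_snd.
      by apply: (cvg_comp (fun q : R * R * R => q.1) snd f1); exact: cvg_snd.
    exact: cvg_pair p1 p2.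
  have c2 : (fun q : R * R * R => P q.1.1 q.1.2)
      @ filter_prod (nbhs (r, t)) (nbhs (0 : R)) --> P r t.
    exact: (cvg_comp fst (fun p : R * R => P p.1 p.2) cvg_fst c0).
  have c3 : (fun q : R * R * R => P q.1.1 (q.1.2 + q.2) - P q.1.1 q.1.2)
      @ filter_prod (nbhs (r, t)) (nbhs (0 : R)) --> (0 : 'rV[R]_m).
    by rewrite -(subrr (P r t)); exact: cvgB.
  by move/cvgr0_norm_le : c3; exact.
exists d => // r t h r01 t01 hd; apply: (dP h _ (r, t)).
  by rewrite /ball_ /= sub0r normrN.
by split; rewrite /= in_itv.
Qed.

Let H0 r : H r (pi *+ 2) = H r 0.
Proof. by rewrite /H /y oppr0 rot0 rot2pi /rot cosN sinN cos2pi sin2pi oppr0 scale1r scale0r addr0. Qed.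

(* The integral of P J = dH/dt over the circle vanishes because H is periodic.
Integrals are replaced by sums over N.+1 equidistant points; by the uniform
continuity of P the same N serves all radii r. *)
Let sumP e : 0 < e -> exists N, forall r, 0 <= r <= 1 ->
  `|\sum_(k < N.+1) P r (k%:R * (pi *+ 2 / N.+1%:R))| <= N.+1%:R * e.
Proof.
move=> e0; have [d d0 dP] := uP e0.
have pi20 : 0 < pi *+ 2 :> R by rewrite mulrn_wgt0// pi_gt0.
pose N := Num.truncn (pi *+ 2 / d); exists N => r r01.
set h := pi *+ 2 / N.+1%:R.
have N0 : 0 < N.+1%:R :> R by [].
have h0 : 0 < h by rewrite divr_gt0.
have hN : N.+1%:R * h = pi *+ 2 by rewrite mulrC divfK// gt_eqF.
have hd : h < d.
  by rewrite ltr_pdivrMr// mulrC -ltr_pdivrMr// truncnS_gt.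
have ar1 : `|r| <= 1 by case/andP: r01 => r0 r1; rewrite ger0_norm.
pose th k : R := k%:R * h.
have thS k : th k.+1 = th k + h by rewrite /th -natr1 mulrDl mul1r.
have step (k : 'I_N.+1) : `|H r (th k.+1) - H r (th k) - h *: (P r (th k) *m J)| <= e * h.
  have th0 : 0 <= th k by rewrite mulr_ge0// ltW.
  have th1 : th k.+1 <= pi *+ 2 by rewrite -hN ler_wpM2r ?(ltW h0)// ler_nat.
  have := @mean_value_mderiv R _ _ (fun t => H r t + t *: - (P r (th k) *m J))
    (fun t => P r t *m J - P r (th k) *m J) (th k) (th k.+1) e.
  rewrite thS lerDl [th k + h - th k]addrC addKr.
  have -> : H r (th k + h) + (th k + h) *: - (P r (th k) *m J) -
     (H r (th k) + th k *: - (P r (th k) *m J)) =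
     H r (th k + h) - H r (th k) - h *: (P r (th k) *m J).
    by rewrite opprD addrACA -scalerBl (addrC (th k)) addrK scalerN.
  apply; [exact: ltW|exact: ltW| |].
    by move=> t tk; apply: mderivD; [exact: dH|exact: mderiv_id].
  move=> t /andP[t1 t2]; rewrite -mulmxBl (le_trans (Jle _))//.
  have {1}-> : t = th k + (t - th k) by rewrite subrKC.
  apply: dP => //; first by rewrite th0 (le_trans _ th1)// thS lerDl ltW.
  by rewrite ger0_norm ?subr_ge0// (le_lt_trans _ hd)// lerBlDl.
have tele : \sum_(k < N.+1) (H r (th k.+1) - H r (th k)) = 0.
  rewrite -(big_mkord xpredT (fun k => H r (th k.+1) - H r (th k))).
  by rewrite telescope_sumr// /th hN mul0r H0 subrr.
set S := \sum_(k < _) _.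
have SJ : `|h *: (S *m J)| <= N.+1%:R * e * h.
  rewrite -normrN -[X in - X]subr0 opprB -[X in X - _]tele mulmx_suml scaler_sumr -sumrB.
  rewrite (le_trans (ler_norm_sum _ _ _))// -mulrA mulr_natl.
  by rewrite -[N.+1 in leRHS]card_ord -sumr_const ler_sum.
have -> : S = - (S *m J *m J) by rewrite -mulmxA JJ mulmxN mulmx1 opprK.
rewrite normrN (le_trans (Jle _))//.
by move: SJ; rewrite normrZ gtr0_norm// mulrC ler_pM2r.
Qed.

(** Since d(H/r)/dr = P / r^2 has almost vanishing mean over t, the mean of
H / r hardly changes between r = r0, close to 0, and r = 1.  For r0 it is close
to v DF x by differentiability at x; for r = 1 it is at most 4 B: a factor 2
from the difference of two values of F, another 2 from the rotation, since the
maximum norm is not invariant under J-rotations. *)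
Lemma circle_estimate : `|v *m DF x| <= 4 * B.
Proof.
have xx : `|x - x| < rho by rewrite subrr normr0 (le_lt_trans _ vr)// mulr_ge0.
have B0 : 0 <= B by rewrite (le_trans _ (Fb xx)).
have [->|v0] := eqVneq v 0; first by rewrite mul0mx normr0 mulr_ge0.
have nv0 : 0 < `|v| by rewrite normr_gt0.
apply/ler_addgt0Pr => e e0.
have e20 : 0 < e / 2 by rewrite divr_gt0.
pose e1 := e / 2 / (4 * `|v|).
have e10 : 0 < e1 by rewrite divr_gt0// mulr_gt0.
have /nbhs_norm0P[d /= d0 dF] := proj1 (hasjacP _ _ _) (Fd xx) _ e10.
pose r0 := Num.min 1 (d / (4 * `|v|)).
have r00 : 0 < r0 by rewrite lt_min ltr01 divr_gt0// mulr_gt0.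
have r01 : r0 <= 1 by rewrite ge_min lexx.
have r0d : r0 * (2 * `|v|) < d.
  have : r0 <= d / (4 * `|v|) by rewrite ge_min lexx orbT.
  rewrite ler_pdivlMr ?mulr_gt0//; apply: lt_le_trans.
  by rewrite ltr_pM2l// ltr_pM2r// ltr_nat.
have Hr0 t : `|r0^-1 *: H r0 t - v *m DF x| <= e / 2.
  have E : v *m DF x = r0^-1 *: ((r0 *: (v *m rot t)) *m DF x *m rot (- t)).
    rewrite -!scalemxAl scalerA mulVf ?gt_eqF// scale1r.
    have rD : rot t *m DF x = DF x *m rot t.
      by rewrite mulmxDl mulmxDr -!scalemxAl -!scalemxAr mul1mx mulmx1 DFJ.
    by rewrite -(mulmxA v) rD -!mulmxA rotNK mulmx1.
  rewrite E -scalerBr -mulmxBl normrZ gtr0_norm ?invr_gt0// ler_pdivrMl//.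
  rewrite (le_trans (rot_norm _ _))//.
  have nh : `|r0 *: (v *m rot t)| <= r0 * (2 * `|v|).
    by rewrite normrZ gtr0_norm// ler_pM2l// rot_norm.
  have hh := dF _ (le_lt_trans nh r0d).
  rewrite -ler_pdivlMl// (le_trans hh)//.
  rewrite (le_trans (ler_wpM2l (ltW e10) nh))// /e1.
  have vn0 : `|v| != 0 by rewrite gt_eqF.
  by rewrite le_eqVlt; apply/orP; left; apply/eqP; field.
have H1 t : `|1^-1 *: H 1 t| <= 4 * B.
  rewrite invr1 scale1r (le_trans (rot_norm _ _))//.
  rewrite (_ : 4 * B = 2 * (2 * B)); last by ring.
  rewrite ler_wpM2l//.
  by rewrite (le_trans (ler_normB _ _))// mulr_natl mulr2n lerD// Fb// yball// normr1.
pose e2 := e / 2 * r0 ^+ 2.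
have e20' : 0 < e2 by rewrite mulr_gt0// exprn_gt0.
have [N NP] := sumP e20'.
pose th (k : nat) : R := k%:R * (pi *+ 2 / N.+1%:R).
pose S r := \sum_(k < N.+1) (r^-1 *: H r (th k)).
have N0 : 0 < N.+1%:R :> R by [].
have dS : `|S 1 - S r0| <= N.+1%:R * (e / 2).
  have := @mean_value_mderiv R _ _ S (fun r => r^-2 *: \sum_(k < N.+1) P r (th k)) r0 1
     (N.+1%:R * (e / 2)).
  have Ne0 : 0 <= N.+1%:R * (e / 2) by rewrite mulr_ge0// ltW.
  move=> /(_ r01 Ne0) H'.
  apply: le_trans (H' _ _) _.
  - move=> r /andP[ra rb]; rewrite /S scaler_sumr => i j.
    rewrite summxE.
    have -> : (fun s => (\sum_(k < N.+1) s^-1 *: H s (th k)) i j) =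
       \sum_(k < N.+1) (fun s => (s^-1 *: H s (th k)) i j).
      by apply/funext => s; rewrite summxE fct_sumE.
    apply: is_derive_sum => k.
    by apply: dHr; rewrite (lt_le_trans r00 ra).
  - move=> r /andP[ra rb]; have r_gt0 := lt_le_trans r00 ra.
    rewrite normrZ gtr0_norm ?invr_gt0 ?exprn_gt0// ler_pdivrMl ?exprn_gt0//.
    apply: le_trans (NP r _) _; first by rewrite rb ltW.
    rewrite (_ : _ * e2 = r0 ^+ 2 * (N.+1%:R * (e / 2))); last by rewrite /e2; ring.
    apply: ler_wpM2r; first by rewrite mulr_ge0// ltW.
    by apply: lerXn2r => //; rewrite nnegrE ltW.
  - by apply: ler_piMr; [rewrite mulr_ge0// ltW|rewrite lerBlDr lerDl ltW].
have S1 : `|S 1| <= N.+1%:R * (4 * B).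
  rewrite (le_trans (ler_norm_sum _ _ _))// mulr_natl.
  by rewrite -[N.+1 in leRHS]card_ord -sumr_const ler_sum.
have S0 : `|S r0 - N.+1%:R *: (v *m DF x)| <= N.+1%:R * (e / 2).
  rewrite scaler_nat -[N.+1 in X in _ - X]card_ord -sumr_const -sumrB.
  rewrite (le_trans (ler_norm_sum _ _ _))// mulr_natl.
  by rewrite -[N.+1 in leRHS]card_ord -sumr_const ler_sum.
have : `|N.+1%:R *: (v *m DF x)| <= N.+1%:R * (4 * B + e).
  have -> : N.+1%:R *: (v *m DF x) = S 1 - (S 1 - S r0) - (S r0 - N.+1%:R *: (v *m DF x)).
    by rewrite !subKr.
  rewrite (le_trans (ler_normB _ _))// [e]splitr addrA 2!mulrDr lerD//.
  by rewrite (le_trans (ler_normB _ _))// lerD.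
by rewrite normrZ gtr0_norm// ler_pM2l.
Qed.

End Circle.

(** The circle estimate needs 2 |v| < rho; scaling v to length rho / 4 turns 4 B
into 16 B / rho. *)
Lemma cauchy_estimate (F : 'rV[R]_m -> 'rV[R]_m) DF (x v : 'rV[R]_m) (rho B : R) :
  0 < rho ->
  (forall y : 'rV[R]_m, `|y - x| < rho -> hasjac F y (DF y)) ->
  (forall y : 'rV[R]_m, `|y - x| < rho -> {for y, continuous DF}) ->
  (forall y : 'rV[R]_m, `|y - x| < rho -> DF y *m J = J *m DF y) ->
  (forall y : 'rV[R]_m, `|y - x| < rho -> `|F y| <= B) ->
  `|v *m DF x| <= 16 * B / rho * `|v|.
Proof.
move=> rho0 Fd DFc DFJ Fb.
have [->|v0] := eqVneq v 0; first by rewrite mul0mx !normr0 mulr0.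
have nv0 : 0 < `|v| by rewrite normr_gt0.
pose c := rho / (4 * `|v|).
have c0 : 0 < c by rewrite divr_gt0// mulr_gt0.
have cv : c * `|v| = rho / 4 by rewrite /c; field; rewrite gt_eqF.
have := @circle_estimate F DF x (c *: v) rho B Fd DFc DFJ Fb.
rewrite -scalemxAl (normrZ c v) (normrZ c (v *m _)) (gtr0_norm c0) cv => H.
have {}H : c * `|v *m DF x| <= 4 * B by apply: H; lra.
rewrite -ler_pdivlMl// in H; rewrite (le_trans H)// /c le_eqVlt; apply/orP; left.
by apply/eqP; field; rewrite !gt_eqF.
Qed.

End CauchyEstimate.

(** * Bounds on compact sets and on segments *)

Section Compactness.
Context {R : realType}.

Lemma compact_norm_bound (T : topologicalType) (A : set T) (V : normedModType R)
    (f : T -> V) : compact A -> (forall x, A x -> {for x, continuous f}) ->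
  exists2 M, 0 < M & forall x, A x -> `|f x| <= M.
Proof.
move=> /compact_near_coveringP/(_ _ (pinfty_nbhs R) (fun M x => `|f x| <= M)) cA fc.
have [|M [_ HM]] := cA _.
  move=> x Ax; exists ([set y | `|f y| <= `|f x| + 1], [set M | `|f x| + 1 <= M]) => /=.
    split.
      have /cvgr_norm_le H := fc x Ax; apply: H.
      by rewrite ltrDl.
    exists (`|f x| + 1); split; first by rewrite num_real.
    by move=> y /ltW.
  by move=> [y M] /= [H1 H2]; exact: le_trans H2.
exists (`|M| + 1) => // x Ax.
by apply: HM => //; rewrite (le_lt_trans (ler_norm _))// ltrDl.
Qed.

(** The reciprocal of f is bounded. *)
Lemma compact_pos_bound (T : topologicalType) (A : set T) (f : T -> R) :
  compact A -> (forall x, A x -> {for x, continuous f}) ->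
  (forall x, A x -> 0 < f x) ->
  exists2 c, 0 < c & forall x, A x -> c <= f x.
Proof.
move=> cA fc f0.
have [|M M0 HM] := @compact_norm_bound T A R^o (fun x => (f x)^-1) cA.
  by move=> x Ax; apply: cvgV; [rewrite gt_eqF// f0|exact: fc].
exists M^-1 => [|x Ax]; first by rewrite invr_gt0.
have := HM x Ax; rewrite gtr0_norm ?invr_gt0 ?f0// => H.
by rewrite -[leRHS]invrK lef_pV2 ?posrE ?invr_gt0 ?f0.
Qed.

Lemma compact_closed_ball0 m (r : R) : compact [set x : 'rV[R]_m | `|x| <= r].
Proof.
apply: bounded_closed_compact.
  by exists r; split; [exact: num_real|move=> M rM x /= /le_trans; apply; exact: ltW].
have -> : [set x : 'rV[R]_m | `|x| <= r] = Num.norm @^-1` [set y | y <= r] by [].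
by apply: closed_comp; [move=> x _; exact: norm_continuous|exact: closed_le].
Qed.

Lemma quadform_le m (M : 'M[R]_m) (v : 'rV[R]_m) :
  `|(v *m M *m v^T) 0 0| <= m%:R ^+ 2 * `|M| * `|v| ^+ 2.
Proof.
have vT : `|v^T| <= `|v|.
  by apply/mx_norm_leP => // i j; rewrite mxE entry_norm_le.
rewrite (le_trans (entry_norm_le _ _ _))// (le_trans (mulmx_norm_le _ _))//.
rewrite -mulrA (le_trans (ler_wpM2l _ (ler_pM _ _ (mulmx_norm_le _ _) vT)))//.
by rewrite le_eqVlt; apply/orP; left; apply/eqP; ring.
Qed.

End Compactness.

Section BallSegment.
Context {R : realType}.

Lemma ball_segment_center m (a x y : 'rV[R]_m) (t r : R) : 0 <= t <= 1 ->
  `|x - a| < r -> `|y - a| < r -> `|x + t *: (y - x) - a| < r.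
Proof.
case/andP=> t0 t1 xr yr.
have -> : x + t *: (y - x) - a = (1 - t) *: (x - a) + t *: (y - a).
  by apply/matrixP => i j; rewrite !mxE; ring.
have r0 : 0 < r := le_lt_trans (normr_ge0 _) xr.
rewrite (le_lt_trans (ler_normD _ _))// !normrZ !ger0_norm ?subr_ge0//.
have := normr_ge0 (x - a); have := normr_ge0 (y - a).
have [->|tn0] := eqVneq t 0; first by rewrite subr0 mul1r mul0r addr0.
have tp : 0 < t by rewrite lt_neqAle eq_sym tn0.
by nra.
Qed.

Lemma ball_segment m (x y : 'rV[R]_m) (t r : R) : 0 <= t <= 1 ->
  `|x| < r -> `|y| < r -> `|x + t *: (y - x)| < r.
Proof.
by move=> t01 xr yr; have := @ball_segment_center m 0 x y t r t01; rewrite !subr0; apply.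
Qed.

End BallSegment.

(** * Lipschitz bounds for derivatives of holomorphic maps *)

Section LipschitzDerivative.
Context {R : realType} {m : nat}.
Variable J : 'M[R]_m.
Hypothesis JJ : J *m J = - 1%:M.
Hypothesis Jle : forall w : 'rV[R]_m, `|w *m J| <= `|w|.
Variables (F : 'rV[R]_m -> 'rV[R]_m) (DF : 'rV[R]_m -> 'M[R]_m) (rho L : R).
Hypothesis rho0 : 0 < rho.
Hypothesis L0 : 0 <= L.
Hypothesis Fd : forall y : 'rV[R]_m, `|y| < rho -> hasjac F y (DF y).
Hypothesis DFc : forall y : 'rV[R]_m, `|y| < rho -> {for y, continuous DF}.
Hypothesis DFJ : forall y : 'rV[R]_m, `|y| < rho -> DF y *m J = J *m DF y.
Hypothesis DFb : forall (y v : 'rV[R]_m), `|y| < rho -> `|v *m DF y| <= L * `|v|.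

Lemma lipschitz_of_jac (x y : 'rV[R]_m) : `|x| < rho -> `|y| < rho -> `|F y - F x| <= L * `|y - x|.
Proof.
move=> xr yr; apply: (@mean_value_hasjac _ _ _ _ DF); first by rewrite mulr_ge0.
  by move=> t t01; apply: Fd; exact: ball_segment.
by move=> t t01; apply: DFb; exact: ball_segment.
Qed.

(** The Cauchy estimate for z |-> F (z + h) - F z, h = y - x, on the ball of
radius rho / 4 about x, where it is bounded by L |h|. *)
Lemma jac_lipschitz (x y v : 'rV[R]_m) : `|x| < rho / 4 -> `|y| < rho / 4 ->
  `|v *m (DF y - DF x)| <= 64 * L / rho * `|y - x| * `|v|.
Proof.
move=> xr yr; pose h := y - x.
have hr : `|h| < rho / 2 by rewrite (le_lt_trans (ler_normB _ _))//; lra.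
have zr (z : 'rV[R]_m) : `|z - x| < rho / 4 -> `|z| < rho / 2.
  by move=> zx; rewrite -(subrK x z) (le_lt_trans (ler_normD _ _))//; lra.
have zr1 (z : 'rV[R]_m) : `|z - x| < rho / 4 -> `|z| < rho by move=> /zr zz; move: rho0 zz; lra.
have zr2 (z : 'rV[R]_m) : `|z - x| < rho / 4 -> `|z + h| < rho.
  by move=> /zr ?; rewrite (le_lt_trans (ler_normD _ _))//; lra.
have shj z : hasjac (fun z : 'rV[R]_m => z + h) z 1%:M.
  rewrite -[1%:M]addr0; apply: hasjacD; [exact: hasjac_id|exact: hasjac_cst].
have := @cauchy_estimate R m J JJ Jle (fun z => F (z + h) - F z)
  (fun z => DF (z + h) - DF z) x v (rho / 4) (L * `|h|).
have xh : x + h = y by rewrite subrKC.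
rewrite xh => H; apply: (le_trans (H _ _ _ _ _)).
- by rewrite divr_gt0.
- move=> z zx; apply: hasjacD; last by apply/hasjacN/Fd/zr1.
  by rewrite -[DF _]mul1mx; apply: (hasjac_comp (shj z)); apply/Fd/zr2.
- move=> z zx; have c1 : (fun z => z + h) @ z --> z + h by exact: hasjac_continuous (shj z).
  have c2 : (fun z => DF (z + h)) @ z --> DF (z + h).
    have H2 := DFc (zr2 z zx).
    by apply: (cvg_comp (fun z => z + h) DF c1).
  have H1 := DFc (zr1 z zx).
  exact: (cvgB c2 H1).
- by move=> z zx; rewrite mulmxBl mulmxBr (DFJ (zr1 z zx)) (DFJ (zr2 z zx)).
- move=> z zx; have := lipschitz_of_jac (zr1 z zx) (zr2 z zx).
  by rewrite [z + h - z]addrC addKr.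
by rewrite le_eqVlt; apply/orP; left; apply/eqP; field; rewrite gt_eqF.
Qed.

(** The mean value inequality for the map z |-> F z - z DF x, whose derivative
is small near x by the preceding lemma. *)
Lemma taylor_lipschitz (x y : 'rV[R]_m) : `|x| < rho / 4 -> `|y| < rho / 4 ->
  `|F y - F x - (y - x) *m DF x| <= 64 * L / rho * `|y - x| ^+ 2.
Proof.
move=> xr yr.
have C0 : 0 <= 64 * L / rho by rewrite divr_ge0 ?mulr_ge0// ltW.
have -> : F y - F x - (y - x) *m DF x =
    (F y - y *m DF x) - (F x - x *m DF x) by rewrite mulmxBl !opprB [X in _ + X = _]addrC addrACA [X in _ + X = _]addrC.
apply: (@mean_value_hasjac _ _ _ (fun z => F z - z *m DF x) (fun z => DF z - DF x)).
- by rewrite mulr_ge0// sqr_ge0.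
- move=> t t01; apply: hasjacD; last by apply/hasjacN/hasjac_mulmx.
  by apply: Fd; have := ball_segment t01 xr yr; move: rho0; lra.
- move=> t t01; rewrite (le_trans (jac_lipschitz _ xr (ball_segment t01 xr yr)))//.
  rewrite expr2 mulrA ler_wpM2r// ler_wpM2l// addrC addKr normrZ.
  by case/andP: t01 => t0 t1; rewrite ger0_norm// ler_piMl.
Qed.

End LipschitzDerivative.

(** * Euler maps of a Killing field and their means *)

Section KillingEuler.
Context {R : realType} {m : nat}.
Variables (K : 'rV[R]_m -> 'rV[R]_m) (DK : 'rV[R]_m -> 'M[R]_m).
Variables (G : 'rV[R]_m -> 'M[R]_m) (DG : 'I_m -> 'rV[R]_m -> 'M[R]_m).
Variables (J : 'M[R]_m) (r : R).
Hypothesis r_gt0 : 0 < r.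
Hypothesis Kd : forall x : 'rV[R]_m, `|x| < r -> hasjac K x (DK x).
Hypothesis DKc : forall x : 'rV[R]_m, `|x| < r -> {for x, continuous DK}.
Hypothesis DKJ : forall x : 'rV[R]_m, `|x| < r -> DK x *m J = J *m DK x.
Hypothesis Gd : forall x v : 'rV[R]_m, `|x| < r ->
  is_derive x v G (\sum_l v 0 l *: DG l x).
Hypothesis Gc : forall x : 'rV[R]_m, `|x| < r -> {for x, continuous G}.
Hypothesis DGc : forall (l : 'I_m) (x : 'rV[R]_m), `|x| < r -> {for x, continuous (DG l)}.
Hypothesis Gpos : forall x v : 'rV[R]_m, `|x| < r -> v != 0 -> 0 < (v *m G x *m v^T) 0 0.
Hypothesis killing : forall x : 'rV[R]_m, `|x| < r ->
  DK x *m G x + \sum_l K x 0 l *: DG l x + G x *m (DK x)^T = 0.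
Hypothesis K0 : K 0 = 0.

(* Iterates of the Euler map are kept in the ball A of radius r1; one further
step may leave it, but stays in the ball A0 of radius r0. *)
Let r1 := r / 2.
Let r1_gt0 : 0 < r1. Proof. by rewrite divr_gt0. Qed.
Let r1r : r1 < r. Proof. by rewrite /r1; move: r_gt0; lra. Qed.
Let A : set 'rV[R]_m := [set x | `|x| <= r1].
Let Ar (x : 'rV[R]_m) : `|x| <= r1 -> `|x| < r.
Proof. by move=> /le_lt_trans; apply. Qed.
Let cA : compact A. Proof. exact: compact_closed_ball0. Qed.

Let r0 := 3 / 4 * r.
Let r0r : r0 < r. Proof. by rewrite /r0; move: r_gt0; lra. Qed.
Let r1r0 : r1 < r0. Proof. by rewrite /r0 /r1; move: r_gt0; lra. Qed.
Let A0 : set 'rV[R]_m := [set x | `|x| <= r0].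
Let A0r (x : 'rV[R]_m) : `|x| <= r0 -> `|x| < r.
Proof. by move=> /le_lt_trans; apply. Qed.
Let cA0 : compact A0. Proof. exact: compact_closed_ball0. Qed.

Let Q (x v : 'rV[R]_m) : R := (v *m G x *m v^T) 0 0.

Let QZ x (a : R) v : Q x (a *: v) = a ^+ 2 * Q x v.
Proof.
by rewrite /Q linearZ /= -!scalemxAl -scalemxAr !mxE mulrA expr2.
Qed.

Let Q_upper : exists2 C, 0 < C & forall x v : 'rV[R]_m, `|x| <= r0 ->
  Q x v <= C * `|v| ^+ 2.
Proof.
have [M M0 HM] := @compact_norm_bound R _ A0 _ G cA0 (fun x Ax => Gc (A0r Ax)).
exists (m%:R ^+ 2 * M + 1) => [|x v xr].
  by rewrite ltr_wpDl// mulr_ge0 ?exprn_ge0// ltW.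
rewrite (le_trans (ler_norm _))// (le_trans (quadform_le _ _))//.
rewrite ler_wpM2r ?exprn_ge0// (le_trans (y := m%:R ^+ 2 * M))//.
  by rewrite ler_wpM2l ?exprn_ge0// HM.
by rewrite lerDl.
Qed.

(* By homogeneity it is enough to consider unit vectors. *)
Let Q_lower : exists2 c, 0 < c & forall x v : 'rV[R]_m, `|x| <= r0 ->
  c * `|v| ^+ 2 <= Q x v.
Proof.
pose S : set 'rV[R]_m := [set v | `|v| = 1].
have cS : compact S.
  apply: (@subclosed_compact _ _ [set v : 'rV[R]_m | `|v| <= 1]).
  - have -> : S = Num.norm @^-1` [set y : R | y = 1] by [].
    by apply: closed_comp; [move=> x _; exact: norm_continuous|exact: closed_eq].
  - exact: compact_closed_ball0.
  - by move=> v /= ->.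
have [|||c c0 Hc] := @compact_pos_bound R _ (A0 `*` S) (fun p => Q p.1 p.2).
- exact: compact_setX.
- move=> [x v] [/= Ax Sv].
  have c1 : (fun p : 'rV[R]_m * 'rV[R]_m => G p.1) @ (x, v) --> G x.
    by apply: (cvg_comp fst G); [exact: cvg_fst|exact: Gc (A0r Ax)].
  have c2 : (fun p : 'rV[R]_m * 'rV[R]_m => p.2 *m G p.1 *m (p.2)^T) @ (x, v)
     --> v *m G x *m v^T.
    apply: cvg_mulmx; last by apply: cvg_trmx; exact: cvg_snd.
    by apply: cvg_mulmx => //; exact: cvg_snd.
  by have /cvg_mxP := c2; apply.
- move=> [x v] [/= Ax Sv]; apply: Gpos; first exact: A0r.
  by rewrite -normr_gt0 Sv.
exists c => // x v xr.
have [->|v0] := eqVneq v 0.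
  by rewrite normr0 expr0n mulr0 /Q mul0mx mul0mx mxE.
have nv0 : `|v| != 0 by rewrite normr_eq0.
have -> : v = `|v| *: (`|v|^-1 *: v) by rewrite scalerA divff// scale1r.
rewrite QZ normrZ normr_id mulrC.
have u1 : `| `|v|^-1 *: v| = 1 by rewrite normrZ normfV normr_id mulVf.
by rewrite u1 mulr1 ler_wpM2l ?exprn_ge0//; exact: (Hc (x, `|v|^-1 *: v)).
Qed.

Let E (h : R) (x : 'rV[R]_m) := x + h *: K x.
Let DE (h : R) (x : 'rV[R]_m) : 'M[R]_m := 1%:M + h *: DK x.

(* The derivative in s of the pullback of the metric by E s; at s = 0 it is the
Lie derivative of the metric along K. *)
Let Phi (s : R) (x : 'rV[R]_m) : 'M[R]_m :=
  DK x *m G (E s x) *m (DE s x)^T +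
  DE s x *m (\sum_l K x 0 l *: DG l (E s x)) *m (DE s x)^T +
  DE s x *m G (E s x) *m (DK x)^T.

Let mderiv_pullback s (x : 'rV[R]_m) : `|E s x| < r ->
  mderiv (fun s => DE s x *m G (E s x) *m (DE s x)^T) s (Phi s x).
Proof.
move=> Er.
have dDE : mderiv (fun s => DE s x) s (DK x).
  rewrite -[X in mderiv _ _ X]add0r.
  by apply: mderivD; [exact: mderiv_cst|exact: mderiv_id].
have dDET : mderiv (fun s => (DE s x)^T) s (DK x)^T.
  move=> i j; rewrite mxE.
  have -> : (fun s => (DE s x)^T i j) = (fun s => DE s x j i).
    by apply/funext => t; rewrite mxE.
  exact: dDE.
have dG : mderiv (fun s => G (E s x)) s (\sum_l K x 0 l *: DG l (E s x)).
  apply/mderivP; apply: is_derive_line; exact: Gd.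
have := mderivM (mderivM dDE dG) dDET.
by rewrite mulmxDl.
Qed.

(* Phi is continuous at (x, 0), where it vanishes by the Killing equation, and
the ball is compact. *)
Let Phi_small e : 0 < e -> exists2 d, 0 < d & forall s (x : 'rV[R]_m),
  `|s| < d -> `|x| <= r1 -> `|E s x| < r0 /\ `|Phi s x| <= e.
Proof.
move=> e0; have /compact_near_coveringP/(_ R (nbhs (0 : R))
  (fun s x => `|E s x| < r0 /\ `|Phi s x| <= e)) := cA.
case=> [x /= Ax|d /= d0 dP]; last first.
  exists d => // s x sd xr; apply: (dP s _ x xr).
  by rewrite /ball_ /= sub0r normrN.
have xr := Ar Ax.
pose F := filter_prod (nbhs x) (nbhs (0 : R)).
have FF : Filter F by apply: filter_prod_filter.
have cx : (fun q : 'rV[R]_m * R => q.1) @ F --> x by exact: cvg_fst.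
have cs : (fun q : 'rV[R]_m * R => q.2) @ F --> (0 : R) by exact: cvg_snd.
have cK : (fun q : 'rV[R]_m * R => K q.1) @ F --> K x.
  by apply: (cvg_comp (fun q : 'rV[R]_m * R => q.1) K cx); exact: hasjac_continuous (Kd xr).
have cDK : (fun q : 'rV[R]_m * R => DK q.1) @ F --> DK x.
  by apply: (cvg_comp (fun q : 'rV[R]_m * R => q.1) DK cx); exact: DKc.
have cE : (fun q : 'rV[R]_m * R => E q.2 q.1) @ F --> x.
  rewrite -[X in _ --> X]addr0 -(scale0r (K x)).
  by apply: cvgD => //; exact: cvgZ.
have cDE : (fun q : 'rV[R]_m * R => DE q.2 q.1) @ F --> (1%:M : 'M[R]_m).
  rewrite -[X in _ --> X]addr0 -(scale0r (DK x)).
  by apply: cvgD; [exact: cvg_cst|exact: cvgZ].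
have cDET : (fun q : 'rV[R]_m * R => (DE q.2 q.1)^T) @ F --> (1%:M : 'M[R]_m).
  by rewrite -trmx1; exact: cvg_trmx.
have cG : (fun q : 'rV[R]_m * R => G (E q.2 q.1)) @ F --> G x.
  by apply: (cvg_comp (fun q : 'rV[R]_m * R => E q.2 q.1) G cE); exact: Gc.
have cDG : (fun q : 'rV[R]_m * R => \sum_l K q.1 0 l *: DG l (E q.2 q.1)) @ F
    --> \sum_l K x 0 l *: DG l x.
  apply: cvg_big => [|l _]; first exact: add_continuous.
  apply: cvgZ; first by have /cvg_mxP := cK; apply.
  by apply: (cvg_comp (fun q : 'rV[R]_m * R => E q.2 q.1) (DG l) cE); exact: DGc.
have cPhi : (fun q : 'rV[R]_m * R => Phi q.2 q.1) @ F --> (0 : 'M[R]_m).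
  have L0 : DK x *m G x *m 1%:M + 1%:M *m (\sum_l K x 0 l *: DG l x) *m 1%:M +
      1%:M *m G x *m (DK x)^T = 0 by rewrite !mul1mx !mulmx1 killing.
  have t1 : (fun q : 'rV[R]_m * R => DK q.1 *m G (E q.2 q.1) *m (DE q.2 q.1)^T) @ F
      --> DK x *m G x *m 1%:M by exact: cvg_mulmx (cvg_mulmx cDK cG) cDET.
  have t2 : (fun q : 'rV[R]_m * R => DE q.2 q.1 *m
      (\sum_l K q.1 0 l *: DG l (E q.2 q.1)) *m (DE q.2 q.1)^T) @ F
      --> 1%:M *m (\sum_l K x 0 l *: DG l x) *m 1%:M.
    exact: cvg_mulmx (cvg_mulmx cDE cDG) cDET.
  have t3 : (fun q : 'rV[R]_m * R => DE q.2 q.1 *m G (E q.2 q.1) *m (DK q.1)^T) @ F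
      --> 1%:M *m G x *m (DK x)^T.
    exact: cvg_mulmx (cvg_mulmx cDE cG) (cvg_trmx cDK).
  by rewrite -L0; exact: cvgD (cvgD t1 t2) t3.
have n1 : \forall q \near F, `|Phi q.2 q.1| <= e.
  by move/cvgr0_norm_le : cPhi; exact.
have n2 : \forall q \near F, `|E q.2 q.1| < r0.
  by move/cvgr_norm_lt : cE; apply; exact: le_lt_trans Ax r1r0.
exact: filterI.
Qed.

(** The first order term in h of the pulled back metric is its Lie derivative
along the Killing field K, which is zero; the error is therefore o(h), uniformly
on the ball. *)
Lemma euler_almost_isometry e : 0 < e -> exists2 d, 0 < d & forall h (x : 'rV[R]_m),
  0 < h < d -> `|x| <= r1 -> `|E h x| <= r0 /\
  forall v, Q (E h x) (v *m DE h x) <= (1 + e * h) * Q x v.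
Proof.
move=> e0; have [c c0 Qc] := Q_lower.
pose e' := e * c / (m%:R ^+ 2 + 1).
have m0 : 0 < m%:R ^+ 2 + 1 :> R by rewrite ltr_wpDl// exprn_ge0.
have e'0 : 0 < e' by rewrite divr_gt0// mulr_gt0.
have [d d0 dP] := Phi_small e'0; exists d => // h x /andP[h0 hd] xr.
have xr0 : `|x| <= r0 by rewrite (le_trans xr)// ltW.
have near_h t : 0 <= t <= h -> `|t| < d.
  by case/andP=> t0 th; rewrite ger0_norm// (le_lt_trans th).
split=> [|v].
  have [] := dP h x (near_h h _) xr; first by rewrite lexx ltW.
  by move=> /ltW.
have := @mean_value_mderiv R m m (fun s => DE s x *m G (E s x) *m (DE s x)^T)
  (Phi^~ x) 0 h e' (ltW h0) (ltW e'0).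
have D0 : DE 0 x = 1%:M by rewrite /DE scale0r addr0.
have E0 : E 0 x = x by rewrite /E scale0r addr0.
rewrite D0 E0 trmx1 mul1mx mulmx1 subr0 => H.
have {}H : `|DE h x *m G (E h x) *m (DE h x)^T - G x| <= e' * h.
  apply: H => t th; have [Er Ph] := dP t x (near_h t th) xr => //.
  by apply: mderiv_pullback; exact: lt_trans Er r0r.
have -> : Q (E h x) (v *m DE h x) =
  Q x v + (v *m (DE h x *m G (E h x) *m (DE h x)^T - G x) *m v^T) 0 0.
  rewrite mulmxBr mulmxBl [X in _ + X]mxE [X in _ + (_ + X)]mxE /Q addrC subrK.
  by rewrite trmx_mul !mulmxA.
rewrite mulrDl mul1r lerD2l (le_trans (ler_norm _))//.
rewrite (le_trans (quadform_le _ _))//.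
rewrite mulrAC (le_trans (ler_wpM2l _ H))// ?mulr_ge0 ?exprn_ge0//.
rewrite [leRHS]mulrAC.
rewrite (le_trans (y := e * c * `|v| ^+ 2 * h))//; last first.
  by rewrite ler_wpM2r ?(ltW h0)// -mulrA ler_wpM2l ?(ltW e0)// Qc.
rewrite [leLHS]mulrA ler_wpM2r ?(ltW h0)// mulrAC ler_wpM2r ?exprn_ge0//.
rewrite /e' mulrA ler_pdivrMr// [leLHS]mulrC ler_wpM2l ?mulr_ge0 ?(ltW e0) ?(ltW c0)//.
by rewrite lerDl.
Qed.

Let E0 h : E h 0 = 0.
Proof. by rewrite /E K0 scaler0 addr0. Qed.

Let Ed h x : `|x| < r -> hasjac (E h) x (DE h x).
Proof. by move=> xr; apply: hasjacD; [exact: hasjac_id|apply: hasjacZ; exact: Kd]. Qed.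

Let DEc h (x : 'rV[R]_m) : `|x| < r -> {for x, continuous (DE h)}.
Proof.
move=> xr; apply: (@cvgD _ _ _ (nbhs x) _ (cst 1%:M) (h \*: DK)).
  exact: cvg_cst.
exact: cvgZl_tmp (DKc xr).
Qed.

Let DEJ h (x : 'rV[R]_m) : `|x| < r -> DE h x *m J = J *m DE h x.
Proof.
by move=> xr; rewrite mulmxDl mulmxDr mul1mx mulmx1 -scalemxAl -scalemxAr DKJ.
Qed.

Fixpoint Diter (h : R) (k : nat) (x : 'rV[R]_m) : 'M[R]_m :=
  if k is k'.+1 then Diter h k' x *m DE h (iter k' (E h) x) else 1%:M.

Let iterE0 h k : iter k (E h) 0 = 0.
Proof. by elim: k => //= k ->. Qed.

(* For N steps of length h with accumulated distortion (1 + e)^N <= B, the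
bounds c and C of the metric give the common Lipschitz constant Lam of the first
N iterates.  The constant B is absolute: it depends neither on h nor on the
total time N h. *)
Section Iterates.
Variables (c C B Lam h e : R) (N : nat).
Hypothesis c0 : 0 < c.
Hypothesis Qc : forall x v : 'rV[R]_m, `|x| <= r0 -> c * `|v| ^+ 2 <= Q x v.
Hypothesis QC : forall x v : 'rV[R]_m, `|x| <= r0 -> Q x v <= C * `|v| ^+ 2.
Hypothesis Lam1 : 1 <= Lam.
Hypothesis LamP : B * C <= Lam ^+ 2 * c.
Hypothesis e0 : 0 <= e.
Hypothesis h0 : 0 < h.
Hypothesis stepP : forall x : 'rV[R]_m, `|x| <= r1 -> `|E h x| <= r0 /\
  forall v, Q (E h x) (v *m DE h x) <= (1 + e) * Q x v.
Hypothesis eN : (1 + e) ^+ N <= B.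

Let Lam0 : 0 < Lam. Proof. exact: lt_le_trans Lam1. Qed.

Let r2 := r1 / Lam.
Let r2r1 : r2 <= r1.
Proof. by rewrite ler_pdivrMr// ler_peMr// ltW. Qed.

Let Q_Lam k (x y v w : 'rV[R]_m) : (k <= N)%N -> `|x| <= r0 -> `|y| <= r0 ->
  Q y w <= (1 + e) ^+ k * Q x v -> `|w| <= Lam * `|v|.
Proof.
move=> kN xr yr H.
rewrite -(@ler_pXn2r _ 2) ?nnegrE ?mulr_ge0// ?(ltW Lam0)//.
rewrite -(ler_pM2l c0) (le_trans (Qc w yr))// (le_trans H)//.
have Q0 : 0 <= Q x v by rewrite (le_trans _ (Qc v xr))// mulr_ge0 ?exprn_ge0// ltW.
have e1 : 1 <= 1 + e by rewrite lerDl.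
have ekB : (1 + e) ^+ k <= B.
  by rewrite (le_trans _ eN)// ler_weXn2l.
rewrite (le_trans (ler_wpM2r Q0 ekB))//.
have B0 : 0 <= B by rewrite (le_trans _ ekB)// exprn_ge0// (le_trans _ e1).
rewrite (le_trans (ler_wpM2l B0 (QC v xr)))// exprMn mulrA.
by rewrite [leRHS]mulrA (mulrC c) ler_wpM2r// exprn_ge0.
Qed.

(** As long as the iterates stay in the ball of radius r1 they are almost
isometries, hence Lam-Lipschitz; as they fix 0, starting within r1 / Lam keeps
them in that ball.  The two facts are proved by one induction. *)
Lemma euler_iterates k : (k <= N)%N -> forall x : 'rV[R]_m, `|x| <= r2 ->
  [/\ `|iter k (E h) x| <= r1, hasjac (iter k (E h)) x (Diter h k x),
      {for x, continuous (Diter h k)}, Diter h k x *m J = J *m Diter h k x &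
      forall v, Q (iter k (E h) x) (v *m Diter h k x) <= (1 + e) ^+ k * Q x v].
Proof.
elim: k => [_ x xr|k IH kN x xr].
  split=> /=; first exact: le_trans xr r2r1.
  - exact: hasjac_id.
  - exact: (@cst_continuous _ _ (1%:M : 'M[R]_m) x).
  - by rewrite mul1mx mulmx1.
  - by move=> v; rewrite mulmx1 expr0 mul1r.
have jac (y : 'rV[R]_m) : `|y| <= r2 ->
    hasjac (iter k.+1 (E h)) y (Diter h k.+1 y).
  move=> yr; have [y1 yj _ _ _] := IH (ltnW kN) y yr.
  by apply: (hasjac_comp yj); apply: Ed; exact: Ar.
have QD (y : 'rV[R]_m) v : `|y| <= r2 ->
    Q (iter k.+1 (E h) y) (v *m Diter h k.+1 y) <= (1 + e) ^+ k.+1 * Q y v.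
  move=> yr; have [y1 _ _ _ yQ] := IH (ltnW kN) y yr.
  rewrite /= mulmxA (le_trans ((stepP y1).2 _))// exprS -mulrA ler_wpM2l ?yQ//.
  by rewrite addr_ge0.
have [x1 xj xc xJ _] := IH (ltnW kN) x xr.
have DE_le (y v : 'rV[R]_m) : `|y| <= r2 -> `|v *m Diter h k.+1 y| <= Lam * `|v|.
  move=> yr; have [y1 _ _ _ _] := IH (ltnW kN) y yr.
  have yr0 : `|y| <= r0 by rewrite (le_trans yr)// (le_trans r2r1)// ltW.
  exact: Q_Lam kN yr0 (stepP y1).1 (QD y v yr).
split; last by move=> v; exact: QD.
- rewrite -[X in `|X|]subr0 -[X in _ - X](iterE0 h k.+1).
  have xL : Lam * `|x| <= r1 by rewrite mulrC -ler_pdivlMr.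
  apply: le_trans xL.
  apply: (@mean_value_hasjac R m m (iter k.+1 (E h)) (Diter h k.+1) 0 x).
  + by rewrite mulr_ge0// ltW.
  + move=> t /andP[t0 t1]; apply: jac; rewrite subr0 add0r normrZ ger0_norm//.
    by rewrite (le_trans _ xr)// ler_piMl.
  + move=> t /andP[t0 t1]; rewrite subr0 add0r; apply: DE_le.
    by rewrite normrZ ger0_norm// (le_trans _ xr)// ler_piMl.
- exact: jac.
- apply: (@cvg_mulmx R _ (nbhs x) _ m m m (Diter h k)
    (fun y => DE h (iter k (E h) y))) => //.
  apply: (cvg_comp (iter k (E h)) (DE h)); last exact: DEc (Ar x1).
  exact: hasjac_continuous xj.
- by rewrite /= -mulmxA (DEJ _ (Ar x1)) mulmxA xJ -mulmxA.
Qed.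

Let r2_ge0 : 0 <= r2.
Proof. by rewrite divr_ge0// ltW. Qed.

Let r2r0 (x : 'rV[R]_m) : `|x| <= r2 -> `|x| <= r0.
Proof. by move=> xr; rewrite (le_trans xr)// (le_trans r2r1)// ltW. Qed.

Let Diter_norm k (x v : 'rV[R]_m) : (k <= N)%N -> `|x| <= r2 ->
  `|v *m Diter h k x| <= Lam * `|v|.
Proof.
move=> kN xr; have [x1 _ _ _ xQ] := euler_iterates kN xr.
have x10 : `|iter k (E h) x| <= r0 by rewrite (le_trans x1)// ltW.
exact: Q_Lam kN (r2r0 xr) x10 (xQ v).
Qed.

(* The derivative at 0 of the Euler map. *)
Let M : 'M[R]_m := DE h 0.
Let Mi : 'M[R]_m := invmx M.

Let zr : `|0 : 'rV[R]_m| < r. Proof. by rewrite normr0. Qed.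
Let zr0 : `|0 : 'rV[R]_m| <= r0. Proof. by rewrite normr0 (le_trans _ (ltW r1r0))// ltW. Qed.

(* DK 0 is skew for the inner product G 0, since the Killing equation at the
zero 0 of K has no derivative of G; so M = 1 + h DK 0 does not shorten vectors
and the powers of its inverse are bounded. *)
Let M_expand (v : 'rV[R]_m) : Q 0 v <= Q 0 (v *m M).
Proof.
have skew : DK 0 *m G 0 + G 0 *m (DK 0)^T = 0.
  have := killing zr; rewrite K0 big1 ?addr0// => l _.
  by rewrite mxE scale0r.
have MGM : M *m G 0 *m M^T = G 0 + h ^+ 2 *: (DK 0 *m G 0 *m (DK 0)^T).
  rewrite /M /DE linearD /= trmx1 linearZ /= mulmxDl mul1mx mulmxDr mulmx1 mulmxDl.
  rewrite -!scalemxAl -!scalemxAr scalerA -expr2 -!addrA; congr (_ + _).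
  by rewrite addrA -scalerDr skew scaler0 add0r.
have -> : Q 0 (v *m M) = Q 0 v + h ^+ 2 * Q 0 (v *m DK 0).
  have -> : Q 0 (v *m M) = (v *m (M *m G 0 *m M^T) *m v^T) 0 0.
    by rewrite /Q trmx_mul !mulmxA.
  rewrite MGM mulmxDr mulmxDl mxE; congr (_ + _).
  by rewrite -scalemxAr -scalemxAl mxE /Q trmx_mul !mulmxA.
by rewrite lerDl mulr_ge0 ?sqr_ge0// (le_trans _ (Qc _ zr0))// mulr_ge0 ?sqr_ge0// ltW.
Qed.

Let M_unit : M \in unitmx.
Proof.
rewrite -row_free_unit -kermx_eq0; apply/rowV0P => v /sub_kermxP vM.
apply/eqP; apply: contraT => v0.
have := M_expand v; rewrite vM leNgt => /negP; case.
by rewrite {1}/Q !mul0mx mxE; exact: Gpos.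
Qed.

Let Mi_norm k (v : 'rV[R]_m) : `|v *m Mi ^+ k| <= Lam * `|v|.
Proof.
have Mi_contract (w : 'rV[R]_m) : Q 0 (w *m Mi) <= Q 0 w.
  by have := M_expand (w *m Mi); rewrite mulmxKV.
apply: (@Q_Lam 0 0 0) => //; rewrite expr0 mul1r.
elim: k => [|k IH]; first by rewrite expr0 mulmx1.
by rewrite exprSr -mulmxE mulmxA (le_trans (Mi_contract _)).
Qed.

Let MMi k : M ^+ k *m Mi ^+ k = 1%:M.
Proof.
elim: k => [|k IH]; first by rewrite !expr0 mulmx1.
by rewrite exprSr exprS -!mulmxE mulmxA -(mulmxA (M ^+ k)) mulmxV// mulmx1.
Qed.

Let Diter0 k : Diter h k 0 = M ^+ k.
Proof.
elim: k => [|k IH]; first by rewrite expr0.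
by rewrite /= iterE0 IH exprSr mulmxE.
Qed.

Let MiJ k : Mi ^+ k *m J = J *m Mi ^+ k.
Proof.
have MJ : M *m J = J *m M by exact: DEJ.
have MiJ1 : Mi *m J = J *m Mi.
  by apply: (can_inj (mulKmx M_unit)); rewrite mulKVmx// !mulmxA MJ mulmxK.
elim: k => [|k IH]; first by rewrite expr0 mul1mx mulmx1.
by rewrite exprS -!mulmxE -mulmxA IH !mulmxA MiJ1.
Qed.

Hypothesis N0 : (0 < N)%N.

(** Bochner's mean of the maps of a flow, each followed by the inverse of its
derivative at the fixed point, with Euler iterates in place of the flow. *)
Definition euler_mean (x : 'rV[R]_m) : 'rV[R]_m :=
  N%:R^-1 *: \sum_(k < N) iter k (E h) x *m Mi ^+ k.
Definition euler_mean_jac (x : 'rV[R]_m) : 'M[R]_m :=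
  N%:R^-1 *: \sum_(k < N) Diter h k x *m Mi ^+ k.

Let NR0 : 0 < N%:R :> R. Proof. by rewrite ltr0n. Qed.

Lemma euler_mean_regular (x : 'rV[R]_m) : `|x| <= r2 ->
  [/\ hasjac euler_mean x (euler_mean_jac x), {for x, continuous euler_mean_jac},
      euler_mean_jac x *m J = J *m euler_mean_jac x &
      forall v : 'rV[R]_m, `|v *m euler_mean_jac x| <= Lam ^+ 2 * `|v|].
Proof.
move=> xr.
have it (k : 'I_N) := euler_iterates (ltnW (ltn_ord k)) xr.
split.
- apply: hasjacZ; apply: hasjac_sum => k; have [_ kj _ _ _] := it k.
  exact: (hasjac_comp kj (hasjac_mulmx (Mi ^+ k) (iter k (E h) x))).
- apply: (@cvgZl_tmp _ _ _ (nbhs x) _ N%:R^-1 (fun y => \sum_(k < N) Diter h k y *m Mi ^+ k)).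
  apply: cvg_big => [|k _]; first exact: add_continuous.
  have [_ _ kc _ _] := it k.
  by apply: cvg_mulmx; [exact: kc|exact: cvg_cst].
- rewrite -scalemxAl -scalemxAr mulmx_suml mulmx_sumr; congr (_ *: _).
  apply: eq_bigr => k _; have [_ _ _ kJ _] := it k.
  by rewrite -mulmxA MiJ mulmxA kJ mulmxA.
- move=> v; rewrite -scalemxAr normrZ gtr0_norm ?invr_gt0// ler_pdivrMl//.
  rewrite mulmx_sumr (le_trans (ler_norm_sum _ _ _))// mulr_natl.
  rewrite -[N in leRHS]card_ord -sumr_const ler_sum// => k _.
  rewrite mulmxA (le_trans (Mi_norm _ _))// expr2 -mulrA ler_wpM2l ?(ltW Lam0)//.
  by apply: Diter_norm => //; exact: ltnW.
Qed.

Lemma euler_mean0 : euler_mean 0 = 0.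
Proof. by rewrite /euler_mean big1 ?scaler0// => k _; rewrite iterE0 mul0mx. Qed.

Lemma euler_mean_jac0 : euler_mean_jac 0 = 1%:M.
Proof.
rewrite /euler_mean_jac (eq_bigr (fun=> 1%:M)) => [|k _]; last by rewrite Diter0 MMi.
by rewrite sumr_const card_ord -(scaler_nat N 1%:M) scalerA mulVf ?scale1r// gt_eqF.
Qed.

(** The mean intertwines the Euler map with M up to boundary terms, because
u (E x) - u x M telescopes; dividing by N makes the two remaining terms small. *)
Lemma euler_mean_defect (x : 'rV[R]_m) : `|x| <= r2 ->
  `|euler_mean (x + h *: K x) - euler_mean x - h *: (euler_mean x *m DK 0)| <=
    N%:R^-1 * (Lam * r1 + `|x *m M|).
Proof.
move=> xr.
have -> : euler_mean (x + h *: K x) - euler_mean x - h *: (euler_mean x *m DK 0) =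
    N%:R^-1 *: (iter N (E h) x *m Mi ^+ N.-1 - x *m M).
  have this : euler_mean x + h *: (euler_mean x *m DK 0) = euler_mean x *m M.
    by rewrite /M /DE mulmxDr mulmx1 -scalemxAr.
  rewrite -addrA -opprD this /euler_mean -scalemxAl -scalerBr; congr (_ *: _).
  have tele (w : nat -> 'rV[R]_m) n : \sum_(k < n.+1) w k.+1 *m Mi ^+ k -
      (\sum_(k < n.+1) w k *m Mi ^+ k) *m M = w n.+1 *m Mi ^+ n - w 0%N *m M.
    elim: n => [|n IH]; first by rewrite !big_ord1 expr0 !mulmx1.
    rewrite big_ord_recr [X in _ - X *m _]big_ord_recr /= mulmxDl opprD addrACA IH.
    have -> : w n.+1 *m Mi ^+ n.+1 *m M = w n.+1 *m Mi ^+ n.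
      by rewrite exprSr -mulmxE mulmxA mulmxKV.
    by rewrite addrC addrA subrK.
  have := tele (fun k => iter k (E h) x) N.-1; rewrite prednK// => <-.
  by congr (_ - _); apply: eq_bigr => k _; rewrite iterSr.
rewrite normrZ gtr0_norm ?invr_gt0// ler_wpM2l ?invr_ge0 ?(ltW NR0)//.
rewrite (le_trans (ler_normB _ _))// lerD2r (le_trans (Mi_norm _ _))//.
rewrite ler_wpM2l ?(ltW Lam0)//.
by have [] := euler_iterates (leqnn N) xr.
Qed.

End Iterates.

(** The defect of the Euler mean is O(1 / N), that is O(h / T) for a total time
T = N h.  The constants r2 and L do not depend on T, so a large T makes the
defect smaller than e h. *)
Lemma almost_linearization : exists r2 L : R, [/\ 0 < r2, r2 <= r1, 0 < L &
  forall e, 0 < e -> exists (u : 'rV[R]_m -> 'rV[R]_m) (Du : 'rV[R]_m -> 'M[R]_m) (h : R),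
  [/\ 0 < h < e, u 0 = 0, Du 0 = 1%:M &
    forall x : 'rV[R]_m, `|x| <= r2 ->
    [/\ hasjac u x (Du x), {for x, continuous Du}, Du x *m J = J *m Du x,
        forall v : 'rV[R]_m, `|v *m Du x| <= L * `|v| &
        `|u (x + h *: K x) - u x - h *: (u x *m DK 0)| <= e * h]]].
Proof.
have [c c0 Qc] := Q_lower; have [C C0 QC] := Q_upper.
pose B : R := expR 1.
have B0 : 0 < B by exact: expR_gt0.
pose Lam := Num.max 1 (B * C / c).
have Lam1 : 1 <= Lam by rewrite le_max lexx.
have Lam0 : 0 < Lam by exact: lt_le_trans Lam1.
have LamP : B * C <= Lam ^+ 2 * c.
  rewrite -ler_pdivrMr// (le_trans (y := Lam))//; first by rewrite le_max lexx orbT.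
  by rewrite expr2 ler_peMr// ltW.
exists (r1 / Lam), (Lam ^+ 2); split.
- by rewrite divr_gt0.
- by rewrite ler_pdivrMr// ler_peMr// ltW.
- by rewrite exprn_gt0.
move=> e e0.
(* D bounds the boundary terms of the telescoping sum, so that D / N <= e h as
soon as N h >= T. *)
pose D : R := Lam * r1 + r1 * m%:R * (1 + `|DK 0|) + 1.
have D0 : 0 < D.
  have p1 : 0 <= Lam * r1 by rewrite mulr_ge0 ?ltW.
  have p2 : 0 <= r1 * m%:R * (1 + `|DK 0|) by rewrite !mulr_ge0 ?addr_ge0// ltW.
  by rewrite ltr_wpDl// addr_ge0.
pose T := D / e.
have T0 : 0 < T by rewrite divr_gt0.
(* Over a time at most T + 1 this distortion accumulates to at most exp 1. *)
have [d d0 dP] := @euler_almost_isometry (T + 1)^-1 ltac:(by rewrite invr_gt0 addr_gt0).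
pose h := Num.min (Num.min (d / 2) (e / 2)) 1.
have h0 : 0 < h by rewrite !lt_min ltr01 !divr_gt0.
have hd : h < d by rewrite !gt_min (ltr_pdivrMr _ _ (ltr0n R 2)) ltr_pMr// ltr1n.
have he : h < e by rewrite !gt_min [e / 2 < e]ltr_pdivrMr// ltr_pMr// ltr1n// orbT.
have h1 : h <= 1 by rewrite ge_min lexx orbT.
pose N := (Num.truncn (T / h)).+1.
have NT : T < N%:R * h by rewrite -ltr_pdivrMr// truncnS_gt.
have NT1 : N%:R * h <= T + 1.
  rewrite /N -natr1 mulrDl mul1r lerD// -ler_pdivlMr//.
  by rewrite truncn_le divr_ge0// ltW.
pose ee := (T + 1)^-1 * h.
have ee0 : 0 <= ee by rewrite mulr_ge0 ?invr_ge0 ?addr_ge0// ltW.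
have eN : (1 + ee) ^+ N <= B.
  rewrite (le_trans (y := expR ee ^+ N))//.
    by rewrite lerXn2r ?nnegrE ?expR_ge0 ?addr_ge0// expR_ge1Dx.
  rewrite -expRM_natl ler_expR /ee mulrCA ler_pdivrMl ?addr_gt0//.
  by rewrite mulr1.
have step x (xr : `|x| <= r1) := dP h x (introT andP (conj h0 hd)) xr.
exists (euler_mean h N), (euler_mean_jac h N), h.
have N0 : (0 < N)%N by [].
have P := euler_mean_regular c0 Qc QC Lam1 LamP ee0 step eN N0.
split; first by rewrite h0.
- exact: euler_mean0.
- exact: euler_mean_jac0 c0 Qc N0.
move=> x xr; have [p1 p2 p3 p4] := P x xr; split=> //.
have xr1 : `|x| <= r1 by rewrite (le_trans xr)// ler_pdivrMr// ler_peMr// ltW.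
apply: le_trans (euler_mean_defect c0 Qc QC Lam1 LamP ee0 step eN N0 xr) _.
have NR0 : 0 < N%:R :> R by rewrite ltr0n.
rewrite ler_pdivrMl// (le_trans (y := D))//; last first.
  have -> : N%:R * (e * h) = N%:R * h * e by rewrite (mulrC e) mulrA.
  by rewrite -ler_pdivrMr// ltW.
have n1 : `|1%:M : 'M[R]_m| <= 1.
  by apply/mx_norm_leP => // i j; rewrite mxE; case: eqP => _; rewrite ?normr1// normr0.
have nDE : `|DE h 0| <= 1 + `|DK 0|.
  rewrite (le_trans (ler_normD _ _))// lerD// normrZ gtr0_norm//.
  by rewrite ler_piMl.
rewrite /D -addrA lerD2l (le_trans (mulmx_norm_le _ _))//.
rewrite (le_trans (y := r1 * m%:R * (1 + `|DK 0|)))//; last by rewrite lerDl.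
apply: ler_pM => //.
by rewrite mulrC ler_wpM2r.
Qed.

End KillingEuler.

(** * Limits of bounded sequences along an ultrafilter *)

Section UltraLimit.
Context {R : realType}.

(** Bounded sequences of numbers converge along every ultrafilter, by
compactness of intervals. *)
Lemma ultra_limit_mx (U : set_system nat) p q (g : nat -> 'M[R]_(p, q)) (M : R) :
  UltraFilter U -> (forall n, `|g n| <= M) -> exists l : 'M[R]_(p, q), g @ U --> l.
Proof.
move=> UU gM.
have H (i : 'I_p) (j : 'I_q) : exists l : R, (fun n => g n i j) @ U --> l.
  have cM : compact `[- M, M]%classic by exact: segment_compact.
  have [|l [_ Hl]] := cM ((fun n => g n i j) @ U) _.
    apply: nearW => n /=; rewrite in_itv /= -ler_norml.
    exact: le_trans (entry_norm_le _ _ _) (gM n).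
  exists l => A lA; have [//|UnA] := in_ultra_setVsetC ((fun n => g n i j) @^-1` A) UU.
  by have [y [nAy Ay]] := Hl (~` A) A UnA lA.
have /choice[l Hl] : forall ij : 'I_p * 'I_q, exists l : R,
  (fun n => g n ij.1 ij.2) @ U --> l by move=> [i j]; exact: H.
exists (\matrix_(i, j) l (i, j)); apply/cvg_mxP => i j; rewrite mxE.
exact: (Hl (i, j)).
Qed.

Lemma limit_norm_le (T : Type) (F : set_system T) (V : normedModType R)
    (g : T -> V) (l : V) (c : R) : ProperFilter F ->
  g @ F --> l -> (\forall t \near F, `|g t| <= c) -> `|l| <= c.
Proof.
move=> FF gl gc; apply/ler_addgt0Pr => e e0.
have /cvgrPdist_le/(_ e e0) H := gl.
have [t [t1 t2]] := filter_ex (filterI gc H).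
by rewrite -(subrK (g t) l) addrC (le_trans (ler_normD _ _))// lerD.
Qed.

End UltraLimit.

(** * From approximate to exact linearization *)

Section ExactLinearization.
Context {R : realType} {m : nat}.
Variables (K : 'rV[R]_m -> 'rV[R]_m) (J B : 'M[R]_m) (r L kappa : R).
Hypothesis JJ : J *m J = - 1%:M.
Hypothesis Jle : forall w : 'rV[R]_m, `|w *m J| <= `|w|.
Hypothesis r0 : 0 < r.
Hypothesis L0 : 0 < L.
Hypothesis Kb : forall x : 'rV[R]_m, `|x| <= r -> `|K x| <= kappa.
Hypothesis approx : forall e, 0 < e ->
  exists (u : 'rV[R]_m -> 'rV[R]_m) (Du : 'rV[R]_m -> 'M[R]_m) (h : R),
  [/\ 0 < h < e, u 0 = 0, Du 0 = 1%:M &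
    forall x : 'rV[R]_m, `|x| <= r ->
    [/\ hasjac u x (Du x), {for x, continuous Du}, Du x *m J = J *m Du x,
        forall v : 'rV[R]_m, `|v *m Du x| <= L * `|v| &
        `|u (x + h *: K x) - u x - h *: (u x *m B)| <= e * h]].

(* C is the Lipschitz constant of the Jacobians on the ball of radius r / 4;
for |x| < rho both x and x + h K x lie in that ball when h is small. *)
Let C := 64 * L / r.
Let rho := r / 8.

(* The Taylor estimate replaces the difference quotient of u along K by the
derivative K x Du x; this costs C kappa^2 h, which explains the choice of e'. *)
Let approx_eq e : 0 < e ->
  exists (u : 'rV[R]_m -> 'rV[R]_m) (Du : 'rV[R]_m -> 'M[R]_m),
  [/\ u 0 = 0, Du 0 = 1%:M, forall x : 'rV[R]_m, `|x| < rho ->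
    [/\ `|u x| <= L * rho, `|Du x| <= L, Du x *m J = J *m Du x &
        `|K x *m Du x - u x *m B| <= e] &
    forall x y : 'rV[R]_m, `|x| < rho -> `|y| < rho ->
      `|u y - u x - (y - x) *m Du x| <= C * `|y - x| ^+ 2 /\
      forall v : 'rV[R]_m, `|v *m (Du y - Du x)| <= C * `|y - x| * `|v|].
Proof.
move=> e0; have C0 : 0 < C by rewrite divr_gt0// mulr_gt0.
have kap0 : 0 <= kappa.
  by rewrite (le_trans (normr_ge0 (K 0)))// Kb// normr0 ltW.
have d0 : 0 < C * kappa ^+ 2 + 1 by rewrite ltr_wpDl// mulr_ge0 ?sqr_ge0// ltW.
pose e' := Num.min (e / (C * kappa ^+ 2 + 1)) (r / 8 / (kappa + 1)).
have e'0 : 0 < e' by rewrite lt_min !divr_gt0// ltr_wpDl.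
have [u [Du [h [/andP[h0 he'] u0 Du0 P]]]] := approx e'0.
have lt8 (x : 'rV[R]_m) : `|x| < rho -> `|x| <= r.
  by rewrite /rho => H; move: r0; lra.
have lt4 (x : 'rV[R]_m) : `|x| < rho -> `|x| < r / 4.
  by rewrite /rho => H; move: r0; lra.
have uj (x : 'rV[R]_m) : `|x| < r -> hasjac u x (Du x) by move=> /ltW/P[].
have Duc (x : 'rV[R]_m) : `|x| < r -> {for x, continuous Du} by move=> /ltW/P[].
have DuJ (x : 'rV[R]_m) : `|x| < r -> Du x *m J = J *m Du x by move=> /ltW/P[].
have Dub (x v : 'rV[R]_m) : `|x| < r -> `|v *m Du x| <= L * `|v|.
  by move=> /ltW/P[].
have taylor := taylor_lipschitz JJ Jle r0 (ltW L0) uj Duc DuJ Dub.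
have lips := jac_lipschitz JJ Jle r0 (ltW L0) uj Duc DuJ Dub.
exists u, Du; split=> // [x xr|x y xr yr]; last first.
  by split=> [|v]; [apply: taylor; exact: lt4|apply: lips; exact: lt4].
have [_ _ xJ xD xe] := P x (lt8 x xr).
split=> //.
- have z0 : `|0 : 'rV[R]_m| < r by rewrite normr0.
  have xr1 : `|x| < r by move: xr r0; rewrite /rho; lra.
  have := lipschitz_of_jac (ltW L0) uj Dub z0 xr1.
  rewrite u0 !subr0 => /le_trans; apply.
  by rewrite ler_wpM2l// ltW.
- apply/mx_norm_leP => [|i j]; first exact: ltW.
  have -> : Du x i j = (row i (Du x)) 0 j by rewrite mxE.
  rewrite rowE.
  rewrite (le_trans (entry_norm_le _ _ _))// (le_trans (xD _))// ler_piMr ?(ltW L0)//.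
  by apply/mx_norm_leP => // k l; rewrite mxE; case: (_ && _); rewrite ?normr1// normr0.
have xK : `|K x| <= kappa by apply/Kb/lt8.
have hk : h * kappa < r / 8.
  have h1 : h < r / 8 / (kappa + 1).
    by rewrite (lt_le_trans he')// ge_min lexx orbT.
  rewrite ltr_pdivlMr in h1; last by rewrite ltr_wpDl.
  rewrite (le_lt_trans _ h1)// ler_pM2l//; lra.
have yr : `|x + h *: K x| < r / 4.
  rewrite (le_lt_trans (ler_normD _ _))// normrZ gtr0_norm//.
  have := ler_wpM2l (ltW h0) xK; move: xr hk; rewrite /rho; lra.
have := taylor x (x + h *: K x) (lt4 x xr) yr.
have -> : x + h *: K x - x = h *: K x by rewrite addrC addKr.
rewrite normrZ (gtr0_norm h0) => T.
rewrite -(ler_pM2l h0) -[X in X * _](gtr0_norm h0) -normrZ.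
have -> : h *: (K x *m Du x - u x *m B) =
    (u (x + h *: K x) - u x - h *: (u x *m B)) -
    (u (x + h *: K x) - u x - (h *: K x) *m Du x).
  by rewrite opprB [RHS]addrC addrA subrK scalerBr -scalemxAl.
rewrite (le_trans (ler_normB _ _))// (le_trans (lerD xe T))//.
have e'e : e' * (C * kappa ^+ 2 + 1) <= e by rewrite -ler_pdivlMr// ge_min lexx.
have hK2 : (h * `|K x|) ^+ 2 <= h * e' * kappa ^+ 2.
  rewrite exprMn expr2 ler_pM ?sqr_ge0 ?mulr_ge0 ?(ltW h0)//.
    by rewrite ler_pM2l// ltW.
  by rewrite -ler_sqr ?nnegrE in xK.
rewrite (le_trans (lerD (lexx _) (ler_wpM2l (ltW C0) hK2)))//.
rewrite (_ : _ + _ = h * (e' * (C * kappa ^+ 2 + 1))); last by ring.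
by rewrite ler_pM2l.
Qed.

(** Approximate solutions for errors 1, 1/2, 1/3, ... are bounded with equally
Lipschitz Jacobians, so their limit along an ultrafilter is differentiable, with
the limit of the Jacobians as Jacobian, and solves the equation exactly. *)
Lemma exact_linearization :
  exists (u : 'rV[R]_m -> 'rV[R]_m) (Du : 'rV[R]_m -> 'M[R]_m) (rho C : R),
  [/\ 0 < rho, 0 < C, u 0 = 0, Du 0 = 1%:M & forall x : 'rV[R]_m, `|x| < rho ->
    [/\ hasjac u x (Du x), Du x *m J = J *m Du x, K x *m Du x = u x *m B &
      forall y v : 'rV[R]_m, `|y| < rho ->
        `|v *m (Du y - Du x)| <= C * `|y - x| * `|v|]].
Proof.
have C0 : 0 < C by rewrite divr_gt0// mulr_gt0.
have rho0 : 0 < rho by rewrite divr_gt0.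
have /choice[u_] : forall n : nat, exists u, exists Du, _ :=
  fun n => @approx_eq n.+1%:R^-1 ltac:(by rewrite invr_gt0 ltr0n).
move=> /choice[Du_ P].
have [U [UU sU]] := ultraFilterLemma (eventually_filter).
have PF : ProperFilter U by exact: ultra_proper.
have /choice[u uP] : forall x : 'rV[R]_m, exists l : 'rV[R]_m, `|x| < rho -> (u_^~ x) @ U --> l.
  move=> x; have [xr|xr] := boolP (`|x| < rho); last by exists 0.
  have [|l Hl] := @ultra_limit_mx R U _ _ (u_^~ x) (L * rho) UU; last by exists l.
  by move=> n; have [_ _ /(_ x xr)[]] := P n.
have /choice[Du DuP] : forall x : 'rV[R]_m, exists l : 'M[R]_m, `|x| < rho -> (Du_^~ x) @ U --> l.
  move=> x; have [xr|xr] := boolP (`|x| < rho); last by exists 0.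
  have [|l Hl] := @ultra_limit_mx R U _ _ (Du_^~ x) L UU; last by exists l.
  by move=> n; have [_ _ /(_ x xr)[]] := P n.
have zr : `|0 : 'rV[R]_m| < rho by rewrite normr0.
have lim_eq (p q : nat) (g : nat -> 'M[R]_(p, q)) (a b : 'M[R]_(p, q)) : g @ U --> a -> g @ U --> b -> a = b.
  move=> Ha Hb; apply/eqP; rewrite -subr_eq0 -normr_le0.
  apply: (@limit_norm_le R _ U _ (fun n => g n - g n)); first exact: cvgB.
  by apply: nearW => n; rewrite subrr normr0.
have Dmul (x v : 'rV[R]_m) : `|x| < rho -> (fun n => v *m Du_ n x) @ U --> v *m Du x.
  by move=> xr; apply: cvg_mulmx; [exact: cvg_cst|exact: DuP].
exists u, Du, rho, C; split=> //.
- apply: (lim_eq _ _ (u_^~ 0)); first exact: uP.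
  have -> : u_^~ 0 = cst 0 by apply/funext => n; have [] := P n.
  exact: cvg_cst.
- apply: (lim_eq _ _ (Du_^~ 0)); first exact: DuP.
  have -> : Du_^~ 0 = cst 1%:M by apply/funext => n; have [] := P n.
  exact: cvg_cst.
move=> x xr; split.
- apply/hasjacP => e e0; apply/nbhs_norm0P.
  exists (Num.min (rho - `|x|) (e / C)); first by rewrite /= lt_min subr_gt0 xr divr_gt0.
  move=> h /=; rewrite lt_min => /andP[h1 h2].
  have yr : `|x + h| < rho by rewrite (le_lt_trans (ler_normD _ _))//; lra.
  apply: (@limit_norm_le R _ U _ (fun n => u_ n (x + h) - u_ n x - h *m Du_ n x)).
    by apply: cvgB; [apply: cvgB; exact: uP|exact: Dmul].
  apply: nearW => n; have [_ _ _ /(_ x (x + h) xr yr)[H _]] := P n.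
  move: H; have -> : x + h - x = h by rewrite addrC addKr.
  move=> /le_trans; apply.
  rewrite expr2 mulrA ler_wpM2r//.
  by move: (ltW h2); rewrite ler_pdivlMr// mulrC.
- apply: (lim_eq _ _ (fun n => Du_ n x *m J)).
    by apply: cvg_mulmx; [exact: DuP|exact: cvg_cst].
  have -> : (fun n => Du_ n x *m J) = (fun n => J *m Du_ n x).
    by apply/funext => n; have [_ _ /(_ x xr)[]] := P n.
  by apply: cvg_mulmx; [exact: cvg_cst|exact: DuP].
- apply/eqP; rewrite -subr_eq0 -normr_le0; apply/ler_addgt0Pr => e e0; rewrite add0r.
  apply: (@limit_norm_le R _ U _ (fun n => K x *m Du_ n x - u_ n x *m B)).
    apply: cvgB; first exact: Dmul.
    by apply: cvg_mulmx; [exact: uP|exact: cvg_cst].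
  apply: sU.
  have := near_infty_natSinv_lt (PosNum e0); apply: filterS => n /= ne.
  have [_ _ /(_ x xr)[_ _ _ H] _] := P n.
  by rewrite (le_trans H)// ltW.
- move=> y v yr.
  apply: (@limit_norm_le R _ U _ (fun n => v *m (Du_ n y - Du_ n x))).
    by apply: cvg_mulmx; [exact: cvg_cst|apply: cvgB; exact: DuP].
  by apply: nearW => n; have [_ _ _ /(_ x y xr yr)[_]] := P n.
Qed.

End ExactLinearization.

(** * Functions with continuous partial derivatives *)

Section Partials.
Context {R : realType} {m : nat}.
Implicit Types (f g : 'rV[R]_m -> R) (x y : 'rV[R]_m).

Let e_ (k : 'I_m) : 'rV[R]_m := delta_mx 0 k.

Lemma partial_step f (a x : 'rV[R]_m) k (s D eps d : R) :
  (forall y : 'rV[R]_m, `|y - a| < d -> derivable f y (e_ k) /\ `|partial k f y - D| <= eps) ->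
  `|x - a| < d -> `|x + s *: e_ k - a| < d ->
  `|f (x + s *: e_ k) - f x - s * D| <= eps * `|s|.
Proof.
move=> H xd yd.
have seg t : 0 <= t <= 1 -> `|x + (t * s) *: e_ k - a| < d.
  move=> t01; have := ball_segment_center t01 xd yd.
  by rewrite [_ + _ - x]addrC addKr scalerA.
have := @mean_value_ineq R (fun t => f (x + (t * s) *: e_ k) - t * (s * D))
  (fun t => s * (partial k f (x + (t * s) *: e_ k) - D)) (eps * `|s|).
rewrite mul1r mul0r scale0r addr0 mul0r subr0 mul1r.
have -> : f (x + s *: e_ k) - s * D - f x = f (x + s *: e_ k) - f x - s * D by ring.
apply=> t t01; have [dd Dle] := H _ (seg t t01); last first.
  by rewrite normrM mulrC ler_wpM2r.
have h1 : is_derive t 1 (fun t => f (x + (t * s) *: e_ k)) (s * partial k f (x + (t * s) *: e_ k)).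
  have hd : is_derive (0 + t * s) 1 (fun t => f (x + t *: e_ k))
      (partial k f (x + (t * s) *: e_ k)).
    by rewrite add0r; apply: is_derive_line; exact: derivableP dd.
  have := is_derive_affine hd.
  by under eq_fun do rewrite add0r.
have h2 : is_derive t 1 (fun t : R => t * (s * D)) (s * D).
  have := @is_derive_affine R id 0 (s * D) t 1 (is_derive_id _ _).
  by under eq_fun do rewrite /= add0r; rewrite mulr1.
by have := is_deriveB h1 h2; rewrite mulrBr.
Qed.

(** The increment of f is the sum of its increments along an edge path parallel
to the axes; each edge is handled by the mean value inequality. *)
Lemma continuous_partials_derive f (a v : 'rV[R]_m) :
  (\forall y \near a, forall k, derivable f y (e_ k)) ->
  (forall k, {for a, continuous (partial k f)}) ->
  is_derive a v f (\sum_k v 0 k * partial k f a).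
Proof.
move=> fd fc.
pose A : 'M[R]_(m, 1) := \col_k partial k f a.
suff fj : hasjac (fun y => (f y)%:M : 'rV[R]_1) a A.
  have := hasjac_coord_derive v 0 fj.
  rewrite mxE; under eq_fun do rewrite mxE eqxx mulr1n.
  by under eq_bigr do rewrite mxE.
apply/hasjacP => e e0.
have m0 : 0 < m%:R + 1 :> R by rewrite ltr_wpDl.
pose e1 := e / (m%:R + 1); have e10 : 0 < e1 by rewrite divr_gt0.
have : \forall y \near a, forall k, derivable f y (e_ k) /\ `|partial k f y - partial k f a| <= e1.
  have H : \forall y \near a, forall k, `|partial k f y - partial k f a| <= e1.
    apply: (@filter_forall _ 'I_m (fun k y => `|partial k f y - partial k f a| <= e1) (nbhs a)).
    move=> k; have fk : partial k f @ a --> partial k f a := fc k.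
    by move/cvgr_distC_le : fk; apply.
  exact: (@filterS2 _ (nbhs a) _ _ _ _ (fun y H1 H2 k => conj (H1 k) (H2 k)) fd H).
case/nbhs_normP => d /= d0 dP; apply/nbhs_norm0P; exists d => // h /= hd.
(* The vertices of the edge path from 0 to h. *)
pose w (n : nat) : 'rV[R]_m := \row_i (if (i < n)%N then h 0 i else 0).
have wh n : `|w n| <= `|h|.
  apply/mx_norm_leP => // i j; rewrite mxE; case: ifP => _; last by rewrite normr0.
  exact: entry_norm_le.
have wS (k : 'I_m) : w k.+1 = w k + h 0 k *: e_ k.
  apply/matrixP => i j; rewrite !mxE (ord1 i) eqxx ltnS leq_eqVlt val_eqE /=.
  have [->|jk] := eqVneq j k; first by rewrite ltnn add0r mulr1.
  by rewrite /= mulr0 addr0.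
have w0 : w 0%N = 0 by apply/matrixP => i j; rewrite !mxE.
have wm : w m = h by apply/matrixP => i j; rewrite mxE ltn_ord (ord1 i).
have E : f (a + h) - f a - \sum_k h 0 k * partial k f a =
    \sum_(k < m) (f (a + w k.+1) - f (a + w k) - h 0 k * partial k f a).
  rewrite sumrB -(big_mkord xpredT (fun k => f (a + w k.+1) - f (a + w k))).
  by rewrite (telescope_sumr (fun k => f (a + w k)))// wm w0 addr0.
apply/mx_norm_leP => [|i j]; first by rewrite mulr_ge0// ltW.
rewrite (ord1 i) (ord1 j) !mxE eqxx !mulr1n.
under eq_bigr do rewrite mxE.
rewrite E (le_trans (ler_norm_sum _ _ _))//.
rewrite (le_trans (y := \sum_(k < m) e1 * `|h|))//; last first.
  rewrite sumr_const card_ord -mulr_natl mulrA ler_wpM2r// /e1 mulrA.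
  by rewrite ler_pdivrMr// mulrC ler_wpM2l ?(ltW e0)// lerDl.
apply: ler_sum => k _; rewrite wS addrA.
rewrite (le_trans (y := e1 * `|h 0 k|))//; last by rewrite ler_wpM2l ?entry_norm_le ?ltW.
apply: (@partial_step f a _ k _ _ _ d).
- by move=> y yd; apply: dP; rewrite /= distrC.
- by rewrite [_ - a]addrC addKr (le_lt_trans (wh _)).
- by rewrite -[a + w k + _]addrA -wS [_ - a]addrC addKr (le_lt_trans (wh _)).
Qed.

(* The mean value inequality is applied twice: along the i-th axis to the
increment of f in the j-th direction, then along the j-th axis. *)
Let second_difference f (a : 'rV[R]_m) i j (eps d s : R) : 0 < s -> s < d ->
  (forall y, `|y - a| < 2 * d -> [/\ derivable f y (e_ i), derivable (partial i f) y (e_ j) &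
     `|partial j (partial i f) y - partial j (partial i f) a| <= eps]) ->
  `|f (a + s *: e_ i + s *: e_ j) - f (a + s *: e_ i) - f (a + s *: e_ j) + f a -
    s ^+ 2 * partial j (partial i f) a| <= eps * s ^+ 2.
Proof.
move=> s0 sd H; set D := partial j (partial i f) a.
have ne k : `|e_ k| <= 1.
  by apply/mx_norm_leP => // p q; rewrite mxE; case: (_ && _); rewrite ?normr1// normr0.
have nse k (t : R) : 0 <= t <= s -> `|t *: e_ k| < d.
  case/andP=> t0 ts; rewrite normrZ ger0_norm// (le_lt_trans _ sd)// (le_trans _ ts)//.
  by rewrite ler_piMr.
have n1 (t : R) : 0 <= t <= 1 -> `|a + (t * s) *: e_ i - a| < 2 * d.
  case/andP=> t0 t1; rewrite [_ - a]addrC addKr.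
  have /nse-/(_ i) : 0 <= t * s <= s by rewrite mulr_ge0 ?(ltW s0)// ler_piMl// ltW.
  by move: s0 sd; lra.
have n2 (t : R) : 0 <= t <= 1 -> `|a + (t * s) *: e_ i + s *: e_ j - a| < 2 * d.
  case/andP=> t0 t1; rewrite -[a + _ + _]addrA [_ - a]addrC addKr (le_lt_trans (ler_normD _ _))//.
  have /nse-/(_ i) : 0 <= t * s <= s by rewrite mulr_ge0 ?(ltW s0)// ler_piMl// ltW.
  have /nse-/(_ j) : 0 <= s <= s by rewrite lexx ltW.
  by lra.
have := @mean_value_ineq R
  (fun t => f (a + (t * s) *: e_ i + s *: e_ j) - f (a + (t * s) *: e_ i) - t * (s ^+ 2 * D))
  (fun t => s * (partial i f (a + (t * s) *: e_ i + s *: e_ j) - partial i f (a + (t * s) *: e_ i)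
     - s * D)) (eps * s ^+ 2).
rewrite !mul1r !mul0r scale0r !addr0 subr0.
have -> : f (a + s *: e_ i + s *: e_ j) - f (a + s *: e_ i) - s ^+ 2 * D - (f (a + s *: e_ j) - f a)
  = f (a + s *: e_ i + s *: e_ j) - f (a + s *: e_ i) - f (a + s *: e_ j) + f a - s ^+ 2 * D by ring.
apply=> t t01; last first.
  rewrite normrM gtr0_norm// expr2 mulrCA ler_pM2l// -[X in _ <= _ * X](gtr0_norm s0).
  apply: (@partial_step _ a _ j _ _ _ (2 * d)); [|exact: n1|exact: n2].
  by move=> y yd; have [] := H y yd.
have aux (b : 'rV[R]_m) : derivable f (b + (t * s) *: e_ i) (e_ i) ->
    is_derive t 1 (fun t => f (b + (t * s) *: e_ i)) (s * partial i f (b + (t * s) *: e_ i)).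
  move=> bd.
  have hd : is_derive (0 + t * s) 1 (fun t => f (b + t *: e_ i))
      (partial i f (b + (t * s) *: e_ i)).
    by rewrite add0r; apply: is_derive_line; exact: derivableP bd.
  have := is_derive_affine hd.
  by under eq_fun do rewrite add0r.
have h2 : is_derive t 1 (fun t : R => t * (s ^+ 2 * D)) (s ^+ 2 * D).
  have := @is_derive_affine R id 0 (s ^+ 2 * D) t 1 (is_derive_id _ _).
  by under eq_fun do rewrite /= add0r; rewrite mulr1.
have h1 := aux a (let: And3 p _ _ := H _ (n1 t t01) in p).
have h3 : is_derive t 1 (fun t => f (a + (t * s) *: e_ i + s *: e_ j))
    (s * partial i f (a + (t * s) *: e_ i + s *: e_ j)).
  have := aux (a + s *: e_ j); rewrite addrAC.
  have -> : (fun t => f (a + s *: e_ j + (t * s) *: e_ i)) =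
      (fun t => f (a + (t * s) *: e_ i + s *: e_ j)).
    by apply/funext => t'; rewrite addrAC.
  have [q1 _ _] := H _ (n2 t t01).
  by move=> X; apply: X; exact: q1.
have := is_deriveB (is_deriveB h3 h1) h2.
by rewrite !mulrBr mulrA -expr2.
Qed.

(** The second difference of f over a small square is close to s^2 times either
mixed derivative. *)
Lemma schwarz f (a : 'rV[R]_m) i j :
  (\forall y \near a, [/\ derivable f y (e_ i), derivable f y (e_ j),
      derivable (partial i f) y (e_ j) & derivable (partial j f) y (e_ i)]) ->
  {for a, continuous (partial j (partial i f))} ->
  {for a, continuous (partial i (partial j f))} ->
  partial i (partial j f) a = partial j (partial i f) a.
Proof.
move=> fd cij cji; apply/eqP; rewrite -subr_eq0 -normr_le0.
apply/ler_addgt0Pr => e e0; rewrite add0r.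
have e20 : 0 < e / 2 by rewrite divr_gt0.
have : \forall y \near a, [/\ derivable f y (e_ i), derivable f y (e_ j),
      derivable (partial i f) y (e_ j) & derivable (partial j f) y (e_ i)] /\
    (`|partial j (partial i f) y - partial j (partial i f) a| <= e / 2 /\
     `|partial i (partial j f) y - partial i (partial j f) a| <= e / 2).
  have ij : partial j (partial i f) @ a --> partial j (partial i f) a := cij.
  have ji : partial i (partial j f) @ a --> partial i (partial j f) a := cji.
  move/cvgr_distC_le : ij => /(_ _ e20) H1; move/cvgr_distC_le : ji => /(_ _ e20) H2.
  exact: filterI fd (filterI H1 H2).
case/nbhs_normP => d /= d0 dP; pose d2 := d / 2; pose s := d2 / 2.
have d20 : 0 < d2 by rewrite divr_gt0.
have s0 : 0 < s by rewrite divr_gt0.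
have sd : s < d2 by rewrite /s; move: d20; lra.
have dE : 2 * d2 = d by rewrite /d2; field.
have A1 := @second_difference f a i j (e / 2) d2 s s0 sd.
have A2 := @second_difference f a j i (e / 2) d2 s s0 sd.
have dP' (y : 'rV[R]_m) : `|y - a| < 2 * d2 -> `|a - y| < d by rewrite dE distrC.
have {}A1 := A1 (fun y yd => let: conj (And4 p1 _ p3 _) (conj q1 _) := dP y (dP' y yd) in And3 p1 p3 q1).
have {}A2 := A2 (fun y yd => let: conj (And4 _ p2 _ p4) (conj _ q2) := dP y (dP' y yd) in And3 p2 p4 q2).
have s20 : 0 < s ^+ 2 by rewrite exprn_gt0.
rewrite -(ler_pM2l s20) -[X in X * _](gtr0_norm s20) -normrM.
set Dij := partial i (partial j f) a in A2 *.
set Dji := partial j (partial i f) a in A1 *.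
move: A1 A2; rewrite (addrAC a (s *: e_ j)).
set p := f (a + s *: e_ i + s *: e_ j); set q := f (a + s *: e_ i); set t := f (a + s *: e_ j).
have -> : p - t - q + f a = p - q - t + f a by ring.
set z := p - q - t + f a => A1 A2.
have -> : s ^+ 2 * (Dij - Dji) = (z - s ^+ 2 * Dji) - (z - s ^+ 2 * Dij) by ring.
rewrite (le_trans (ler_normB _ _))// (le_trans (lerD A1 A2))//.
by rewrite -mulrDl -splitr mulrC.
Qed.

End Partials.

(** * Continuity of the determinant and of the inverse matrix *)

Section MatrixContinuity.
Context {K : numFieldType} {T : Type} {F : set_system T} {FF : Filter F}.

Lemma cvg_det p (M : T -> 'M[K]_p) (A : 'M[K]_p) :
  M @ F --> A -> (fun x => \det (M x)) @ F --> \det A.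
Proof.
move=> /cvg_mxP MA; rewrite /determinant.
apply: cvg_big => [|s _]; first exact: add_continuous.
apply: cvgM; first exact: cvg_cst.
by apply: cvg_big => [|i _]; [exact: mul_continuous|exact: MA].
Qed.

(** Cramer's rule. *)
Lemma cvg_invmx p (M : T -> 'M[K]_p) (A : 'M[K]_p) : A \in unitmx ->
  (\forall x \near F, M x \in unitmx) ->
  M @ F --> A -> (fun x => invmx (M x)) @ F --> invmx A.
Proof.
move=> Au Mu MA; have /cvg_mxP MAe := MA.
have c1 : (fun x => (\det (M x))^-1 *: \adj (M x)) @ F --> invmx A.
  rewrite /invmx Au; apply: cvgZ.
    by apply: cvgV; [rewrite -unitfE -unitmxE|exact: cvg_det].
  apply/cvg_mxP => i j; rewrite mxE /cofactor.
  under eq_fun do rewrite mxE /cofactor.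
  apply: cvgM; first exact: cvg_cst.
  apply: cvg_det; apply/cvg_mxP => k l; rewrite !mxE.
  under eq_fun do rewrite !mxE.
  exact: MAe.
apply: cvg_trans c1; apply: near_eq_cvg.
by apply: filterS Mu => x Mx; rewrite /invmx Mx.
Qed.

End MatrixContinuity.

Lemma is_derive_mx (R : realType) (V : normedModType R) p q (M : V -> 'M[R]_(p, q))
    (x v : V) (D : 'M[R]_(p, q)) :
  (forall i j, is_derive x v (fun y => M y i j) (D i j)) -> is_derive x v M D.
Proof.
move=> H; have D1 : derivable M x v by apply/derivable_mxP => i j; have [] := H i j.
split=> //; rewrite derive_mx//; apply/matrixP => i j; rewrite mxE.
by have [_ ->] := H i j.
Qed.

(** * Smooth functions *)

Section Smooth.
Context {R : realType} {m : nat}.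
Variables (U : set 'rV[R]_m).

Lemma smooth_continuous (f : 'rV[R]_m -> R) x : smooth_on U f -> U x -> {for x, continuous f}.
Proof. by move=> /(_ 0%N)[H _] /H. Qed.

Lemma smooth_derivable (f : 'rV[R]_m -> R) x i : smooth_on U f -> U x ->
  derivable f x (delta_mx 0 i).
Proof. by move=> /(_ 1%N)[_ /(_ i)[H _]] /H. Qed.

Lemma smooth_partial (f : 'rV[R]_m -> R) i : smooth_on U f -> smooth_on U (partial i f).
Proof. by move=> fs k; have [_ /(_ i)[]] := fs k.+1. Qed.

Hypothesis oU : open U.

Let nearU x : U x -> \forall y \near x, U y.
Proof. by move=> Ux; exact: open_nbhs_nbhs. Qed.

Lemma smooth_derive (f : 'rV[R]_m -> R) (x v : 'rV[R]_m) : smooth_on U f -> U x ->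
  is_derive x v f (\sum_k v 0 k * partial k f x).
Proof.
move=> fs Ux; apply: continuous_partials_derive.
  by apply: filterS (nearU Ux) => y Uy k; exact: smooth_derivable.
by move=> k; apply: smooth_continuous Ux; exact: smooth_partial.
Qed.

Lemma smooth_schwarz (f : 'rV[R]_m -> R) (x : 'rV[R]_m) i j : smooth_on U f -> U x ->
  partial i (partial j f) x = partial j (partial i f) x.
Proof.
move=> fs Ux; apply: schwarz.
- apply: filterS (nearU Ux) => y Uy.
  by split; apply: smooth_derivable => //; exact: smooth_partial.
- by apply: smooth_continuous Ux; do 2 apply: smooth_partial.
- by apply: smooth_continuous Ux; do 2 apply: smooth_partial.
Qed.

End Smooth.

(** * The Killing field of a holomorphic gradient *)

Section KahlerKilling.
Context {R : realType} {n : nat}.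
Local Notation V := ('rV[R]_(n + n)).
Local Notation J := (Jmx : 'M[R]_(n + n)).
Variables (U : set V) (G : V -> 'M[R]_(n + n)) (f : V -> R) (X : V -> V)
  (DX : V -> 'M[R]_(n + n)).
Hypothesis oU : open U.
Hypothesis Gs : forall i j, smooth_on U (fun x => G x i j).
Hypothesis fs : smooth_on U f.
Hypothesis Gsym : forall x, U x -> (G x)^T = G x.
Hypothesis GJ : forall x, U x -> J *m G x *m J^T = G x.
Hypothesis Gpos : forall x v : V, U x -> v != 0 -> 0 < (v *m G x *m v^T) 0 0.
Let omega i j x := (J *m G x) i j.
Hypothesis omega_closed : forall x i j k, U x ->
  partial i (omega j k) x + partial j (omega k i) x + partial k (omega i j) x = 0.
Hypothesis XG : forall x, U x -> X x *m G x = \row_i partial i f x.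
Hypothesis Xj : forall x, U x -> hasjac X x (DX x).
Hypothesis DXJ : forall x, U x -> DX x *m J = J *m DX x.

Let DG l x : 'M[R]_(n + n) := \matrix_(i, j) partial l (fun y => G y i j) x.

Lemma JmxJ : J *m J = - 1%:M.
Proof.
rewrite /Jmx mulmx_block !mul0mx !mulmx0 !mul1mx !mulmx1 !add0r addr0.
by rewrite scalar_mx_block opp_block_mx !oppr0.
Qed.

Lemma Jmx_tr : J^T = - J.
Proof.
rewrite /Jmx tr_block_mx !trmx0 linearN /= !trmx1 opp_block_mx.
by rewrite !oppr0 opprK.
Qed.

Let nearU x : U x -> \forall y \near x, U y.
Proof. by move=> Ux; exact: open_nbhs_nbhs. Qed.

Lemma metric_derive (x v : V) : U x -> is_derive x v G (\sum_l v 0 l *: DG l x).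
Proof.
move=> Ux; apply: is_derive_mx => i j; rewrite summxE.
under eq_bigr do rewrite !mxE.
exact: (smooth_derive oU v (Gs i j) Ux).
Qed.

Lemma metric_continuous x : U x -> {for x, continuous G}.
Proof.
move=> Ux; apply: (proj2 (@cvg_mxP R _ (nbhs x) _ _ _ G (G x))) => i j.
exact: smooth_continuous (Gs i j) Ux.
Qed.

Lemma metric_partial_continuous l x : U x -> {for x, continuous (DG l)}.
Proof.
move=> Ux; apply: (proj2 (@cvg_mxP R _ (nbhs x) _ _ _ (DG l) (DG l x))) => i j.
rewrite mxE; under eq_fun do rewrite mxE.
exact: smooth_continuous (smooth_partial l (Gs i j)) Ux.
Qed.

Lemma metric_unit x : U x -> G x \in unitmx.
Proof.
move=> Ux; rewrite -row_free_unit -kermx_eq0; apply/rowV0P => v /sub_kermxP vM.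
apply/eqP; apply: contraT => v0.
by have := Gpos Ux v0; rewrite vM mul0mx mxE ltxx.
Qed.

(** Differentiation of X G = df. *)
Lemma gradient_jac x i j : U x ->
  (DX x *m G x) i j + (X x *m DG i x) 0 j = partial i (partial j f) x.
Proof.
move=> Ux.
have XGj : \forall y \near x, \sum_l X y 0 l * G y l j = partial j f y.
  apply: filterS (nearU Ux) => y Uy.
  by have /matrixP/(_ 0 j) := XG Uy; rewrite !mxE.
have H : is_derive x (delta_mx 0 i) (fun y => \sum_l X y 0 l * G y l j)
   (\sum_l (X x 0 l *: DG i x l j + G x l j *: DX x i l)).
  have -> : (fun y => \sum_l X y 0 l * G y l j) =
     \sum_l ((fun y => X y 0 l) * (fun y => G y l j)).
    by apply/funext => y; rewrite fct_sumE.
  apply: is_derive_sum => l; apply: is_deriveM.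
    have := hasjac_coord_derive (delta_mx 0 i) l (Xj Ux).
    by rewrite -rowE mxE.
  rewrite mxE; apply: derivableP; exact: smooth_derivable (Gs l j) Ux.
have [_ Hd] := near_eq_is_derive XGj H.
rewrite [RHS]Hd !mxE big_split /= addrC; congr (_ + _); apply: eq_bigr => l _.
by rewrite mulrC.
Qed.

Lemma hessian_symmetric x : U x ->
  DX x *m G x + \matrix_(i, j) (X x *m DG i x) 0 j =
  (DX x *m G x + \matrix_(i, j) (X x *m DG i x) 0 j)^T.
Proof.
move=> Ux; set H := _ + _.
have HE i j : H i j = partial i (partial j f) x.
  by rewrite -gradient_jac// [LHS]mxE [X in _ + X]mxE.
apply/matrixP => i j; rewrite [RHS]mxE !HE.
exact: (smooth_schwarz oU i j fs Ux).
Qed.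

(** At a zero of X the coordinate Hessian of f is DX G, so symmetry of second
derivatives says that DX is self-adjoint for G. *)
Lemma zero_self_adjoint x : U x -> X x = 0 -> DX x *m G x = G x *m (DX x)^T.
Proof.
move=> Ux X0; have := hessian_symmetric Ux.
have -> : \matrix_(i, j) (X x *m DG i x) 0 j = 0.
  by apply/matrixP => i j; rewrite !mxE big1// => l _; rewrite X0 mxE mul0r.
by rewrite addr0 trmx_mul Gsym.
Qed.

(** Holomorphy gives the Jacobian pointwise only; its continuity follows from
DX = (Hess f - X dG) G^-1, a formula in smooth functions and X. *)
Lemma gradient_jac_continuous x : U x -> {for x, continuous DX}.
Proof.
move=> Ux.
pose C y : 'M[R]_(n + n) := \matrix_(i, j) (partial i (partial j f) y - (X y *m DG i y) 0 j).
have DXE y : U y -> DX y = C y *m invmx (G y).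
  move=> Uy; apply: (can_inj (mulmxK (metric_unit Uy))); rewrite mulmxKV ?metric_unit//.
  by apply/matrixP => i j; rewrite [RHS]mxE -gradient_jac// addrK.
have cX : X @ x --> X x by exact: hasjac_continuous (Xj Ux).
have cC : C @ x --> C x.
  apply: (proj2 (@cvg_mxP R _ (nbhs x) _ _ _ C (C x))) => i j.
  rewrite mxE; under eq_fun do rewrite mxE.
  apply: cvgB.
    exact: smooth_continuous (smooth_partial i (smooth_partial j fs)) Ux.
  have H : (fun y => X y *m DG i y) @ x --> X x *m DG i x.
    have cD : DG i @ x --> DG i x := @metric_partial_continuous i x Ux.
    exact: cvg_mulmx cX cD.
  by have /cvg_mxP := H; apply.
have cI : (fun y => invmx (G y)) @ x --> invmx (G x).
  have cG : G @ x --> G x := @metric_continuous x Ux.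
  apply: cvg_invmx cG; first exact: metric_unit.
  by apply: filterS (nearU Ux) => y; exact: metric_unit.
have cP : (fun y => C y *m invmx (G y)) @ x --> C x *m invmx (G x) by exact: cvg_mulmx cC cI.
rewrite /prop_for /continuous_at (DXE x Ux).
have E : \forall y \near x, C y *m invmx (G y) = DX y.
  exact: (@filterS _ (nbhs x) _ _ _ (fun y Uy => esym (DXE y Uy)) (nearU Ux)).
exact: (cvg_trans (@near_eq_cvg _ _ (nbhs x) _ _ _ E) cP).
Qed.

(** Cartan's formula: for K = X J the contraction of K with omega is - df, and
omega is closed, so the Lie derivative of omega along K is - d (df) = 0.  As K is
holomorphic, the Lie derivative of the metric omega (., J .) is zero too. *)
Lemma gradient_killing x : U x ->
  (DX x *m J) *m G x + \sum_l (X x *m J) 0 l *: DG l x + G x *m (DX x *m J)^T = 0.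
Proof.
move=> Ux; set K := X x *m J; set DK := DX x *m J.
have omega_derive l j k :
    is_derive x (delta_mx 0 l) (omega j k) ((J *m DG l x) j k).
  have -> : omega j k = \sum_s ((J j s) \*: (fun y => G y s k)).
    by apply/funext => y; rewrite /omega mxE fct_sumE.
  rewrite mxE; apply: is_derive_sum => s; rewrite [DG l x s k]mxE.
  by apply: is_deriveZ; apply: derivableP; exact: smooth_derivable (Gs s k) Ux.
have omega_partial l j k : partial l (omega j k) x = (J *m DG l x) j k.
  by have [_ <-] := omega_derive l j k.
have omega_anti y : U y -> (J *m G y)^T = - (J *m G y).
  move=> Uy; have GJc : J *m G y = G y *m J.
    by rewrite -{2}(GJ Uy) Jmx_tr mulmxN mulNmx -mulmxA JmxJ mulmxN mulmx1 opprK.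
  by rewrite trmx_mul Gsym// Jmx_tr mulmxN GJc.
have anti l i j : (J *m DG l x) i j = - (J *m DG l x) j i.
  rewrite -!omega_partial /partial -deriveN; last by have [] := omega_derive l j i.
  apply: near_eq_derive.
  have E y (Uy : U y) : omega i j y = (- omega j i) y.
    by have /matrixP/(_ j i) := omega_anti y Uy; rewrite [LHS]mxE [RHS]mxE.
  exact: (@filterS _ (nbhs x) _ _ _ E (nearU Ux)).
(* The components of the Lie derivative of omega: by closedness they are those
of the exterior derivative of the contraction of K with omega. *)
have sym j k : (DK *m (J *m G x)) j k - (DK *m (J *m G x)) k j +
    \sum_l K 0 l * (J *m DG l x) j k = 0.
  have H i j' : (DK *m (J *m G x)) i j' + (K *m (J *m DG i x)) 0 j' = - partial i (partial j' f) x.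
    rewrite -gradient_jac// /DK /K !mulmxA -!(mulmxA _ J J) JmxJ !mulmxN !mulmx1 !mulNmx.
    by rewrite !mxE opprD.
  have -> : \sum_l K 0 l * (J *m DG l x) j k =
      (K *m (J *m DG j x)) 0 k - (K *m (J *m DG k x)) 0 j.
    rewrite [X in X - _]mxE [X in _ - X]mxE -sumrB; apply: eq_bigr => l _.
    have := omega_closed l j k Ux; rewrite !omega_partial => c.
    rewrite -mulrBr; congr (_ * _).
    have aux (p q d : R) : p - q + d = 0 -> p = q - d by move=> *; lra.
    by apply: aux; rewrite -(anti j k l).
  rewrite addrACA H -opprD H (smooth_schwarz oU j k fs Ux).
  by rewrite opprK addNr.
have sum0 : DK *m (J *m G x) + (J *m G x) *m DK^T + \sum_l K 0 l *: (J *m DG l x) = 0.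
  have tr j k : (J *m G x *m DK^T) j k = - (DK *m (J *m G x)) k j.
    have -> : J *m G x *m DK^T = - (DK *m (J *m G x))^T.
      by rewrite (trmx_mul DK (J *m G x)) omega_anti// mulNmx opprK.
    by rewrite [LHS]mxE [X in - X]mxE.
  apply/matrixP => j k; rewrite [RHS]mxE -(sym j k).
  rewrite [LHS]mxE [X in X + _ = _]mxE tr summxE; congr (_ + _).
  by apply: eq_bigr => l _; rewrite [LHS]mxE.
have DKJ : DK *m J = J *m DK by rewrite /DK -mulmxA JmxJ mulmxA -DXJ// -mulmxA JmxJ.
have := congr1 (mulmx (- J)) sum0; rewrite mulmx0 !(mulmxDr (- J)) addrAC => E; rewrite -[RHS]E.
have JJ : - J *m J = 1%:M by rewrite mulNmx JmxJ opprK.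
congr (_ + _ + _).
- by rewrite (mulmxA DK) DKJ -!mulmxA (mulmxA (- J)) JJ mul1mx.
- rewrite mulmx_sumr; apply: eq_bigr => l _.
  by rewrite -scalemxAr mulmxA JJ mul1mx.
- by rewrite !mulmxA JJ mul1mx.
Qed.

End KahlerKilling.

(** * The inverse of a map close to the identity *)

(* The Banach fixed point theorem asks for a structure with both the norm and
the completeness of matrices. *)
HB.instance Definition _ (R : realType) (m n : nat) := Complete.on 'M[R]_(m, n).

Section InverseFunction.
Context {R : realType} {m : nat}.
Variables (u : 'rV[R]_m -> 'rV[R]_m) (Du : 'rV[R]_m -> 'M[R]_m) (d : R).
Hypothesis d_gt0 : 0 < d.
Hypothesis u0 : u 0 = 0.
Hypothesis uj : forall x : 'rV[R]_m, `|x| < d -> hasjac u x (Du x).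
Hypothesis Du1 : forall x v : 'rV[R]_m, `|x| < d -> `|v *m (Du x - 1%:M)| <= 2^-1 * `|v|.

Let g (x : 'rV[R]_m) := u x - x.

Let g_lip (x y : 'rV[R]_m) : `|x| < d -> `|y| < d -> `|g y - g x| <= 2^-1 * `|y - x|.
Proof.
apply: lipschitz_of_jac => [//|z zd|//]; last exact: Du1.
by apply: hasjacD; [exact: uj|exact/hasjacN/hasjac_id].
Qed.

Let expand (x y : 'rV[R]_m) : `|x| < d -> `|y| < d -> `|y - x| <= 2 * `|u y - u x|.
Proof.
move=> xd yd; have := g_lip xd yd.
have -> : y - x = (u y - u x) - (g y - g x).
  by rewrite /g; apply/matrixP => i j; rewrite !mxE; ring.
set p := u y - u x; set q := g y - g x => qle.
have := ler_normB p q; lra.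
Qed.

Let Du_unit (x : 'rV[R]_m) : `|x| < d -> Du x \in unitmx.
Proof.
move=> xd; rewrite -row_free_unit -kermx_eq0; apply/rowV0P => v /sub_kermxP vD.
have := Du1 v xd; rewrite mulmxBr vD mulmx1 sub0r normrN => H.
by apply/eqP; rewrite -normr_le0; move: H (normr_ge0 v); lra.
Qed.

(* With u = id + g, a solution of u x = w is a fixed point of x |-> w - g x,
which maps the ball of radius d / 2 to itself: |w| + |x| / 2 <= d / 4 + d / 4. *)
Let solve (w : 'rV[R]_m) : `|w| < d / 4 -> exists2 x : 'rV[R]_m, `|x| <= d / 2 & u x = w.
Proof.
move=> wd; pose T (x : 'rV[R]_m) := w - g x.
pose U : set 'rV[R]_m := [set x | `|x| <= d / 2].
have Ud (x : 'rV[R]_m) : U x -> `|x| < d.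
  by rewrite /U /= => xd; move: d_gt0; lra.
have z0 : `|0 : 'rV[R]_m| < d by rewrite normr0.
have TU x : U x -> U (T x).
  move=> Ux; have := g_lip z0 (Ud x Ux); rewrite {2}/g u0 !subr0 => gx.
  rewrite /U /= (le_trans (ler_normB _ _))//.
  by move: Ux gx wd; rewrite /U /=; lra.
have cT : is_contraction (mkfun_fun TU).
  exists (NngNum (ltac:(by []) : 0 <= 2^-1 :> R)); split=> /=; first by lra.
  move=> [x y] [/= Ux Uy]; rewrite /mkfun /T.
  have -> : w - g x - (w - g y) = - (g x - g y).
    by apply/matrixP => i j; rewrite !mxE; ring.
  by rewrite normrN; exact: (g_lip (Ud y Uy) (Ud x Ux)).
have [||x Ux xT] := banach_fixed_point cT.
- have -> : U = Num.norm @^-1` [set y : R | y <= d / 2] by [].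
  by apply: closed_comp; [move=> x _; exact: norm_continuous|exact: closed_le].
- by exists 0; rewrite /U /= normr0 divr_ge0// ltW.
exists x => //; have E : x = w - (u x - x) := xT.
apply/eqP; rewrite -subr_eq0; apply/eqP.
have -> : u x - w = x - (w - (u x - x)) by apply/matrixP => i j; rewrite !mxE; ring.
by rewrite -E subrr.
Qed.

(** The difference g of u and the identity is 1/2-Lipschitz, so u expands
distances at least by 1/2 and the equation u x = w is solved by iteration. *)
Lemma inverse_function : exists s : 'rV[R]_m -> 'rV[R]_m,
  [/\ forall w : 'rV[R]_m, `|w| < d / 4 -> `|s w| < d /\ u (s w) = w,
      forall x : 'rV[R]_m, `|x| < d -> `|u x| < d / 4 -> s (u x) = x &
      forall w : 'rV[R]_m, `|w| < d / 4 ->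
        Du (s w) \in unitmx /\ hasjac s w (invmx (Du (s w)))].
Proof.
have /choice[s sP] : forall w : 'rV[R]_m, exists x : 'rV[R]_m,
    `|w| < d / 4 -> `|x| <= d / 2 /\ u x = w.
  move=> w; have [wd|wd] := boolP (`|w| < d / 4); last by exists 0.
  by have [x xd ux] := solve wd; exists x.
have sd (w : 'rV[R]_m) : `|w| < d / 4 -> `|s w| < d.
  by move=> /sP[H _]; move: H d_gt0; lra.
have su (w : 'rV[R]_m) : `|w| < d / 4 -> u (s w) = w by move=> /sP[].
exists s; split=> [w wd|x xd ux|w wd].
- by split; [exact: sd|exact: su].
- apply/eqP; rewrite -subr_eq0 -normr_le0.
  have := expand xd (sd _ ux); rewrite su// subrr normr0 mulr0; exact.
have Dunit := Du_unit (sd w wd); split=> //.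
apply/hasjacP => e e0.
set A := Du (s w) in Dunit *; pose c := m%:R * `|invmx A| + 1.
have c0 : 0 < c by rewrite ltr_wpDl// mulr_ge0.
have e1 : 0 < e / (2 * c) by rewrite divr_gt0// mulr_gt0.
have /hasjacP/(_ _ e1)/nbhs_norm0P[r /= r0 rP] := uj (sd w wd).
apply/nbhs_norm0P; exists (Num.min (d / 4 - `|w|) (r / 2)).
  by rewrite /= lt_min subr_gt0 wd divr_gt0.
move=> k /=; rewrite lt_min => /andP[k1 k2].
have wk : `|w + k| < d / 4 by rewrite (le_lt_trans (ler_normD _ _))//; lra.
pose h := s (w + k) - s w.
have hk : `|h| <= 2 * `|k|.
  have := expand (sd w wd) (sd _ wk); rewrite !su//.
  by have -> : w + k - w = k by rewrite addrC addKr.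
have := rP h; rewrite /= => /(_ ltac:(lra)).
rewrite /h subrKC !su// -/h.
have -> : w + k - w = k by rewrite addrC addKr.
move=> H.
have -> : h - k *m invmx A = - ((k - h *m A) *m invmx A).
  by rewrite mulmxBl mulmxK// opprB.
rewrite normrN (le_trans (mulmx_norm_le _ _))//.
rewrite (le_trans (y := c * `|k - h *m A|))//.
  by rewrite mulrAC ler_wpM2r// /c lerDl.
rewrite (le_trans (ler_wpM2l (ltW c0) H))//.
rewrite (le_trans (y := c * (e / (2 * c) * (2 * `|k|))))//.
  by rewrite ler_wpM2l ?(ltW c0)// ler_wpM2l// ltW.
by rewrite le_eqVlt; apply/orP; left; apply/eqP; field; rewrite gt_eqF.
Qed.

End InverseFunction.

(** * Linearization of a holomorphic gradient field *)

Section Translation.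
Context {R : realType}.

Lemma hasjac_shift (K : numFieldType) m n (f : 'rV[K]_m -> 'rV[K]_n) (a x : 'rV[K]_m) A :
  hasjac f (a + x) A -> hasjac (fun y => f (a + y)) x A.
Proof.
move=> fA; rewrite -[A]mul1mx; apply: (@hasjac_comp _ _ _ _ (fun y => a + y) f) => //.
by rewrite -[1%:M]add0r; apply: hasjacD; [exact: hasjac_cst|exact: hasjac_id].
Qed.

Lemma is_derive_shift_dom (V W : normedModType R) (f : V -> W) (a x v : V) df :
  is_derive (a + x) v f df -> is_derive x v (fun y => f (a + y)) df.
Proof.
have E : (fun h : R => h^-1 *: (f (a + (h *: v + x)) - f (a + x))) =
         (fun h : R => h^-1 *: (f (h *: v + (a + x)) - f (a + x))).
  by apply/funext => h; rewrite addrCA.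
move=> [D E']; split; first by rewrite /derivable /= E.
by rewrite -E' /derive /= E.
Qed.

Lemma continuous_shift_dom (V : normedModType R) (W : topologicalType) (f : V -> W) (a x : V) :
  {for a + x, continuous f} -> {for x, continuous (fun y => f (a + y))}.
Proof.
move=> fc; apply: (@cvg_comp _ _ _ (fun y => a + y) f (nbhs x) (nbhs (a + x))) => //.
by apply: cvgD; [exact: cvg_cst|exact: cvg_id].
Qed.

End Translation.

Section KahlerLinearization.
Context {R : realType} {n : nat}.
Local Notation V := ('rV[R]_(n + n)).
Local Notation J := (Jmx : 'M[R]_(n + n)).
Variables (U : set V) (G : V -> 'M[R]_(n + n)) (f : V -> R) (X : V -> V)
  (DX : V -> 'M[R]_(n + n)).
Hypothesis oU : open U.
Hypothesis Gs : forall i j, smooth_on U (fun x => G x i j).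
Hypothesis fs : smooth_on U f.
Hypothesis Gsym : forall x, U x -> (G x)^T = G x.
Hypothesis GJ : forall x, U x -> J *m G x *m J^T = G x.
Hypothesis Gpos : forall x v : V, U x -> v != 0 -> 0 < (v *m G x *m v^T) 0 0.
Hypothesis omega_closed : forall x i j k, U x ->
  partial i (fun y => (J *m G y) j k) x + partial j (fun y => (J *m G y) k i) x +
  partial k (fun y => (J *m G y) i j) x = 0.
Hypothesis XG : forall x, U x -> X x *m G x = \row_i partial i f x.
Hypothesis Xj : forall x, U x -> hasjac X x (DX x).
Hypothesis DXJ : forall x, U x -> DX x *m J = J *m DX x.

Lemma Jmx_norm_le (w : V) : `|w *m J| <= `|w|.
Proof.
rewrite -[w in `|w *m _|]hsubmxK /Jmx mul_row_block !mulmx0 mulmxN !mulmx1 add0r addr0.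
apply/mx_norm_leP => // i j; rewrite mxE.
by case: (fintype.split j) => k; rewrite !mxE ?normrN; exact: entry_norm_le.
Qed.

(** The linearization is carried out for the Killing field K = X J, recentered
at the zero a.  The linearizing map is holomorphic, so it linearizes X = - K J
along with K. *)
Lemma kahler_linearization (a : V) : U a -> X a = 0 ->
  exists (u : V -> V) (Du : V -> 'M[R]_(n + n)) (rho : R),
  [/\ 0 < rho, forall x : V, `|x| < rho -> U (a + x), u 0 = 0, Du 0 = 1%:M &
   forall x : V, `|x| < rho ->
    [/\ hasjac u x (Du x), Du x *m J = J *m Du x, X (a + x) *m Du x = u x *m DX a &
      forall v : V, `|v *m (Du x - 1%:M)| <= 2^-1 * `|v|]].
Proof.
move=> Ua Xa0.
have [r r0 rU] : exists2 r, 0 < r & forall x : V, `|x| < r -> U (a + x).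
  have : \forall y \near a, U y by exact: open_nbhs_nbhs.
  case/nbhs_normP => r /= r0 rU.
  by exists r => // x xr; apply: rU; rewrite /= opprD addrA subrr sub0r normrN.
pose K x := X (a + x) *m J; pose DK x := DX (a + x) *m J.
pose DG l x : 'M[R]_(n + n) := \matrix_(i, j) partial l (fun y => G y i j) (a + x).
have Kj (x : V) : `|x| < r -> hasjac K x (DK x).
  move=> /rU Ux; exact: (hasjac_comp (hasjac_shift (Xj Ux)) (hasjac_mulmx J _)).
have DKc (x : V) : `|x| < r -> {for x, continuous DK}.
  move=> /rU Ux.
  have c1 : (fun y => DX (a + y)) @ x --> DX (a + x).
    apply: continuous_shift_dom.
    exact: (gradient_jac_continuous oU Gs fs Gpos XG Xj Ux).
  exact: (cvg_mulmx c1 (cvg_cst J)).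
have DKJ (x : V) : `|x| < r -> DK x *m J = J *m DK x.
  by move=> /rU Ux; rewrite /DK DXJ// -!mulmxA DXJ.
have Gd (x v : V) : `|x| < r ->
    is_derive x v (fun y => G (a + y)) (\sum_l v 0 l *: DG l x).
  by move=> /rU Ux; apply: is_derive_shift_dom; exact: (metric_derive oU Gs v Ux).
have Gc (x : V) : `|x| < r -> {for x, continuous (fun y => G (a + y))}.
  by move=> /rU Ux; apply: continuous_shift_dom; exact: (metric_continuous Gs Ux).
have DGc l (x : V) : `|x| < r -> {for x, continuous (DG l)}.
  move=> /rU Ux; apply: (continuous_shift_dom (a := a)
    (f := fun y => \matrix_(i, j) partial l (fun z => G z i j) y)).
  exact: (metric_partial_continuous (l := l) Gs Ux).
have Gp (x v : V) : `|x| < r -> v != 0 -> 0 < (v *m G (a + x) *m v^T) 0 0.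
  by move=> /rU; exact: Gpos.
have kill (x : V) : `|x| < r ->
    DK x *m G (a + x) + \sum_l K x 0 l *: DG l x + G (a + x) *m (DK x)^T = 0.
  by move=> /rU Ux; exact: (gradient_killing oU Gs fs Gsym GJ omega_closed XG Xj DXJ Ux).
have K0 : K 0 = 0 by rewrite /K addr0 Xa0 mul0mx.
have [r2 [L [r20 r2r L0 approx]]] :=
  almost_linearization r0 Kj DKc DKJ Gd Gc DGc Gp kill K0.
have r2r' : r2 < r by move: r2r r0; lra.
have [kap kap0 Kb] : exists2 M, 0 < M & forall x : V, `|x| <= r2 -> `|K x| <= M.
  apply: (@compact_norm_bound R _ [set x : V | `|x| <= r2] _ K).
    exact: compact_closed_ball0.
  move=> x xr; apply: (hasjac_continuous (A := DK x)).
  by apply: Kj; exact: le_lt_trans xr r2r'.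
have [u [Du [rho [C [rho0 C0 u0 Du0 P]]]]] :=
  exact_linearization JmxJ Jmx_norm_le r20 L0 Kb approx.
(* The bound 1 / (2 C) makes the C-Lipschitz Jacobian 1/2-close to Du 0 = 1. *)
pose d := Num.min (Num.min rho r) (2^-1 / C).
exists u, Du, d; split=> //.
- by rewrite !lt_min rho0 r0 divr_gt0// invr_gt0.
- by move=> x; rewrite !lt_min => /andP[/andP[_ xr] _]; exact: rU.
move=> x; rewrite !lt_min => /andP[/andP[xrho xr] xC].
have z : `|0 : V| < rho by rewrite normr0.
have [ux DuJ E _] := P x xrho; split=> //.
  have -> : X (a + x) = - (K x *m J) by rewrite /K -mulmxA JmxJ mulmxN mulmx1 opprK.
  rewrite mulNmx -mulmxA -DuJ mulmxA E -mulmxA /DK addr0 -mulmxA JmxJ mulmxN mulmx1.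
  by rewrite mulmxN opprK.
move=> v; have [_ _ _ /(_ x v xrho)] := P 0 z.
rewrite Du0 subr0 => /le_trans; apply; rewrite ler_wpM2r//.
by move: (ltW xC); rewrite ler_pdivlMr// mulrC.
Qed.

End KahlerLinearization.

(** * Real and complex coordinates *)

Lemma continuous_dist (K1 K2 : numFieldType) (V : normedModType K1)
    (W : normedModType K2) (f : V -> W) (x : V) :
  (forall e, 0 < e -> exists2 d, 0 < d & forall y, `|x - y| < d -> `|f x - f y| <= e) ->
  {for x, continuous f}.
Proof.
move=> H; apply/cvgrPdist_le => e /H[d d0 dP].
by apply/nbhs_normP; exists d.
Qed.

Section ComplexReal.
Context {R : realType}.
Local Notation C := R[i].
Local Notation J := Jmx.

Section Algebra.
Context {n : nat}.
Implicit Types (z : 'rV[C]_n) (x : 'rV[R]_(n + n)).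

Lemma to_realK : cancel (@to_real R n) to_complex.
Proof.
move=> z; apply/rowP => j; rewrite !mxE.
rewrite (unsplitK (inl j)) (unsplitK (inr j)) !mxE.
by case: (z 0 j).
Qed.

Lemma to_complexK : cancel (@to_complex R n) to_real.
Proof.
move=> x; rewrite -[RHS]hsubmxK; congr row_mx; apply/rowP => j; rewrite !mxE /=;
  by congr (x _ _); apply/val_inj.
Qed.

Lemma to_realD z z' : to_real (z + z') = to_real z + to_real z'.
Proof.
rewrite /to_real add_row_mx; congr row_mx; apply/rowP => j; rewrite !mxE;
  by case: (z 0 j) (z' 0 j) => [a b] [a' b'].
Qed.

Lemma to_realN z : to_real (- z) = - to_real z.
Proof.
rewrite /to_real opp_row_mx; congr row_mx; apply/rowP => j; rewrite !mxE;
  by case: (z 0 j).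
Qed.

Lemma to_realB z z' : to_real (z - z') = to_real z - to_real z'.
Proof. by rewrite to_realD to_realN. Qed.

Lemma to_complexD x x' : to_complex (x + x') = to_complex x + to_complex x'.
Proof. by apply: (can_inj to_realK); rewrite to_realD !to_complexK. Qed.

Lemma to_complexB x x' : to_complex (x - x') = to_complex x - to_complex x'.
Proof. by apply: (can_inj to_realK); rewrite to_realB !to_complexK. Qed.

Lemma to_real0 : to_real (0 : 'rV[C]_n) = 0.
Proof. by rewrite -(subrr 0) to_realB subrr. Qed.

Lemma to_complex0 : to_complex (0 : 'rV[R]_(n + n)) = 0 :> 'rV[C]_n.
Proof. by rewrite -(subrr 0) to_complexB subrr. Qed.

End Algebra.

(** Right multiplication by L = P + iQ, in the coordinates (x, y) of x + iy. *)
Definition realify {n p : nat} (L : 'M[C]_(n, p)) : 'M[R]_(n + n, p + p) :=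
  block_mx (map_mx (@complex.Re R) L) (map_mx (@complex.Im R) L)
           (- map_mx (@complex.Im R) L) (map_mx (@complex.Re R) L).

Definition complexify {n p : nat} (A : 'M[R]_(n + n, p + p)) : 'M[C]_(n, p) :=
  \matrix_(i, j) Complex (ulsubmx A i j) (ursubmx A i j).

Lemma ReD (a b : C) : complex.Re (a + b) = complex.Re a + complex.Re b.
Proof. by case: a b => [? ?] [? ?]. Qed.
Lemma ImD (a b : C) : complex.Im (a + b) = complex.Im a + complex.Im b.
Proof. by case: a b => [? ?] [? ?]. Qed.
Lemma ReM (a b : C) : complex.Re (a * b) =
  complex.Re a * complex.Re b - complex.Im a * complex.Im b.
Proof. by case: a b => [? ?] [? ?]. Qed.
Lemma ImM (a b : C) : complex.Im (a * b) =
  complex.Re a * complex.Im b + complex.Im a * complex.Re b.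
Proof. by case: a b => [? ?] [? ?]. Qed.

Lemma Re_mulmx n p q (A : 'M[C]_(n, p)) (B : 'M[C]_(p, q)) :
  map_mx (@complex.Re R) (A *m B) = map_mx (@complex.Re R) A *m map_mx (@complex.Re R) B -
    map_mx (@complex.Im R) A *m map_mx (@complex.Im R) B.
Proof.
apply/matrixP => i j; rewrite !mxE (big_morph _ ReD (erefl : complex.Re 0 = 0)).
by rewrite -sumrB; apply: eq_bigr => k _; rewrite !mxE ReM.
Qed.

Lemma Im_mulmx n p q (A : 'M[C]_(n, p)) (B : 'M[C]_(p, q)) :
  map_mx (@complex.Im R) (A *m B) = map_mx (@complex.Re R) A *m map_mx (@complex.Im R) B +
    map_mx (@complex.Im R) A *m map_mx (@complex.Re R) B.
Proof.
apply/matrixP => i j; rewrite !mxE (big_morph _ ImD (erefl : complex.Im 0 = 0)).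
by rewrite -big_split; apply: eq_bigr => k _; rewrite !mxE ImM.
Qed.

Lemma to_real_mulmx n p (z : 'rV[C]_n) (L : 'M[C]_(n, p)) :
  to_real (z *m L) = to_real z *m realify L.
Proof.
rewrite /to_real mul_row_block Re_mulmx Im_mulmx mulmxN; congr row_mx.
Qed.

Lemma realifyM n p q (A : 'M[C]_(n, p)) (B : 'M[C]_(p, q)) :
  realify (A *m B) = realify A *m realify B.
Proof.
rewrite /realify mulmx_block Re_mulmx Im_mulmx !mulmxN !mulNmx opprD; congr block_mx.
- by rewrite addrC.
- by rewrite addrC.
Qed.

Lemma realifyJ n (L : 'M[C]_n) : realify L *m J = J *m realify L.
Proof.
rewrite /realify /Jmx !mulmx_block !mulmx0 !mul0mx !mulmx1 !mul1mx !add0r !addr0.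
by rewrite !mulmxN !mulNmx !mulmx1 !mul1mx ?opprK.
Qed.

(** Real matrices that commute with J are complex linear. *)
Lemma complexifyK n (A : 'M[R]_(n + n)) : A *m J = J *m A -> realify (complexify A) = A.
Proof.
rewrite -{1 2}(submxK A) /Jmx !mulmx_block !mulmx0 !mul0mx !mulmx1 !mul1mx !add0r !addr0.
rewrite !mulmxN !mulNmx !mulmx1 !mul1mx => /eq_block_mx[e1 e2 e3 e4].
rewrite -[RHS]submxK /realify -e1 -e2 ?opprK; congr block_mx; apply/matrixP => i j; rewrite !mxE //.
Qed.

Lemma realify_inj n p : injective (@realify n p).
Proof.
move=> A B /eq_block_mx[/matrixP e1 /matrixP e2 _ _]; apply/matrixP => i j.
have := e1 i j; have := e2 i j; rewrite !mxE.
by case: (A i j) (B i j) => [? ?] [? ?] /= -> ->.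
Qed.

Lemma normc_ge_Im (z : C) : `|complex.Im z|%:C%C <= `|z|.
Proof.
rewrite normc_def lecR -sqrtr_sqr ler_wsqrtr// lerDr; exact: sqr_ge0.
Qed.

Lemma normc_le_ReIm (z : C) : `|z| <= (`|complex.Re z| + `|complex.Im z|)%:C%C.
Proof.
case: z => a b; rewrite normc_def lecR /=.
rewrite -[leRHS]ger0_norm ?addr_ge0// -sqrtr_sqr ler_wsqrtr//.
rewrite sqrrD !real_normK ?num_real// -addrA lerD2l lerDr.
by rewrite mulrn_wge0// mulr_ge0.
Qed.

Section Norms.
Context {n : nat}.
Implicit Types (z : 'rV[C]_n) (x : 'rV[R]_(n + n)).

Lemma norm_to_real z : `|to_real z|%:C%C <= `|z|.
Proof.
have [r rz] : exists r, `|z| = r%:C%C.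
  by exists (complex.Re `|z|); rewrite RRe_real// normr_real.
have r0 : 0 <= r by rewrite -ler0c -rz.
rewrite rz lecR; apply/mx_norm_leP => // i j; rewrite -lecR -rz mxE.
case: (fintype.split j) => k; rewrite mxE.
  by rewrite (le_trans (normc_ge_Re _))// entry_norm_le.
by rewrite (le_trans (normc_ge_Im _))// entry_norm_le.
Qed.

Lemma norm_to_complex x : `|to_complex x| <= (2 * `|x|)%:C%C.
Proof.
apply/mx_norm_leP => [|i j]; first by rewrite ler0c mulr_ge0.
rewrite mxE (le_trans (normc_le_ReIm _))// lecR /= mulr_natl mulr2n.
by rewrite lerD// entry_norm_le.
Qed.

Lemma pos_complexP (e : C) : 0 < e -> exists2 r : R, 0 < r & e = r%:C%C.
Proof.
move=> e0; exists (complex.Re e); last by rewrite RRe_real// gtr0_real.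
by move: e0; rewrite ltcE /= => /andP[].
Qed.

Lemma to_complex_continuous : continuous (@to_complex R n).
Proof.
move=> x; apply: continuous_dist => e /pos_complexP[r r0 ->].
exists (r / 2) => [|y xy]; first by rewrite divr_gt0.
rewrite -to_complexB (le_trans (norm_to_complex _))// lecR.
by move: xy; rewrite ltr_pdivlMr// mulrC => /ltW.
Qed.

Lemma to_real_continuous : continuous (@to_real R n).
Proof.
move=> z; apply: continuous_dist => e e0.
exists e%:C%C => [|y zy]; first by rewrite ltcR.
rewrite -to_realB -lecR (le_trans (norm_to_real _))//.
exact: ltW.
Qed.

End Norms.

Lemma hasjac_realify n p (f : 'rV[C]_n -> 'rV[C]_p) z L :
  hasjac f z L -> hasjac (to_real \o f \o to_complex) (to_real z) (realify L).
Proof.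
move=> /hasjacP fL; apply/hasjacP => e e0.
have e1 : 0 < (e / 2)%:C%C :> C by rewrite ltcR divr_gt0.
have /nbhs_norm0P[_ /= /pos_complexP[d d0 ->] dP] := fL _ e1.
apply/nbhs_norm0P; exists (d / 2); first by rewrite /= divr_gt0.
move=> k /= kd; pose h := to_complex k.
have hk : `|h| <= (2 * `|k|)%:C%C by exact: norm_to_complex.
have hd : `|h| < d%:C%C.
  by rewrite (le_lt_trans hk)// ltcR mulrC -ltr_pdivlMr.
have -> : k *m realify L = to_real (h *m L) by rewrite to_real_mulmx to_complexK.
rewrite to_complexD to_realK -/h -!to_realB.
rewrite -lecR (le_trans (norm_to_real _))// (le_trans (dP h hd))//.
rewrite (le_trans (ler_wpM2l (ltW e1) hk))// -rmorphM lecR.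
by rewrite le_eqVlt; apply/orP; left; apply/eqP; field.
Qed.

Lemma hasjac_complexify n p (F : 'rV[R]_(n + n) -> 'rV[R]_(p + p)) z (L : 'M[C]_(n, p)) :
  hasjac F (to_real z) (realify L) -> hasjac (to_complex \o F \o to_real) z L.
Proof.
move=> /hasjacP FL; apply/hasjacP => _ /pos_complexP[e e0 ->].
have e1 : 0 < e / 2 by rewrite divr_gt0.
have /nbhs_norm0P[d /= d0 dP] := FL _ e1.
apply/nbhs_norm0P; exists d%:C%C; first by rewrite /= ltcR.
move=> h /= hd.
have kd : `|to_real h| < d by rewrite -ltcR (le_lt_trans (norm_to_real _)).
have -> : to_complex (F (to_real (z + h))) - to_complex (F (to_real z)) - h *m L =
    to_complex (F (to_real z + to_real h) - F (to_real z) - to_real h *m realify L).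
  by rewrite !to_complexB to_realD -to_real_mulmx to_realK.
rewrite (le_trans (norm_to_complex _))//.
rewrite (le_trans (y := (2 * (e / 2 * `|to_real h|))%:C%C))//.
  by rewrite lecR ler_pM2l// dP.
rewrite (_ : 2 * (e / 2 * `|to_real h|) = e * `|to_real h|); last by field.
by rewrite rmorphM ler_wpM2l ?norm_to_real// ler0c ltW.
Qed.

End ComplexReal.

(** * Self-adjoint matrices *)

Section SelfAdjoint.
Local Open Scope sesquilinear_scope.
Context {C : numClosedFieldType} {n : nat}.
Implicit Types (L H A B : 'M[C]_n).

Lemma adjmxM p q r (A : 'M[C]_(p, q)) (B : 'M[C]_(q, r)) : (A *m B)^t* = B^t* *m A^t*.
Proof. by rewrite trmx_mul map_mxM. Qed.

Lemma hermsymE H : H^t* = H -> H \is hermsymmx.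
Proof. by move=> HH; apply/is_hermitianmxP; rewrite expr0 scale1r HH. Qed.

(** Writing H = W* W, with W = sqrt d P from the spectral decomposition of H,
conjugation by W* turns L into a Hermitian matrix, to which the spectral theorem
applies. *)
Lemma self_adjoint_diagonalizable L H : H^t* = H ->
  (forall z : 'rV[C]_n, z != 0 -> 0 < (z *m H *m z^t*) 0 0) ->
  L *m H = H *m L^t* ->
  diagonalizable L /\ forall a, eigenvalue L a -> a \is Num.real.
Proof.
move=> HH Hpos LH.
have Hs := hermsymE HH.
have HE := orthomx_spectralP (hermitian_normalmx Hs).
set P := spectralmx H in HE; set d := spectral_diag H in HE.
have Pu : P \in unitmx by exact: spectral_unit.
have PU : P \is unitarymx by exact: spectral_unitarymx.
have Pinv : invmx P = P^t* by exact: invmx_unitary.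
have d0 i : 0 < d 0 i.
  have ri0 : row i P != 0.
    apply: contraTneq Pu => ri0; rewrite -row_free_unit; apply/negP => /row_free_inj inj.
    have : delta_mx 0 i = 0 :> 'rV[C]_n.
      by apply: (inj 1%N); rewrite mul0mx -rowE.
    by move=> /matrixP/(_ 0 i)/eqP; rewrite !mxE !eqxx oner_eq0.
  have := Hpos _ ri0; congr (0 < _).
  have -> : row i P *m H *m (row i P)^t* = row i (diag_mx d) *m (col i 1%:M).
    rewrite HE rowE !mulmxA mulmxK//.
    rewrite adjmxM -Pinv mulmxA -(mulmxA _ P) mulmxV// mulmx1 -rowE; congr (_ *m _).
    by apply/matrixP => k j; rewrite !mxE (ord1 j) eqxx /=; case: (k == i); rewrite ?conjC1 ?conjC0.
  rewrite !mxE (bigD1 i)//= !mxE eqxx mulr1n mulr1 big1 ?addr0// => j ji.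
  by rewrite !mxE (negbTE ji) mulr0.
pose s : 'rV[C]_n := \row_i sqrtC (d 0 i).
have s0 i : 0 < s 0 i by rewrite mxE sqrtC_gt0.
have sstar : (diag_mx s)^t* = diag_mx s.
  rewrite tr_diag_mx map_diag_mx; congr diag_mx; apply/rowP => i.
  by rewrite [LHS]mxE; exact: (geC0_conj (ltW (s0 i))).
pose W := diag_mx s *m P.
have su : diag_mx s \in unitmx.
  by rewrite unitmxE det_diag unitfE; apply/prodf_neq0 => i _; rewrite gt_eqF.
have Wu : W \in unitmx by rewrite unitmx_mul su.
have HW : H = W^t* *m W.
  rewrite adjmxM sstar /W -!mulmxA (mulmxA (diag_mx s)) mulmx_diag HE Pinv !mulmxA.
  congr (_ *m _ *m _); congr diag_mx; apply/rowP => i; rewrite !mxE.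
  by rewrite -expr2 sqrtCK.
clearbody W; have Wsu : W^t* \in unitmx by rewrite map_unitmx unitmx_tr.
pose M := invmx (W^t*) *m L *m W^t*.
have MM : M^t* = M.
  have M2 : M *m W = W *m L^t*.
    have := LH; rewrite HW => /(congr1 (mulmx (invmx (W^t*)))).
    by rewrite !mulmxA mulVmx// mul1mx.
  rewrite !adjmxM trmxCK.
  have -> : (invmx (W^t*))^t* = invmx W.
    by rewrite trmx_inv map_invmx trmxCK.
  by rewrite mulmxA -M2 mulmxK.
have L1 : L = W^t* *m M *m invmx (W^t*).
  by rewrite /M !mulmxA mulmxV// mul1mx mulmxK.
clearbody M; have Ms := hermsymE MM.
have ME := orthomx_spectralP (hermitian_normalmx Ms).
have Mreal := hermitian_spectral_diag_real Ms.
set S := spectralmx M in ME; set e := spectral_diag M in ME Mreal.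
have Su : S \in unitmx by exact: spectral_unit.
pose T := S *m invmx (W^t*).
have Tu : T \in unitmx by rewrite unitmx_mul Su unitmx_inv.
have LT : T *m L = diag_mx e *m T.
  by rewrite L1 /T !mulmxA mulmxKV// {1}ME !mulmxA mulmxV// mul1mx.
clearbody T; split.
  exists T => //; apply/(diagonalizable_forP _ Tu) => i j ij.
  by rewrite LT mulmxK// mxE -val_eqE /= (negbTE ij).
move=> a /eigenvalueP[v vL v0].
pose w := v *m invmx T.
have w0 : w != 0 by apply: contraNneq v0 => w0; rewrite -(mulmxKV Tu v) -/w w0 mul0mx.
have wE : w *m diag_mx e = a *: w.
  have -> : diag_mx e = T *m L *m invmx T by rewrite LT mulmxK.
  by rewrite /w !mulmxA mulmxKV// vL scalemxAl.
have [j wj] : exists j, w 0 j != 0.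
  apply/existsP; apply: contraNT w0 => /existsPn wz; apply/eqP/rowP => j.
  by rewrite [RHS]mxE; apply/eqP; have := wz j; rewrite negbK.
have /matrixP/(_ 0 j) := wE; rewrite mul_mx_diag [LHS]mxE [RHS]mxE => /eqP.
rewrite mulrC (inj_eq (mulIf wj)) => /eqP <-.
by have /mxOverP := Mreal; apply.
Qed.

End SelfAdjoint.

Section KahlerSelfAdjoint.
Local Open Scope sesquilinear_scope.
Context {R : realType} {n : nat}.
Local Notation C := R[i].
Local Notation J := Jmx.

Lemma realify_adj p q (A : 'M[C]_(p, q)) : realify (A^t*) = (realify A)^T.
Proof.
rewrite /realify tr_block_mx; congr block_mx; apply/matrixP => i j; rewrite !mxE;
  by case: (A j i) => x y; rewrite /= ?opprK.
Qed.

(** A J-invariant symmetric G commutes with J, so it is the real form of a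
Hermitian matrix, for which L is self-adjoint. *)
Lemma kahler_self_adjoint (S G : 'M[R]_(n + n)) (L : 'M[C]_n) : realify L = S ->
  G^T = G -> J *m G *m J^T = G ->
  (forall v : 'rV[R]_(n + n), v != 0 -> 0 < (v *m G *m v^T) 0 0) ->
  S *m G = G *m S^T ->
  diagonalizable L /\ forall a, eigenvalue L a -> a \is Num.real.
Proof.
move=> LS GT GJ Gpos SG.
have GJc : G *m J = J *m G.
  by rewrite -{1}GJ Jmx_tr mulmxN mulNmx -mulmxA JmxJ mulmxN mulmx1 opprK.
have HG := complexifyK GJc; set H := complexify G in HG.
apply: (@self_adjoint_diagonalizable _ _ L H).
- by apply: realify_inj; rewrite realify_adj HG.
- move=> z z0.
  have E : realify (z *m H *m z^t*) = realify z *m G *m (realify z)^T.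
    by rewrite !realifyM realify_adj HG.
  have Ht : (z *m H *m z^t*)^t* = z *m H *m z^t*.
    rewrite !adjmxM trmxCK mulmxA; congr (_ *m _ *m _).
    by apply: realify_inj; rewrite realify_adj HG.
  have re : complex.Re ((z *m H *m z^t*) 0 0) = (to_real z *m G *m (to_real z)^T) 0 0.
    have := congr1 (fun M : 'M[R]_(1 + 1) => M (lshift 1 0) (lshift 1 0)) E.
    rewrite /realify block_mxEul [LHS]mxE => ->.
    have -> : block_mx (map_mx (@complex.Re R) z) (map_mx (@complex.Im R) z)
       (- map_mx (@complex.Im R) z) (map_mx (@complex.Re R) z) =
       col_mx (to_real z) (row_mx (- map_mx (@complex.Im R) z) (map_mx (@complex.Re R) z)).
      by rewrite block_mxEv.
    by rewrite tr_col_mx mul_col_mx mul_col_row block_mxEul.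
  have im : complex.Im ((z *m H *m z^t*) 0 0) = 0.
    have /matrixP/(_ 0 0) := Ht; rewrite [LHS]mxE [(_^T) 0 0]mxE.
    case: ((z *m H *m z^t*) 0 0) => x y E1.
    have H1 : - y = y := congr1 (@complex.Im R) E1.
    by rewrite /=; move: H1; lra.
  rewrite ltcE im re /= eqxx /=; apply: Gpos.
  by apply: contraNneq z0 => tz; rewrite -(to_realK z) tz to_complex0.
- by apply: realify_inj; rewrite !realifyM realify_adj LS HG.
Qed.

End KahlerSelfAdjoint.

(** * Changes of charts *)

Lemma invmx_comm (F : fieldType) m (A B : 'M[F]_m) : A \in unitmx ->
  A *m B = B *m A -> invmx A *m B = B *m invmx A.
Proof.
move=> Au AB; rewrite -[LHS](mulmxK Au) -(mulmxA (invmx A)) -AB mulmxA.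
by rewrite mulVmx// mul1mx.
Qed.

Section ChartChange.
Context {R : realType} {n : nat} {M : complexManifold R n}.
Local Notation C := R[i].
Implicit Types (c d : chart R n M) (p q : M).

Lemma chart_bwdK c : is_chart c -> forall z, (fwd c @` dom c) z ->
  dom c (bwd c z) /\ fwd c (bwd c z) = z.
Proof. by move=> [_ _ fK _ _] _ [q qc <-]; rewrite fK. Qed.

Lemma chart_fwd_continuous c q : is_chart c -> dom c q -> {for q, continuous (fwd c)}.
Proof.
move=> [oc _ _ fc _] qc; move: fc; rewrite continuous_open_subspace// => /(_ q).
by apply; rewrite inE.
Qed.

Lemma chart_bwd_continuous c z : is_chart c -> (fwd c @` dom c) z ->
  {for z, continuous (bwd c)}.
Proof.
move=> [_ oc _ _ fc] zc; move: fc; rewrite continuous_open_subspace// => /(_ z).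
by apply; rewrite inE.
Qed.

Lemma open_preimage_at (T1 T2 : topologicalType) (f : T1 -> T2) (A : set T1) (B : set T2) :
  open A -> open B -> (forall x, A x -> B (f x) -> {for x, continuous f}) ->
  open [set x | A x /\ B (f x)].
Proof.
move=> oA oB fc; rewrite openE => x [Ax Bx].
have nA : nbhs x A by exact: open_nbhs_nbhs.
have nB : nbhs x (f @^-1` B) by apply: (fc x Ax Bx); exact: open_nbhs_nbhs.
exact: filterI nA nB.
Qed.

(** The atlas is maximal, so compatibility with its charts suffices; it holds
because phi and psi are holomorphic. *)
Lemma chart_change c (phi psi : 'rV[C]_n -> 'rV[C]_n) (D D' : set 'rV[C]_n) :
  atlas c -> open D -> open D' -> D `<=` fwd c @` dom c ->
  (forall z, D z -> [/\ D' (phi z), psi (phi z) = z & differentiable phi z]) ->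
  (forall w, D' w -> [/\ D (psi w), phi (psi w) = w & differentiable psi w]) ->
  atlas (Chart [set q | dom c q /\ D (fwd c q)] (phi \o fwd c) (bwd c \o psi)).
Proof.
move=> ac oD oD' Dc phiP psiP; have cc := atlas_chart ac; have [oc oi fK fc bc] := cc.
set w := Chart _ _ _.
have ow : open (dom w).
  apply: (open_preimage_at oc oD) => q qc _; exact: chart_fwd_continuous.
have imw : fwd w @` dom w = D'.
  apply/seteqP; split=> [_ [q [qc Dq] <-]|v D'v]; first by have [] := phiP _ Dq.
  have [Dv pv _] := psiP v D'v; have [q qc qv] := Dc _ Dv.
  by exists q; rewrite /= qv.
have wc : is_chart w.
  split; [exact: ow|by rewrite imw| | |].
  - by move=> q [qc Dq] /=; have [_ -> _] := phiP _ Dq; exact: fK.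
  - rewrite continuous_open_subspace// => q; rewrite inE => -[qc Dq].
    have [_ _ dphi] := phiP _ Dq.
    apply: continuous_comp; first exact: chart_fwd_continuous.
    exact: differentiable_continuous.
  - rewrite imw continuous_open_subspace// => v; rewrite inE => D'v.
    have [Dv _ dpsi] := psiP v D'v.
    apply: continuous_comp; first exact: differentiable_continuous.
    by apply: chart_bwd_continuous => //; exact: Dc.
apply: (atlas_maximal wc) => d ad q [qc Dq] qd.
have [cd dc] := atlas_compatible ac ad qc qd.
have [D'q psiK dphi] := phiP _ Dq; have [_ _ dpsi] := psiP _ D'q.
have [_ _ dK _ _] := atlas_chart ad.
have dcq : transition d c (fwd d q) = fwd c q by rewrite /transition /= dK.
have d1 : differentiable (transition c d \o psi) (phi (fwd c q)).
  by apply: differentiable_comp; [exact: dpsi|rewrite psiK; exact: cd].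
have d2 : differentiable (phi \o transition d c) (fwd d q).
  by apply: differentiable_comp; [exact: dc|rewrite dcq; exact: dphi].
by split; [exact: d1|exact: d2].
Qed.

End ChartChange.

(** * Gradient solitons *)

Section Soliton.
Context {R : realType} {n : nat} {M : complexManifold R n}.
Local Notation C := R[i].
Local Notation J := (Jmx : 'M[R]_(n + n)).
Variables (g : metric_tensor M) (Z : vector_field M) (f : M -> R).
Hypothesis g_kahler : kahler_metric g.
Hypothesis fs : smooth_function f.
Hypothesis Z_hol : holomorphic_vector_field Z.
Hypothesis Z_grad : half_gradient_field g f Z.

Variables (c : chart R n M) (p : M).
Hypothesis ac : atlas c.
Hypothesis pc : dom c p.
Hypothesis Zp : Z c p = 0.

Let cc : is_chart c. Proof. exact: atlas_chart. Qed.
Let U := real_image c.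
Let G := in_real c (g c).
Let F := in_complex c (Z c).
(* In real coordinates the components of Z are those of grad f. *)
Let X := to_real \o F \o to_complex.
Let DX (x : 'rV[R]_(n + n)) := realify ('J F (to_complex x)).

Let oU : open U.
Proof.
apply: open_comp => [x _|]; first exact: to_complex_continuous.
by have [] := cc.
Qed.

Let UP x : U x -> dom c (bwd c (to_complex x)) /\ fwd c (bwd c (to_complex x)) = to_complex x.
Proof. exact: chart_bwdK. Qed.

Let Gs i j : smooth_on U (fun x => G x i j).
Proof. by have [[_ H _ _] _ _] := g_kahler; exact: H. Qed.

Let Gsym x : U x -> (G x)^T = G x.
Proof. by move=> /UP[q _]; have [[_ _ H _] _ _] := g_kahler; exact: H. Qed.

Let Gpos (x v : 'rV[R]_(n + n)) : U x -> v != 0 -> 0 < (v *m G x *m v^T) 0 0.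
Proof. by move=> /UP[q _]; have [[_ _ _ H] _ _] := g_kahler; exact: H. Qed.

Let GJ x : U x -> J *m G x *m J^T = G x.
Proof. by move=> /UP[q _]; have [_ H _] := g_kahler; exact: H. Qed.

Let omega_closed x i j k : U x ->
  partial i (fun y => (J *m G y) j k) x + partial j (fun y => (J *m G y) k i) x +
  partial k (fun y => (J *m G y) i j) x = 0.
Proof. by move=> Ux; have [_ _ H] := g_kahler; exact: (H c x i j k ac Ux). Qed.

(* The d/dx^j components of Z and of (u - i J u) / 2 are Z^j / 2 and
(u_j + i u_(n+j)) / 2: the second one because (u J)_j = - u_(n+j). *)
Let X_gradient x : U x -> X x = gradient G (in_real c f) x.
Proof.
move=> Ux; have := Z_grad ac Ux; set z := in_real c (Z c) x; set u := gradient _ _ _.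
move=> H; suff zu : z = to_complex u.
  by have -> : X x = to_real z by []; rewrite zu to_complexK.
apply/rowP => j; rewrite mxE.
have uJ : (u *m J) 0 (lshift n j) = - u 0 (rshift n j).
  rewrite -[in LHS](hsubmxK u) /Jmx mul_row_block !mulmx0 mulmxN !mulmx1 !add0r addr0.
  by rewrite row_mxEl !mxE.
have E : (map_mx (@real_complex R) u - 'i%C *: map_mx (@real_complex R) (u *m J)) 0 (lshift n j)
    = (u 0 (lshift n j))%:C%C - 'i%C * ((u *m J) 0 (lshift n j))%:C%C.
  by rewrite [LHS]mxE; congr (_ + _); rewrite [LHS]mxE //; congr (- _);
    rewrite [LHS]mxE; congr (_ * _); rewrite [LHS]mxE.
have /matrixP/(_ 0 (lshift n j)) := H.
rewrite /hol_vector row_mxEl [LHS]mxE /type10_part [RHS]mxE E uJ.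
have t0 : (2^-1 : C) != 0 by rewrite invr_eq0 pnatr_eq0.
move/(mulfI t0) => ->.
by apply/eqP; rewrite eq_complex /=; apply/andP; split; apply/eqP; ring.
Qed.

Let XG x : U x -> X x *m G x = \row_i partial i (in_real c f) x.
Proof.
move=> Ux; rewrite X_gradient// /gradient mulmxKV//.
exact: (metric_unit Gpos Ux).
Qed.

Let Xj x : U x -> hasjac X x (DX x).
Proof.
move=> Ux; have [qc qx] := UP Ux.
rewrite -[x in hasjac _ x]to_complexK; apply: hasjac_realify.
apply/hasjac_differentiable; split=> //; rewrite -qx; exact: (Z_hol.2 _ _ ac qc).
Qed.

Let DXJ x : U x -> DX x *m J = J *m DX x.
Proof. by move=> _; exact: realifyJ. Qed.

Let a := to_real (fwd c p).

Let Ua : U a.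
Proof. by rewrite /U /real_image /= to_realK; exists p. Qed.

Let pK : bwd c (fwd c p) = p.
Proof. by have [_ _ H _ _] := cc; exact: H. Qed.

Let Xa : X a = 0.
Proof.
by rewrite /X /= to_realK /F /in_complex pK Zp to_real0.
Qed.

Let L := 'J F (fwd c p).

Let DXa : DX a = realify L.
Proof. by rewrite /DX /a to_realK. Qed.

(** At a zero of Z the term Z dV of the bracket vanishes. *)
Lemma soliton_linear_part : is_linear_part Z p c L.
Proof.
move=> V _; rewrite /lie_bracket.
by rewrite {2}/in_complex pK Zp mul0mx subr0.
Qed.

Lemma soliton_linear_part_diagonalizable :
  diagonalizable L /\ forall b, eigenvalue L b -> b \is Num.real.
Proof.
apply: (kahler_self_adjoint (esym DXa) (Gsym Ua) (GJ Ua)).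
  by move=> v; exact: Gpos.
exact: (zero_self_adjoint oU Gs (fs ac) Gsym XG Xj Ua Xa).
Qed.

(** The real linearizing map commutes with J, so it is a holomorphic change of
coordinates near the zero; in the new chart the components of Z are linear. *)
Lemma soliton_linearizable : linearizable_at Z p.
Proof.
have [u [Du [d [d0 dU u0 Du0 uP]]]] :=
  kahler_linearization oU Gs (fs ac) Gsym GJ Gpos omega_closed XG Xj DXJ Ua Xa.
have uj (x : 'rV[R]_(n + n)) : `|x| < d -> hasjac u x (Du x) by move=> /uP[].
have Du1 (x v : 'rV[R]_(n + n)) : `|x| < d -> `|v *m (Du x - 1%:M)| <= 2^-1 * `|v|.
  by move=> /uP[].
have [s [sP su sj]] := inverse_function d0 u0 uj Du1.
have [phi phiE] : exists phi : 'rV[C]_n -> 'rV[C]_n,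
  phi = to_complex \o (fun y => u (- a + y)) \o to_real by eexists.
have [psi psiE] : exists psi : 'rV[C]_n -> 'rV[C]_n,
  psi = to_complex \o (fun y => a + s y) \o to_real by eexists.
have to_real_phi z : to_real (phi z) = u (- a + to_real z).
  by rewrite phiE /comp to_complexK.
have to_real_psi w : to_real (psi w) = a + s (to_real w).
  by rewrite psiE /comp to_complexK.
(* The inverse of u is controlled on the ball of radius d / 4. *)
pose D : set 'rV[C]_n := [set z | `|- a + to_real z| < d /\ `|u (- a + to_real z)| < d / 4].
pose D' : set 'rV[C]_n := [set w | `|to_real w| < d / 4].
have phij (z : 'rV[C]_n) : `|- a + to_real z| < d ->
    hasjac phi z (complexify (Du (- a + to_real z))).
  move=> zd; rewrite phiE; apply: hasjac_complexify; rewrite complexifyK.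
    by apply: hasjac_shift; exact: uj.
  by have [] := uP _ zd.
have psij (w : 'rV[C]_n) : D' w -> hasjac psi w (complexify (invmx (Du (s (to_real w))))).
  move=> wd; have [Dunit sjw] := sj _ wd; rewrite psiE; apply: hasjac_complexify; rewrite complexifyK.
    by rewrite -[invmx _]add0r; exact: (hasjacD (hasjac_cst a (to_real w)) sjw).
  have [sd _] := sP _ wd; have [_ DJ _ _] := uP _ sd.
  exact: (invmx_comm Dunit DJ).
have phiP z : D z -> [/\ D' (phi z), psi (phi z) = z & differentiable phi z].
  move=> [zd uzd]; have [dphi _] := proj1 (hasjac_differentiable _ _ _) (phij z zd).
  split; [by rewrite /D' /mkset to_real_phi| |exact: dphi].
  apply: (can_inj to_realK); rewrite to_real_psi to_real_phi (su _ zd uzd).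
  exact: addNKr.
have psiP w : D' w -> [/\ D (psi w), phi (psi w) = w & differentiable psi w].
  move=> wd; have [dpsi _] := proj1 (hasjac_differentiable _ _ _) (psij w wd).
  have [sd us] := sP _ wd.
  have sw : - a + to_real (psi w) = s (to_real w) by rewrite to_real_psi addKr.
  split; [by rewrite /D /mkset sw us; split| |exact: dpsi].
  by apply: (can_inj to_realK); rewrite to_real_phi sw us.
have oD' : open D'.
  apply: (@open_comp _ _ (fun w : 'rV[C]_n => `|to_real w|) [set x | x < d / 4]) => [w _|].
    apply: continuous_comp; [exact: to_real_continuous|exact: norm_continuous].
  exact: open_lt.
have shc : continuous (fun z : 'rV[C]_n => - a + to_real z).
  have sh (y : 'rV[R]_(n + n)) : {for y, continuous (fun y => - a + y)}.
    exact: (hasjac_continuous (hasjacD (hasjac_cst (- a) y) (hasjac_id y))).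
  move=> z; exact: (continuous_comp (@to_real_continuous R n z) (sh (to_real z))).
have oD : open D.
  have oA : open [set z : 'rV[C]_n | `|- a + to_real z| < d].
    apply: (@open_comp _ _ (fun z : 'rV[C]_n => `|- a + to_real z|) [set x | x < d]) => [w _|].
      apply: continuous_comp; [exact: shc|exact: norm_continuous].
    exact: open_lt.
  have oB : open [set x : 'rV[R]_(n + n) | `|x| < d / 4].
    apply: (@open_comp _ _ (fun x : 'rV[R]_(n + n) => `|x|) [set x | x < d / 4]) => [x _|].
      exact: norm_continuous.
    exact: open_lt.
  apply: (open_preimage_at oA oB) => z zd _.
  apply: continuous_comp; first exact: shc.
  exact: hasjac_continuous (uj _ zd).
have Dc : D `<=` fwd c @` dom c.
  move=> z [zd _]; have := dU _ zd; rewrite addNKr /U /real_image /= to_realK.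
  exact.
have aw := chart_change ac oD oD' Dc phiP psiP.
set w := Chart _ _ _ in aw.
have Dp : D (fwd c p).
  by rewrite /D /mkset -/a addNr u0 normr0; split; [exact: d0|exact: divr_gt0].
exists w; split; [exact: aw|by split| |].
  by apply: (can_inj to_realK); rewrite to_real_phi -/a addNr u0; rewrite to_real0.
exists L => q [qc Dq]; rewrite (Z_hol.1 c w q ac aw qc (conj qc Dq)).
set z := fwd c q; have [zd _] := Dq.
(* The transition to the new chart is phi near fwd c q. *)
have Jw : 'J (transition c w) z = complexify (Du (- a + to_real z)).
  apply: (proj2 (proj1 (hasjac_differentiable _ _ _) _)).
  apply: hasjac_near (phij z zd).
  have [_ oi _ _ _] := cc.
  have nz : nbhs z (fwd c @` dom c) by apply: open_nbhs_nbhs; split; [exact: oi|by exists q].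
  have E y (yc : (fwd c @` dom c) y) : phi y = transition c w y.
    by have [_ yE] := chart_bwdK cc yc; rewrite /transition /= yE.
  exact: (@filterS _ (nbhs z) _ _ _ E nz).
rewrite Jw; apply: (can_inj to_realK).
have [_ DJ E _] := uP _ zd.
rewrite !to_real_mulmx (complexifyK DJ) to_real_phi -DXa -E addNKr.
congr (_ *m _); rewrite /X /= to_realK /F /in_complex /z.
have [_ _ fK _ _] := cc; rewrite (fK q qc); exact: erefl.
Qed.

End Soliton.

Theorem proposition6 (R : realType) (n : nat) (M : complexManifold R n)
    (g : metric_tensor M) (Z : vector_field M)
    (g_soliton : gradient_kahler_ricci_soliton g)
    (Z_hol : holomorphic_vector_field Z)
    (Z_assoc : associated_to_soliton Z g)
    (Z_neq0 : exists p : M, ~ vanishes_at Z p) :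
  forall p : M, vanishes_at Z p ->
    linearizable_at Z p /\
    (forall c : chart R n M, atlas c -> dom c p ->
       exists L : 'M[R[i]]_n,
         is_linear_part Z p c L /\
         diagonalizable L /\
         (forall a : R[i], eigenvalue L a -> a \is Num.real)).
Proof.
move=> p Zp; have [g_kahler _] := g_soliton; have [f [fs _] Z_grad] := Z_assoc.
split=> [|c ac pc].
  have [c ac pc] := atlas_cover p.
  exact: (soliton_linearizable g_kahler fs Z_hol Z_grad ac pc (Zp c ac pc)).
exists ('J (in_complex c (Z c)) (fwd c p)); split.
  exact: (soliton_linear_part ac pc (Zp c ac pc)).
exact: (soliton_linear_part_diagonalizable g_kahler fs Z_hol Z_grad ac pc (Zp c ac pc)).
Qed.
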